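(* Let $A$ be a commutative $C^*$-algebra and let $E_A$ be a countably generated Hilbert $A$-module. If $S,T\in\mathcal L(E_A)$ are such that $ST\in\mathcal L^1(E_A)$ and $TS\in\mathcal L^1(E_A)$, then $\operatorname{tr}ST=\operatorname{tr}TS$ in $A$.
   Context: $\mathcal L(E_A)$ is the $C^*$-algebra of adjointable operators. $\widehat A$ is the space of characters of $A$, so $A\cong C_0(\widehat A)$. For $\chi\in\widehat A$, $\chi_*E_A:=E_A\otimes_A\mathbb C$ (with $A$ acting on $\mathbb C$ via $\chi$), and $\chi_*T:=T\otimes1$ for $T\in\mathcal L(E_A)$. For $1\le p<\infty$, $\mathcal L^p(E_A)$ is the set of $T\in\mathcal L(E_A)$ for which $\operatorname{tr}|T|^p\colon\chi\mapsto\operatorname{tr}|\chi_*T|^p$ lies in $A\cong C_0(\widehat A)$. For $S,T\in\mathcal L^2(E_A)$, $\langle S,T\rangle_2:=\frac14\sum_{k\in\mathbb Z/4\mathbb Z}i^k\operatorname{tr}|T+i^kS|^2\in A$. The trace $\operatorname{tr}\colon\mathcal L^1(E_A)\to A$ is $\operatorname{tr}T:=\langle S^*,|T|^{1/2}\rangle_2$, where $T=S|T|^{1/2}$ is a weak polar decomposition ($S\in\mathcal L(E_A)$, $|S|=|T|^{1/2}$, so that $S,|T|^{1/2}\in\mathcal L^2(E_A)$). Equivalently, $\operatorname{tr}T=\sum_i\langle\mathfrak e_i,T\mathfrak e_i\rangle$ (norm convergent) for any frame $(\mathfrak e_i)$ of $E_A$, i.e. any sequence in $E_A$ with $\langle v,w\rangle=\sum_i\langle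 v,\mathfrak e_i\rangle\langle\mathfrak e_i,w\rangle$ in norm for all $v,w\in E_A$. *)

(* Defs.v *)
From HB Require Import structures.
From mathcomp Require Import all_boot all_order all_algebra.
From mathcomp Require Import all_classical all_reals all_analysis.
From mathcomp Require Import complex.

Set Implicit Arguments.
Unset Strict Implicit.
Unset Printing Implicit Defensive.

Import Order.TTheory GRing.Theory Num.Theory.
Import numFieldNormedType.Exports.

Local Open Scope classical_set_scope.
Local Open Scope complex_scope.
Local Open Scope ring_scope.

(* A commutative C*-algebra need not have a unit, so its product is not the
   one of a MathComp ring. *)
HB.mixin Record isCommCStarAlgebra (R : realType) A
    of CompleteNormedModule R[i] A := {
  cmul : A -> A -> A;
  cstar : A -> A;
  cmulA : forall a b c, cmul a (cmul b c) = cmul (cmul a b) c;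
  cmulC : forall a b, cmul a b = cmul b a;
  cmulDl : forall a b c, cmul (a + b) c = cmul a c + cmul b c;
  cmulZl : forall (z : R[i]) a b, cmul (z *: a) b = z *: cmul a b;
  cmul_norm : forall a b, `|cmul a b| <= `|a| * `|b|;
  cstarK : forall a, cstar (cstar a) = a;
  cstarD : forall a b, cstar (a + b) = cstar a + cstar b;
  cstarZ : forall (z : R[i]) a, cstar (z *: a) = z^* *: cstar a;
  cstarM : forall a b, cstar (cmul a b) = cmul (cstar b) (cstar a);
  cstar_norm : forall a, `|cmul (cstar a) a| = `|a| ^+ 2
}.

#[short(type="commCStarAlgType")]
HB.structure Definition CommCStarAlgebra (R : realType) :=
  {A of isCommCStarAlgebra R A & CompleteNormedModule R[i] A}.

(* Right Hilbert modules; the inner product is linear in its second variable. *)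
HB.mixin Record isHilbertModule (R : realType) (A : commCStarAlgType R) E
    of CompleteNormedModule R[i] E := {
  mact : E -> A -> E;
  ip : E -> E -> A;
  mactDl : forall v w a, mact (v + w) a = mact v a + mact w a;
  mactDr : forall v a b, mact v (a + b) = mact v a + mact v b;
  mactZl : forall (z : R[i]) v a, mact (z *: v) a = z *: mact v a;
  mactZr : forall (z : R[i]) v a, mact v (z *: a) = z *: mact v a;
  mactA : forall v a b, mact (mact v a) b = mact v (cmul a b);
  ipDr : forall u v w, ip u (v + w) = ip u v + ip u w;
  ipZr : forall (z : R[i]) v w, ip v (z *: w) = z *: ip v w;
  ipMr : forall v w a, ip v (mact w a) = cmul (ip v w) a;
  ipC : forall v w, cstar (ip v w) = ip w v;
  ip_ge0 : forall v, exists b : A, ip v v = cmul (cstar b) b;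
  ip_norm : forall v, `|v| ^+ 2 = `|ip v v|
}.

#[short(type="hilbertModType")]
HB.structure Definition HilbertModule (R : realType) (A : commCStarAlgType R) :=
  {E of isHilbertModule R A E & CompleteNormedModule R[i] E}.

Section ComplexAlgebra.
Variable R : realType.
Local Notation C := (R[i]^o).

Let normRe (z : R[i]) : (`|complex.Re z|%:C <= `|z| :> R[i]).
Proof.
case: z => a b; rewrite normc_def lecR /= -sqrtr_sqr ler_wsqrtr //.
by rewrite lerDl sqr_ge0.
Qed.

Let normIm (z : R[i]) : (`|complex.Im z|%:C <= `|z| :> R[i]).
Proof.
case: z => a b; rewrite normc_def lecR /= -sqrtr_sqr ler_wsqrtr //.
by rewrite lerDr sqr_ge0.
Qed.

Let normReIm (z : R[i]) :
  (`|z| <= `|complex.Re z|%:C + `|complex.Im z|%:C :> R[i]).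
Proof.
case: z => a b /=.
have -> : (a +i* b)%C = a%:C + 'i%C * b%:C :> R[i] by simpc.
apply: le_trans (ler_normD _ _) _; rewrite normrM.
rewrite !normc_def /= !expr0n expr1n /= !addr0 add0r sqrtr1 mul1r.
by rewrite !sqrtr_sqr.
Qed.

Let cauchy_part (f : R[i] -> R) (F : set_system C) :
  {morph f : x y / x - y} -> (forall z, (`|f z|%:C <= `|z| :> R[i])) ->
  ProperFilter F -> cauchy F -> cvg (f @ F).
Proof.
move=> fB fle FF /cauchy_ballP Fc; apply/cauchy_cvgP/cauchy_ballP => e e0.
have e0' : (0 < e%:C :> R[i]) by rewrite ltcR.
near_simpl.
have := Fc _ e0'; apply: filterS => -[x y] /=.
rewrite -!ball_normE /= => xy.
rewrite -ltcR; apply: le_lt_trans xy.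
by rewrite -fB; exact: fle.
Qed.

Lemma complex_complete (F : set_system C) : ProperFilter F -> cauchy F -> cvg F.
Proof.
move=> FF Fc.
have ReB : {morph @complex.Re R : x y / x - y} by move=> [? ?] [? ?].
have ImB : {morph @complex.Im R : x y / x - y} by move=> [? ?] [? ?].
have /cvg_ex[/= a Fa] := cauchy_part ReB normRe FF Fc.
have /cvg_ex[/= b Fb] := cauchy_part ImB normIm FF Fc.
apply/cvg_ex; exists (a +i* b)%C; apply/cvgrPdist_lt => e e0.
have eE : e = (complex.Re e)%:C.
  by move: e0; rewrite ltcE => /andP[/eqP + _]; case: e => [? ?] /= ->.
have r0 : 0 < complex.Re e / 2.
  by rewrite divr_gt0 //; move: e0; rewrite ltcE => /andP[].
move/cvgrPdist_lt : Fa => /(_ _ r0) Fa.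
move/cvgrPdist_lt : Fb => /(_ _ r0) Fb.
near=> z; apply: le_lt_trans (normReIm _) _.
rewrite eE [complex.Re e]splitr -rmorphD /= ltcR.
rewrite ReB ImB /=; apply: ltrD; by near: z.
Unshelve. all: by end_near. Qed.

HB.instance Definition _ := NormedModule.copy R[i] C.
HB.instance Definition _ := Uniform_isComplete.Build R[i] complex_complete.

End ComplexAlgebra.

Section ComplexCStar.
Variable R : realType.
Local Notation C := R[i].

Let mul (a b : C) : C := (a : R[i]) * (b : R[i]).
Let star (a : C) : C := (a : R[i])^*%C.

Let mulA (a b c : C) : mul a (mul b c) = mul (mul a b) c.
Proof. exact: mulrA. Qed.
Let mulC (a b : C) : mul a b = mul b a.
Proof. exact: mulrC. Qed.
Let mulDl (a b c : C) : mul (a + b) c = mul a c + mul b c.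
Proof. exact: mulrDl. Qed.
Let mulZl (z : R[i]) (a b : C) : mul (z *: a) b = z *: mul a b.
Proof. exact/esym/mulrA. Qed.
Let mul_norm (a b : C) : `|mul a b| <= `|a| * `|b|.
Proof. by rewrite [`|mul a b|]normrM. Qed.
Let starK (a : C) : star (star a) = a.
Proof. exact: conjcK. Qed.
Let starD (a b : C) : star (a + b) = star a + star b.
Proof. exact: rmorphD. Qed.
Let starZ (z : R[i]) (a : C) : star (z *: a) = (z^*%C : R[i]) *: star a.
Proof. exact: rmorphM. Qed.
Let starM (a b : C) : star (mul a b) = mul (star b) (star a).
Proof. by rewrite mulC; exact: rmorphM. Qed.
Let star_norm (a : C) : `|mul (star a) a| = `|a| ^+ 2.
Proof.
rewrite mulC [`|mul a (star a)|]normrM expr2; congr (_ * _).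
by case: a => x y; rewrite /star /= /Num.norm /= sqrrN.
Qed.

HB.instance Definition _ := isCommCStarAlgebra.Build R C
  mulA mulC mulDl mulZl mul_norm starK starD starZ starM star_norm.

End ComplexCStar.

Notation hilbertSpaceType R := (hilbertModType (R[i] : commCStarAlgType R)).

Section HilbertModules.
Variables (R : realType) (A : commCStarAlgType R) (E : hilbertModType A).
Implicit Types (u v w : E) (a : A).

Lemma ipDl u v w : ip (u + v) w = ip u w + ip v w :> A.
Proof. by rewrite -ipC ipDr cstarD !ipC. Qed.

Lemma ipZl (z : R[i]) v w : ip (z *: v) w = z^*%C *: ip v w :> A.
Proof. by rewrite -ipC ipZr cstarZ ipC. Qed.

Definition countably_generated :=
  exists x : nat -> E,
    closure [set v | exists n (a : 'I_n -> A), v = \sum_(i < n) mact (x i) (a i)]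
      = setT.

(* Linearity and boundedness are automatic, and the adjoint is unique. *)
Record adjointable := Adjointable {
  aop :> E -> E;
  aadj : E -> E;
  aopP : forall v w, ip (aop v) w = ip v (aadj w) :> A
}.

HB.instance Definition _ := gen_eqMixin adjointable.
HB.instance Definition _ := gen_choiceMixin adjointable.

Implicit Types S T : adjointable.

Let idP v w : ip (id v) w = ip v (id w) :> A.
Proof. by []. Qed.
Let compP S T v w : ip (S (T v)) w = ip v (aadj T (aadj S w)) :> A.
Proof. by rewrite !aopP. Qed.
Let starP T v w : ip (aadj T v) w = ip v (T w) :> A.
Proof. by rewrite -ipC -aopP ipC. Qed.
Let addP S T v w : ip (S v + T v) w = ip v (aadj S w + aadj T w) :> A.
Proof. by rewrite ipDl ipDr !aopP. Qed.
Let scaleP (z : R[i]) T v w :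
  ip (z *: T v) w = ip v (z^*%C *: aadj T w) :> A.
Proof. by rewrite ipZl ipZr aopP. Qed.

Definition aid := Adjointable idP.
Definition acomp S T := Adjointable (compP S T).
Definition astar T := Adjointable (starP T).
Definition aadd S T := Adjointable (addP S T).
Definition ascale z T := Adjointable (scaleP z T).
Definition apow T n := iter n (acomp T) aid.

Definition apositive T := exists S, T = acomp (astar S) S.

(* The unique positive square root of a positive T. *)
Definition asqrt T := xget aid [set S | apositive S /\ acomp S S = T].

Definition aabs T := asqrt (acomp (astar T) T).

End HilbertModules.

Section HilbertSpaceTrace.
Variables (R : realType) (H : hilbertSpaceType R).

Definition orthonormal_basis (B : set H) :=
  (forall e, B e -> ip e e = 1 :> R[i]) /\
  (forall e f, B e -> B f -> e <> f -> ip e f = 0 :> R[i]) /\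
  (forall v, (forall e, B e -> ip e v = 0 :> R[i]) -> v = 0).

Definition onb : set H := xget set0 orthonormal_basis.

(* Trace of a positive operator, with value +oo if the series diverges. *)
Definition postrace (T : adjointable H) : \bar R :=
  \esum_(e in onb) (complex.Re (ip e (T e) : R[i]))%:E.

End HilbertSpaceTrace.

Section Localization.
Variables (R : realType) (A : commCStarAlgType R).
Local Notation C := R[i].

Definition is_character (chi : A -> C) :=
  (forall (z : R[i]) a b, chi (z *: a + b) = z *: chi a + chi b) /\
  (forall a b, chi (cmul a b) = cmul (chi a) (chi b)) /\
  (forall a, chi (cstar a) = cstar (chi a)) /\
  (exists a, chi a <> 0).

(* The interior tensor product of E with C over A, C being an A-module through
   chi: the Hausdorff completion of the span of the elementary tensors for the
   form below. It is unique up to a unitary preserving elementary tensors. *)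
Record pushforward (chi : A -> C) (E : hilbertModType A) := Pushforward {
  push_space :> hilbertSpaceType R;
  tens : E -> C -> push_space;
  tens_ip : forall v w (x y : C),
    ip (tens v x) (tens w y) = cmul (cmul (cstar x) (chi (ip v w))) y;
  tens_dense :
    closure [set t | exists n (v : 'I_n -> E) (x : 'I_n -> C),
      t = \sum_(i < n) tens (v i) (x i)] = setT
}.

Variable E : hilbertModType A.
Implicit Types S T : adjointable E.

Definition is_push_op chi (P : pushforward chi E) T (X : adjointable P) :=
  forall v x, X (tens P v x) = tens P (T v) x.

(* t = tr |chi_* T|^p; only the exponents 1 and 2 are needed, so p is a nat. *)
Definition is_push_trace (p : nat) T chi (t : \bar R) :=
  exists (P : pushforward chi E) (X : adjointable P),
    is_push_op T X /\ t = postrace (apow (aabs X) p).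

(* The function tr |T|^p on characters is the Gelfand transform of a. *)
Definition is_tr_abs_pow (p : nat) T (a : A) :=
  forall chi, is_character chi ->
    exists r : R, is_push_trace p T chi r%:E /\ chi a = r%:C.

Definition in_Lp (p : nat) T := exists a, is_tr_abs_pow p T a.

Definition tr_abs_pow (p : nat) T : A := xget 0 [set a | is_tr_abs_pow p T a].

(* Only meaningful for S and T in L^2: the xget in tr_abs_pow returns 0 when
   its argument is not in L^p, and otherwise the unique possible a. *)
Definition ip2 S T : A :=
  (4%:R^-1 : R[i]) *:
    \sum_(k < 4) ('i%C ^+ k : R[i]) *:
       tr_abs_pow 2 (aadd T (ascale ('i%C ^+ k) S)).

Definition weak_polar T S :=
  T = acomp S (asqrt (aabs T)) /\ aabs S = asqrt (aabs T).

(* For T in L^1, asqrt (aabs T) is |T|^(1/2) and S is the unique weak polar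
   factor. *)
Definition tr T : A :=
  ip2 (astar (xget (aid E) [set S | weak_polar T S])) (asqrt (aabs T)).

End Localization.

(* Main.v *)
(** Characters separate the points of [A], so the two traces are compared one
    character [chi] at a time.  For a frame [y] of [E], polarization turns
    [chi (tr X)] into the series of the [chi <y_j, X y_j>]; Dini's theorem on
    the space of characters is what makes the functions [tr |.|^2] that occur
    in the polarization elements of [A].  Parseval and polarization give
    [tr (U V) = tr (V U)] for Hilbert-Schmidt [U] and [V], hence
    [tr (X Y) = tr (Y X)] for [X] trace class and [Y] bounded.

    Only the products [S T] and [T S] are trace class, so [S] is regularized:
    when [|S| <= 1], take [G n = (\sum_(k < n) (1 - S^* S) ^ k) S^*], for which
    [S (G n) = 1 - (1 - S S^* ) ^ n] and [(G n) S = 1 - (1 - S^* S) ^ n].  Then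
    [tr (S (G n) S T) = tr (S T S (G n)) = tr (T S (G n) S)] by the above, and
    the errors [tr ((1 - S S^* ) ^ n S T)] and [tr (T S (1 - S^* S) ^ n)] tend
    to [0] by dominated convergence, since [S (1 - S^* S) ^ n -> 0] in norm. *)

From HB Require Import structures.
From mathcomp Require Import all_boot all_order all_algebra.
From mathcomp Require Import all_classical all_reals all_analysis.
From mathcomp Require Import complex.
From mathcomp Require Import zify ring lra.
Require Import Defs.

Set Implicit Arguments.
Unset Strict Implicit.
Unset Printing Implicit Defensive.

Import Order.TTheory GRing.Theory Num.Theory.
Import numFieldNormedType.Exports.

Local Open Scope classical_set_scope.
Local Open Scope complex_scope.
Local Open Scope ring_scope.

(** Neither [S] nor [T] need be Hilbert-Schmidt, so cyclicity for pairs of Hilbert-Schmidt operators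
    does not apply to [S T] itself. On a Hilbert space one would cut down with spectral projections
    of [S S^*]; on a Hilbert module these need not exist, and the polynomials [1 - (1 - S S^* ) ^ n]
    take their place. The norm decay concerns [(1 - S S^* ) ^ n S T], whereas dominated convergence
    wants it for one factor of a factorization [S T = W Q] into Hilbert-Schmidt operators. The
    inequality [|V w|^2 <= |w| |V^* V w|] transfers it, at the cost of a square root of the rate.

    Working at one [chi] means working with the semi-inner product [chi <v, w>] on [E]. A norm bound
    [|T| <= c] passes to it because [c^2 - T^* T] has the form of a square, so square roots have to
    precede all local estimates. The characters themselves are obtained from minimal C*-seminorms, a
    route that asks for no unit in [A]. *)

Section RealNorm.
Variable R : realType.
Implicit Types V : normedModType R[i].

(** Norms of [R[i]]-modules are complex numbers; the real part makes the order of [R], and with it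
    [lra] and [nra], available. *)
Definition nrm V (v : V) : R := complex.Re `|v|.

Lemma nrmE V (v : V) : `|v| = (nrm v)%:C.
Proof. by rewrite /nrm RRe_real // normr_real. Qed.

Lemma nrm_ge0 V (v : V) : 0 <= nrm v.
Proof. by rewrite -lecR -nrmE normr_ge0. Qed.

Lemma nrmD V (v w : V) : nrm (v + w) <= nrm v + nrm w.
Proof. by rewrite -lecR rmorphD /= -!nrmE ler_normD. Qed.

Lemma nrmN V (v : V) : nrm (- v) = nrm v.
Proof. by rewrite /nrm normrN. Qed.

Lemma nrmB V (v w : V) : nrm (v - w) = nrm (w - v).
Proof. by rewrite /nrm distrC. Qed.

Lemma nrmZ V (z : R[i]) (v : V) : nrm (z *: v) = nrm (z : R[i]) * nrm v.
Proof. by apply: (@complexI R); rewrite rmorphM /= -!nrmE normrZ. Qed.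

Lemma nrm_double V (v : V) : nrm (v + v) = 2 * nrm v.
Proof.
apply: (@complexI R); rewrite rmorphM /= -!nrmE -mulr2n normrMn.
by rewrite -[LHS]mulr_natl; congr (_ * _); rewrite rmorphMn rmorph1.
Qed.

Lemma nrm0 V : nrm (0 : V) = 0.
Proof. by rewrite /nrm normr0. Qed.

Lemma nrm_eq0 V (v : V) : nrm v = 0 -> v = 0.
Proof. by move=> v0; apply/normr0_eq0; rewrite nrmE v0. Qed.

Lemma nrm_triangle V (u v w : V) : nrm (u - w) <= nrm (u - v) + nrm (v - w).
Proof. by rewrite -[u - w](subrKA v) nrmD. Qed.

Lemma nrm_sub_ge V (v w : V) : nrm v - nrm w <= nrm (v - w).
Proof. by rewrite lerBlDr -{1}[v](subrK w) nrmD. Qed.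

(** Weaker than convergence to 0: one small value for each [d]. This suffices when an estimate holds
    at every index or the sequence is antitone. *)
Definition vanishing (e : nat -> R) := forall d, 0 < d -> exists n, e n < d.

Lemma vanishing_le0 (e : nat -> R) (c x : R) :
  vanishing e -> 0 <= c -> (forall n, x <= c * e n) -> x <= 0.
Proof.
move=> e0 c0 xe; rewrite leNgt; apply/negP => x0.
have [n en] := e0 _ (divr_gt0 x0 (ltr_wpDr c0 ltr01)).
have := xe n; apply/negP; rewrite -ltNge.
move: en; rewrite ltr_pdivlMr; last by rewrite ltr_wpDr.
apply: le_lt_trans.
have [en0|en0] := leP 0 (e n); last first.
  have := xe n. nra.
nra.
Qed.

Lemma vanishing_harmonic (c : R) : vanishing (fun n => c * n.+1%:R^-1).
Proof.
move=> d d0; exists (Num.truncn (`|c| / d)).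
rewrite ltr_pdivrMr //.
have := truncnS_gt (`|c| / d). rewrite ltr_pdivrMr // mulrC => h.
exact: le_lt_trans (ler_norm _) h.
Qed.

Lemma vanishing_geometric (c : R) : 0 <= c -> c < 1 -> vanishing (fun n => c ^+ n).
Proof.
move=> c0 c1 d d0.
have cc : `|c| < 1 by rewrite ger0_norm.
have /cvgrPdist_lt /(_ _ d0) := cvg_expr cc.
move=> [N _ /(_ N (leqnn N))] /=; rewrite sub0r normrN => h.
by exists N; exact: le_lt_trans (ler_norm _) h.
Qed.

Lemma closureT_approx V (D : set V) (v : V) (e : R) :
  closure D = setT -> 0 < e -> exists2 d, D d & nrm (v - d) < e.
Proof.
move=> DT e0; have : closure D v by rewrite DT.
have e0' : 0 < e%:C :> R[i] by rewrite ltcR.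
move=> /(_ _ (nbhsx_ballx v _ e0'))[d [Dd]].
rewrite -ball_normE /= nrmE ltcR => vd; by exists d.
Qed.

(** A bound [e n] controls all later terms at once, so a single small value makes the sequence
    Cauchy; being a closed condition, the bound survives in the limit at every index. *)
Lemma complete_rate (V : completeNormedModType R[i]) (u : nat -> V) (e : nat -> R) :
  vanishing e -> (forall n m, (n <= m)%N -> nrm (u m - u n) <= e n) ->
  exists l, forall n, nrm (l - u n) <= e n.
Proof.
move=> e0 ue.
have : cvg (u @ \oo).
  apply/cauchy_cvgP/cauchy_ballP => d; case: d => d d'; rewrite ltcE /= => /andP[/eqP -> d0].
  have [n en] := e0 _ (divr_gt0 d0 (ltr0n _ 2)).
  near_simpl.
  exists ([set k | (n <= k)%N], [set k | (n <= k)%N]).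
    by split; exists n.
  move=> [k m] /= [nk nm]; rewrite -ball_normE /= nrmE.
  rewrite -[(_ +i* _)%C]/(d%:C) ltcR.
  apply: le_lt_trans (nrm_triangle _ (u n) _) _.
  rewrite [X in _ < X]splitr; apply: ltrD.
    exact: le_lt_trans (ue _ _ nk) en.
  by rewrite nrmB; exact: le_lt_trans (ue _ _ nm) en.
move=> /cvg_ex[l ul]; exists l => n.
rewrite leNgt; apply/negP => h.
have d0 : 0 < (nrm (l - u n) - e n)%:C :> R[i] by rewrite ltcR subr_gt0.
move/cvgrPdist_lt : ul => /(_ _ d0)[N _ /(_ (maxn n N) (leq_maxr _ _))] /=.
rewrite nrmE ltcR ltNge => /negP; apply.
rewrite lerBlDr; apply: le_trans (nrm_triangle _ (u (maxn n N)) _) _.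
by rewrite lerD2l ue // leq_maxl.
Qed.

Lemma nrm_small_eq0 V (v : V) : (forall d, 0 < d -> nrm v <= d) -> v = 0.
Proof.
move=> h; apply: nrm_eq0; apply/eqP; rewrite eq_le nrm_ge0 andbT.
by apply/ler_addgt0Pr => d d0; rewrite add0r h.
Qed.

End RealNorm.

(** * C*-seminorms and the existence of minimal ones *)

Section CStarAlgebra.
Variables (R : realType) (A : commCStarAlgType R).
Implicit Types (a b c x y : A) (q : A -> R).

Lemma cmulDr a b c : cmul a (b + c) = cmul a b + cmul a c.
Proof. by rewrite cmulC cmulDl !(cmulC a). Qed.

Lemma cmulZr (z : R[i]) a b : cmul a (z *: b) = z *: cmul a b.
Proof. by rewrite cmulC cmulZl cmulC. Qed.

Lemma cmulNl a b : cmul (- a) b = - cmul a b.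
Proof. by rewrite -scaleN1r cmulZl scaleN1r. Qed.

Lemma cmulNr a b : cmul a (- b) = - cmul a b.
Proof. by rewrite cmulC cmulNl cmulC. Qed.

Lemma cmul0l a : cmul 0 a = 0.
Proof. by rewrite -(scale0r a) cmulZl !scale0r. Qed.

Lemma cmul0r a : cmul a 0 = 0.
Proof. by rewrite cmulC cmul0l. Qed.

Lemma cmulACA a b c x : cmul (cmul a b) (cmul c x) = cmul (cmul a c) (cmul b x).
Proof. by rewrite -!cmulA; congr cmul; rewrite !cmulA (cmulC b). Qed.

Lemma cstarZc (z : R[i]) a : cstar (z *: a) = z^*%C *: cstar a.
Proof. exact: cstarZ. Qed.

Lemma cstarN a : cstar (- a) = - cstar a.
Proof. by rewrite -scaleN1r cstarZc rmorphN rmorph1 scaleN1r. Qed.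

Lemma nrm_cmul a b : nrm (cmul a b) <= nrm a * nrm b.
Proof. by rewrite -lecR rmorphM /= -!nrmE cmul_norm. Qed.

Lemma nrm_cstar_sq a : nrm (cmul (cstar a) a) = nrm a ^+ 2.
Proof. by apply: (@complexI R); rewrite rmorphXn /= -!nrmE cstar_norm. Qed.

(** The modulus of a character is such a seminorm; conversely, characters will be extracted from
    minimal ones. *)
Record cstar_seminorm q : Prop := CStarSeminorm {
  csn_ge0 : forall x, 0 <= q x;
  csnD : forall x y, q (x + y) <= q x + q y;
  csnZ : forall (z : R[i]) x, q (z *: x) = nrm (z : R[i]) * q x;
  csnM : forall x y, q (cmul x y) <= q x * q y;
  csn_sq : forall x, q (cmul (cstar x) x) = q x ^+ 2
}.

Lemma nrm_cstar_seminorm : cstar_seminorm (@nrm R A).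
Proof.
split; [exact: nrm_ge0|exact: nrmD|exact: nrmZ|exact: nrm_cmul|exact: nrm_cstar_sq].
Qed.

Lemma ler_mul_eps (p s t : R) : 0 <= s -> 0 <= t ->
  (forall e, 0 < e -> p <= (s + e) * (t + e)) -> p <= s * t.
Proof.
move=> s0 t0 H; rewrite leNgt; apply/negP => lt.
have st0 : 0 < s + t + 1 by rewrite ltr_wpDl ?addr_ge0.
pose e := Num.min 1 ((p - s * t) / 2 / (s + t + 1)).
have e0 : 0 < e.
  by rewrite lt_min ltr01 !divr_gt0 // subr_gt0.
have e1 : e <= 1 by rewrite ge_min lexx.
have e2 : e * (s + t + 1) <= (p - s * t) / 2.
  by rewrite -ler_pdivlMr // ge_min lexx orbT.
have := H _ e0; nra.
Qed.

(** The members of the directed family need not be C*-seminorms: submultiplicativity and the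
    C*-identity may hold up to a change of index. This covers both chains in Zorn's lemma and the
    family [q (c ^ n x)]. *)
Lemma csn_inf (I : Type) (f : I -> A -> R) (i0 : I) :
  (forall i x, 0 <= f i x) ->
  (forall i j, exists k, forall x, f k x <= f i x /\ f k x <= f j x) ->
  (forall i x y, f i (x + y) <= f i x + f i y) ->
  (forall i (z : R[i]) x, f i (z *: x) = nrm (z : R[i]) * f i x) ->
  (forall i x y, exists k, f k (cmul x y) <= f i x * f i y) ->
  (forall i x, exists k, f k (cmul (cstar x) x) <= f i x ^+ 2) ->
  (forall i x, exists k, f k x ^+ 2 <= f i (cmul (cstar x) x)) ->
  cstar_seminorm (fun x => inf (range (f^~ x))).
Proof.
move=> f0 fdir fD fZ fM fS1 fS2.
pose m x := inf (range (f^~ x)); rewrite -/m.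
have lb x : has_lbound (range (f^~ x)) by exists 0 => _ [i _ <-].
have mle i x : m x <= f i x by apply: ge_inf => //; exists i.
have mge r x : (forall i, r <= f i x) -> r <= m x.
  by move=> h; apply: lb_le_inf; [exists (f i0 x), i0|move=> _ [i _ <-]].
have m0 x : 0 <= m x by apply: mge.
have mlt x y e : 0 < e -> exists k, f k x < m x + e /\ f k y < m y + e.
  move=> e0; have hi z : exists i, f i z < m z + e.
    have [|_ [i _ <-] h] := @inf_adherent _ (range (f^~ z)) _ e0.
      by split=> //; exists (f i0 z), i0.
    by exists i.
  have [[i fi] [j fj]] := (hi x, hi y).
  have [k fk] := fdir i j; exists k; split.
    exact: le_lt_trans (fk x).1 fi.
  exact: le_lt_trans (fk y).2 fj.
split=> //.
- move=> x y; apply/ler_addgt0Pr => e e0.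
  have [k [kx ky]] := mlt x y _ (divr_gt0 e0 (ltr0n _ 2)).
  have := mle k (x + y); have := fD k x y; lra.
- move=> z x; have z0 := nrm_ge0 (z : R[i]).
  apply/eqP; rewrite eq_le; apply/andP; split; last first.
    by apply: mge => i; rewrite fZ ler_wpM2l // mle.
  have [z1|zn] := eqVneq (nrm (z : R[i])) 0.
    by apply: le_trans (mle i0 _) _; rewrite fZ z1 !mul0r.
  have zp : 0 < nrm (z : R[i]) by rewrite lt_def zn z0.
  rewrite -ler_pdivrMl //; apply: mge => i.
  by rewrite ler_pdivrMl // -fZ mle.
- move=> x y; apply: ler_mul_eps => // e e0.
  have [k [kx ky]] := mlt x y _ e0; have [l fl] := fM k x y.
  apply: le_trans (mle l _) _; apply: le_trans fl _.
  by apply: ler_pM => //; exact: ltW.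
- move=> x; apply/eqP; rewrite eq_le; apply/andP; split.
    rewrite expr2; apply: ler_mul_eps => // e e0.
    have [k [kx _]] := mlt x x _ e0; have [l fl] := fS1 k x.
    apply: le_trans (mle l _) _; apply: le_trans fl _.
    by rewrite expr2; apply: ler_pM => //; exact: ltW.
  apply/ler_addgt0Pr => e e0.
  have [k [kx _]] := mlt (cmul (cstar x) x) (cmul (cstar x) x) _ e0.
  have [l fl] := fS2 k x; apply: le_trans (ltW kx); apply: le_trans fl.
  by rewrite lerXn2r ?nnegrE.
Qed.

(** Zorn's lemma for the reversed order, a chain being bounded by its infimum. The normalization at
    [h] is kept by infima and prevents a collapse to 0. *)
Lemma minimal_csn (h : A) : nrm h = 1 -> exists q, [/\ cstar_seminorm q,
  forall x, q x <= nrm x, q h = 1 &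
  forall q', cstar_seminorm q' -> (forall x, q' x <= q x) -> q' h = 1 ->
    forall x, q' x = q x].
Proof.
move=> h1.
pose P q := [/\ cstar_seminorm q, forall x, q x <= nrm x & q h = 1].
pose T := {q | P q}.
pose r (s t : T) := `[< forall x, sval t x <= sval s x >].
have Pn : P (@nrm R A) by split=> //; exact: nrm_cstar_seminorm.
have [||||[q [qs qn qh]] qmin] := @Zorn T r.
- by move=> t; apply/asboolP.
- move=> s t u /asboolP h1' /asboolP h2; apply/asboolP => x.
  exact: le_trans (h2 x) (h1' x).
- move=> [s sP] [t tP] /asboolP /= h1' /asboolP /= h2.
  have E : s = t by apply/funext => x; apply/eqP; rewrite eq_le h1' h2.
  by subst t; congr exist; exact: Prop_irrelevance.
- move=> F Ftot; have [[s0 Fs0]|nF] := pselect (exists s, F s); last first.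
    by exists (exist _ _ Pn) => s Fs; case: nF; exists s.
  pose f (i : {s | F s}) := sval (sval i).
  have fP (i : {s | F s}) : P (f i) by case: i => -[].
  have lb x : has_lbound (range (f^~ x)).
    by exists 0 => _ [i _ <-]; have [[]] := fP i.
  have Pm : P (fun x => inf (range (f^~ x))).
    split; first 1 last.
    + move=> x; apply: (@le_trans _ _ (f (exist _ _ Fs0) x)).
        by apply: ge_inf => //; exists (exist _ _ Fs0).
      by have [] := fP (exist _ _ Fs0).
    + have -> : range (f^~ h) = [set 1].
        apply/seteqP; split=> [_ [i _ <-]|_ ->] /=; first by have [] := fP i.
        by exists (exist _ _ Fs0) => //; have [] := fP (exist _ _ Fs0).
      by rewrite inf1.
    apply: csn_inf => //; first exact: (exist _ _ Fs0).
    + by move=> i x; have [[]] := fP i.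
    + move=> [s Fs] [t Ft]; have [/asboolP st|/asboolP ts] := Ftot _ _ Fs Ft.
        by exists (exist _ _ Ft) => x; split=> //; exact: st.
      by exists (exist _ _ Fs) => x; split=> //; exact: ts.
    + by move=> i; have [[]] := fP i.
    + by move=> i; have [[]] := fP i.
    + by move=> i x y; exists i; have [[]] := fP i.
    + by move=> i x; exists i; have [[_ _ _ _ ->]] := fP i.
    + by move=> i x; exists i; have [[_ _ _ _ ->]] := fP i.
  exists (exist _ _ Pm) => s Fs; apply/asboolP => x /=.
  by apply: ge_inf => //; exists (exist _ _ Fs).
exists q; split=> // q' q's le' q'h x.
have Pq' : P q' by split=> // y; exact: le_trans (le' y) (qn y).
have /(congr1 sval) /= -> // : exist _ q' Pq' = exist _ q (And3 qs qn qh).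
by apply: qmin; apply/asboolP.
Qed.

End CStarAlgebra.

(** * The modulus of complex numbers *)

Section ComplexNorm.
Variable R : realType.

Lemma nrm_complexE (z : R[i]) :
  nrm (z : R[i]^o) = Num.sqrt (complex.Re z ^+ 2 + complex.Im z ^+ 2).
Proof. by rewrite /nrm normc_def; case: z. Qed.

Lemma nrm_real (r : R) : nrm (r%:C : R[i]^o) = `|r|.
Proof. by rewrite nrm_complexE /= expr0n addr0 sqrtr_sqr. Qed.

Lemma nrm_complexM (z w : R[i]) :
  nrm ((z * w : R[i]) : R[i]^o) = nrm (z : R[i]^o) * nrm (w : R[i]^o).
Proof. exact: (nrmZ z (w : R[i]^o)). Qed.

Lemma conjc_imag : ('i%C)^*%C = - 'i%C :> R[i].
Proof. by apply/eqP; rewrite eq_complex /= oppr0 !eqxx. Qed.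

Lemma nrm_i : nrm ('i%C : R[i]^o) = 1.
Proof. by rewrite nrm_complexE /= expr0n expr1n add0r sqrtr1. Qed.

Lemma iXconj k : 'i%C ^+ k * ('i%C ^+ k)^*%C = 1 :> R[i].
Proof.
elim: k => [|k IH]; first by rewrite expr0 rmorph1 mulr1.
have ii : 'i%C * ('i%C)^*%C = 1 :> R[i] by rewrite conjc_imag mulrN -expr2 sqr_i opprK.
by rewrite exprS rmorphM mulrACA IH mulr1; exact: ii.
Qed.

Lemma nrm_iX k : nrm (('i%C ^+ k : R[i]) : R[i]^o) = 1.
Proof.
elim: k => [|k IH]; first by rewrite expr0 (nrm_real 1) normr1.
by rewrite exprS nrm_complexM IH nrm_i mulr1.
Qed.

End ComplexNorm.

(** * Multiplicativity of minimal C*-seminorms *)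

Section Gelfand.
Variables (R : realType) (A : commCStarAlgType R).
Implicit Types (a b c x y : A) (q : A -> R).

Lemma csnN q x : cstar_seminorm q -> q (- x) = q x.
Proof.
by move=> qs; rewrite -scaleN1r (csnZ qs) nrmN (nrm_real 1) normr1 mul1r.
Qed.

Lemma csnB q x y : cstar_seminorm q -> q (x - y) <= q x + q y.
Proof. by move=> qs; rewrite -(csnN y qs) (csnD qs). Qed.

Lemma csn_star q x : cstar_seminorm q -> q (cstar x) = q x.
Proof.
move=> qs; suff H z : q z <= q (cstar z).
  by apply/eqP; rewrite eq_le H -{2}[x]cstarK H.
have := csnM qs (cstar z) z; rewrite (csn_sq qs) expr2.
have z0 := csn_ge0 qs z; have [->|zn] := eqVneq (q z) 0.
  by rewrite (csn_ge0 qs).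
by rewrite ler_pM2r // lt_def zn.
Qed.

(** Here [iter n (cmul c) x] is [c ^ n x], which makes sense for [n = 0] even if [A] has no unit. *)
Lemma iter_cmulD c n x y :
  iter n (cmul c) (x + y) = iter n (cmul c) x + iter n (cmul c) y.
Proof. by elim: n => //= n ->; rewrite cmulDr. Qed.

Lemma iter_cmulZ c n (z : R[i]) x :
  iter n (cmul c) (z *: x) = z *: iter n (cmul c) x.
Proof. by elim: n => //= n ->; rewrite cmulZr. Qed.

Lemma iter_cmul_star c n x : cstar c = c ->
  cstar (iter n (cmul c) x) = iter n (cmul c) (cstar x).
Proof. by move=> cs; elim: n => //= n; rewrite cstarM => ->; rewrite cs cmulC. Qed.

Lemma iter_cmulMr c n x y : cmul x (iter n (cmul c) y) = iter n (cmul c) (cmul x y).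
Proof. by elim: n => //= n <-; rewrite !cmulA (cmulC x). Qed.

Lemma iter_cmulM c n m x y :
  cmul (iter n (cmul c) x) (iter m (cmul c) y) = iter (n + m) (cmul c) (cmul x y).
Proof. by rewrite iter_cmulMr cmulC iter_cmulMr addnC iterD cmulC. Qed.

Lemma csn_iter_le q c x n m : cstar_seminorm q -> q c = 1 -> (n <= m)%N ->
  q (iter m (cmul c) x) <= q (iter n (cmul c) x).
Proof.
move=> qs qc; elim: m => [|m IH]; first by rewrite leqn0 => /eqP ->.
rewrite leq_eqVlt => /orP[/eqP -> //|/IH]; apply: le_trans => /=.
by have := csnM qs c (iter m (cmul c) x); rewrite qc mul1r.
Qed.

(** By the C*-identity, squaring keeps the value 1, so it is taken at arbitrarily high powers of
    [c]; [csn_iter_le] squeezes the powers in between. *)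
Lemma csn_iter1 q c n : cstar_seminorm q -> cstar c = c -> q c = 1 ->
  q (iter n (cmul c) c) = 1.
Proof.
move=> qs cs qc; apply/eqP; rewrite eq_le; apply/andP; split.
  by rewrite -[leRHS]qc (csn_iter_le c qs qc (leq0n n)).
have [N nN qN] : exists2 N, (n <= N)%N & q (iter N (cmul c) c) = 1.
  elim: n => [|k [N kN qN]]; first by exists 0.
  exists (N + N).+1; first by lia.
  have E : cstar (iter N (cmul c) c) = iter N (cmul c) c.
    by rewrite iter_cmul_star // cs.
  rewrite iterSr -iter_cmulM -[X in cmul X _]E (csn_sq qs) qN.
  by rewrite expr1n.
by rewrite -qN csn_iter_le.
Qed.

Section Minimal.
Variables (q : A -> R) (h : A).
Hypotheses (qs : cstar_seminorm q) (hs : cstar h = h) (qh : q h = 1).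
Hypothesis qmin : forall q', cstar_seminorm q' -> (forall x, q' x <= q x) ->
  q' h = 1 -> forall x, q' x = q x.

(** The infimum over [n] of [q (c ^ n x)] is a C*-seminorm below [q] with value 1 at [h]. By
    minimality it is [q], so [q x <= q (c x)]. *)
Let csn_translate c x : cstar c = c -> q c = 1 ->
  (forall n, q (iter n (cmul c) h) = 1) -> q (cmul c x) = q x.
Proof.
move=> cs qc ch.
pose f n x := q (iter n (cmul c) x).
have f0 i y : 0 <= f i y by exact: (csn_ge0 qs).
have lb y : has_lbound (range (f^~ y)) by exists 0 => _ [i _ <-].
have Fq : cstar_seminorm (fun y => inf (range (f^~ y))).
  apply: csn_inf => //; first exact: 0%N.
  - move=> i j; exists (maxn i j) => y; rewrite /f.
    by split; apply: csn_iter_le => //; rewrite ?leq_maxl ?leq_maxr.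
  - by move=> i y z; rewrite /f iter_cmulD (csnD qs).
  - by move=> i z y; rewrite /f iter_cmulZ (csnZ qs).
  - by move=> i y z; exists (i + i)%N; rewrite /f -iter_cmulM (csnM qs).
  - by move=> i y; exists (i + i)%N; rewrite /f -iter_cmulM -iter_cmul_star // (csn_sq qs).
  - move=> i y; exists i; rewrite /f -(csn_sq qs) iter_cmul_star // iter_cmulM.
    by apply: csn_iter_le => //; rewrite leq_addr.
have E y : inf (range (f^~ y)) = q y.
  apply: (qmin Fq) => [z|]; first by apply: ge_inf => //; exists 0%N.
  have -> : range (f^~ h) = [set 1].
    by apply/seteqP; split=> [_ [i _ <-] /=|_ ->]; [exact: ch|exists 0%N => //=; exact: ch].
  by rewrite inf1.
apply/eqP; rewrite eq_le; apply/andP; split.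
  by have := csnM qs c x; rewrite qc mul1r.
by rewrite -[leLHS]E; apply: ge_inf => //; exists 1%N.
Qed.

Let csn_mul_unit c x : cstar c = c -> q c = 1 -> q (cmul c x) = q x.
Proof.
(* The values [q (c ^ n h)] are found by a first translation, by [h] itself: its powers have
   seminorm 1, whence [q (h c ^ n) = q (c ^ n) = 1] for positive [n]. *)
move=> cs qc; apply: csn_translate => // -[//|n].
rewrite iterSr cmulC -iter_cmulMr csn_translate //; first exact: csn_iter1.
by move=> m; exact: csn_iter1.
Qed.

Let csn_mul_sa c x : cstar c = c -> q (cmul c x) = q c * q x.
Proof.
move=> cs; have [c0|cn] := eqVneq (q c) 0.
  apply/eqP; rewrite eq_le c0 mul0r (csn_ge0 qs) andbT.
  by have := csnM qs c x; rewrite c0 mul0r.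
have cp : 0 < q c by rewrite lt_def cn (csn_ge0 qs).
pose d := ((q c)^-1)%:C *: c.
have cE : c = (q c)%:C *: d.
  by rewrite scalerA -rmorphM /= divff // rmorph1 scale1r.
rewrite {1}cE cmulZl (csnZ qs) nrm_real gtr0_norm // csn_mul_unit //.
  by rewrite cstarZc cs conjc_real.
by rewrite (csnZ qs) nrm_real gtr0_norm ?invr_gt0 // mulVf.
Qed.

(** Squaring both sides, the C*-identity reduces this to the self-adjoint factor [x^* x]. *)
Lemma minimal_csnM x y : q (cmul x y) = q x * q y.
Proof.
apply/eqP; rewrite -(@eqrXn2 _ 2) ?mulr_ge0 ?(csn_ge0 qs) // exprMn -!(csn_sq qs).
rewrite cstarM (cmulC (cstar y)) cmulACA csn_mul_sa //.
by rewrite cstarM cstarK.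
Qed.

(* A seminorm that is multiplicative takes the value [q (a + i b) ^ 2] at
   [a ^ 2 + b ^ 2]. *)
Let csn_sum_sq a b : cstar a = a -> cstar b = b ->
  q (cmul a a) <= q (cmul a a + cmul b b).
Proof.
move=> sa sb; set z := a + 'i%C *: b.
have zs : cstar z = a - 'i%C *: b.
  by rewrite cstarD cstarZc sa sb conjc_imag scaleNr.
have -> : cmul a a + cmul b b = cmul (cstar z) z.
  rewrite zs cmulDl cmulNl !cmulDr !cmulZl !cmulZr scalerA -expr2 sqr_i.
  by rewrite scaleN1r (cmulC b a) opprD opprK addrA addrK.
rewrite (csn_sq qs) minimal_csnM -expr2 lerXn2r ?nnegrE ?(csn_ge0 qs) //.
have -> : a = (2^-1)%:C *: (z + cstar z).
  rewrite zs /z addrACA subrr addr0 scalerDr -scalerDl -rmorphD /=.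
  by rewrite -div1r -splitr scale1r.
rewrite (csnZ qs) nrm_real ger0_norm ?invr_ge0 //.
have := csnD qs z (cstar z); rewrite csn_star //; lra.
Qed.

(** Passing from [x, y] to their squares at least doubles [q (x^2 - y^2)], yet this quantity never
    exceeds 2. Hence it is at most [2 / 2^n] for all [n], and [x^2 - y^2] is the product of [x - y]
    and [x + y]. *)
Lemma minimal_csn_dichotomy x y : cstar x = x -> cstar y = y ->
  q x = 1 -> q y = 1 -> q (x - y) = 0 \/ q (x + y) = 0.
Proof.
move=> sx sy qx qy.
have step u v : cstar u = u -> cstar v = v -> q u = 1 -> q v = 1 ->
    2 * q (cmul u u - cmul v v)
      <= q (cmul (cmul u u) (cmul u u) - cmul (cmul v v) (cmul v v)).
  move=> su sv qu qv.
  have -> : cmul (cmul u u) (cmul u u) - cmul (cmul v v) (cmul v v)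
      = cmul (cmul u u - cmul v v) (cmul u u + cmul v v).
    set U := cmul u u; set V := cmul v v.
    by rewrite cmulDl !cmulDr !cmulNl (cmulC V U) addrA addrK.
  rewrite minimal_csnM mulrC ler_wpM2l ?(csn_ge0 qs) //.
  set p := q _.
  rewrite -(@ler_pXn2r _ 2) ?nnegrE ?(csn_ge0 qs) //.
  (* [(u^2 + v^2)^2 = (2 u v)^2 + (u^2 - v^2)^2]; dropping the last square by [csn_sum_sq] leaves
     [p^2 >= 4]. *)
  have -> : p ^+ 2 = q (cmul (2%:C *: cmul u v) (2%:C *: cmul u v)
      + cmul (cmul u u - cmul v v) (cmul u u - cmul v v)).
    rewrite /p expr2 -minimal_csnM; congr q.
    set U := cmul u u; set V := cmul v v.
    rewrite cmulZl cmulZr scalerA -rmorphM /= cmulACA -/U -/V.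
    rewrite !cmulDl !cmulDr !cmulNl !cmulNr (cmulC V U) opprK.
    have -> : (2 * 2)%:C *: cmul U V = cmul U V *+ 4.
      by rewrite -natrM (rmorph_nat (@real_complex R)) scaler_nat.
    have E (a b c : A) : a + b + (b + c) = b *+ 4 + (a - b + (- b + c)).
      rewrite (addrC (- b) c) (addrC b c) (addrACA a b) (addrACA a (- b)).
      by rewrite -opprD -!mulr2n [RHS]addrCA -mulrnBr.
    exact: E.
  apply: le_trans (csn_sum_sq _ _).
  - rewrite minimal_csnM (csnZ qs) nrm_real minimal_csnM qu qv ger0_norm //.
    by rewrite !mulr1 -expr2.
  - by rewrite cstarZc conjc_real cstarM su sv cmulC.
  - by rewrite cstarD cstarN !cstarM su sv.
have two u v : q u = 1 -> q v = 1 -> q (cmul u u - cmul v v) <= 2.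
  move=> qu qv; apply: le_trans (csnB _ _ qs) _.
  by rewrite !minimal_csnM qu qv mulr1.
suff : q (cmul x x - cmul y y) = 0.
  have -> : cmul x x - cmul y y = cmul (x - y) (x + y).
    by rewrite cmulDl !cmulDr !cmulNl (cmulC y x) addrA addrK.
  rewrite minimal_csnM => /eqP; rewrite mulf_eq0 => /orP[] /eqP; tauto.
apply/eqP; rewrite eq_le (csn_ge0 qs) andbT.
apply: (vanishing_le0 (e := fun n => (2^-1) ^+ n) (c := 2)) => //.
  by apply: vanishing_geometric; lra.
move=> n; elim: n x y sx sy qx qy => [|n IH] x y sx sy qx qy.
  by rewrite expr0 mulr1 two.
have := step _ _ sx sy qx qy.
have := IH (cmul x x) (cmul y y); rewrite !cstarM sx sy !minimal_csnM qx qy mulr1.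
move=> /(_ erefl erefl erefl erefl); rewrite exprS; lra.
Qed.

End Minimal.
End Gelfand.

(** * Characters attaining the norm, and their contractivity *)

Section Characters.
Variables (R : realType) (A : commCStarAlgType R).
Implicit Types (a b c x y : A).
Local Notation C := R[i].

(** Take [q] minimal for the normalized [h = a^* a / |a|^2]. By the dichotomy each self-adjoint
    element is, modulo the kernel of [q], a real multiple of [h], so the quotient is one-dimensional
    and its coordinate [lam] yields the character. *)
Lemma exists_character (a : A) : a != 0 ->
  exists chi : A -> C, is_character chi /\ nrm (chi a : C^o) = nrm a.
Proof.
move=> a0.
have na0 : 0 < nrm a.
  by rewrite lt_def nrm_ge0 andbT; apply: contraNneq a0 => /nrm_eq0 ->.
pose h := ((nrm a ^+ 2)^-1)%:C *: cmul (cstar a) a.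
have hs : cstar h = h by rewrite /h cstarZc conjc_real cstarM cstarK.
have nh : nrm h = 1.
  rewrite /h nrmZ nrm_real nrm_cstar_sq ger0_norm ?invr_ge0 ?exprn_ge0 ?nrm_ge0 //.
  by rewrite mulVf // expf_neq0 // gt_eqF.
have [q [qs qn qh qmin]] := minimal_csn nh.
have qM := minimal_csnM qs hs qh qmin.
have real_part x : cstar x = x -> exists r : R, q (x - r%:C *: h) = 0.
  move=> xs; have [x0|xn] := eqVneq (q x) 0.
    by exists 0; rewrite rmorph0 scale0r subr0.
  have xp : 0 < q x by rewrite lt_def xn (csn_ge0 qs).
  pose y := ((q x)^-1)%:C *: x.
  have xE : x = (q x)%:C *: y.
    by rewrite scalerA -rmorphM /= divff // rmorph1 scale1r.
  have ys : cstar y = y by rewrite /y cstarZc conjc_real xs.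
  have qy : q y = 1.
    by rewrite /y (csnZ qs) nrm_real ger0_norm ?invr_ge0 ?ltW // mulVf.
  have [E|E] := minimal_csn_dichotomy qs hs qh qmin ys hs qy qh.
    by exists (q x); rewrite {1}xE -scalerBr (csnZ qs) E mulr0.
  exists (- q x); rewrite {1}xE rmorphN scaleNr opprK -scalerDr.
  by rewrite (csnZ qs) E mulr0.
have le0 y : q y <= 0 -> q y = 0.
  by move=> h0; apply/eqP; rewrite eq_le h0 (csn_ge0 qs).
have ex x : exists z : C, q (x - z *: h) = 0.
  have s1 : cstar (x + cstar x) = x + cstar x by rewrite cstarD cstarK addrC.
  have s2 : cstar ('i%C *: (x - cstar x)) = 'i%C *: (x - cstar x).
    by rewrite cstarZc cstarD cstarN cstarK conjc_imag scaleNr -scalerN opprB.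
  have [[r1 h1] [r2 h2]] := (real_part _ s1, real_part _ s2).
  (* From [x = ((x + x^* ) - i (i (x - x^* ))) / 2], where both terms in the outer difference come
     from self-adjoint elements. *)
  exists ((2^-1)%:C * (r1%:C - 'i%C * r2%:C)).
  apply: le0.
  have -> : x - ((2^-1)%:C * (r1%:C - 'i%C * r2%:C)) *: h
    = (2^-1)%:C *: ((x + cstar x - r1%:C *: h)
        - 'i%C *: ('i%C *: (x - cstar x) - r2%:C *: h)).
    rewrite -scalerA; set u := r1%:C *: h; rewrite scalerBl -scalerA -/u.
    set v := r2%:C *: h; rewrite (scalerBr 'i%C) (scalerA 'i%C 'i%C) -expr2 sqr_i scaleN1r.
    rewrite !opprD !opprK.
    have -> : x + cstar x - u + (x - cstar x + 'i%C *: v)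
      = (x + x) - (u - 'i%C *: v).
      rewrite addrACA (addrACA x (cstar x)) subrr addr0 opprB.
      by rewrite (addrC ('i%C *: v)).
    rewrite [in RHS]scalerBr (scalerDr _ x x) -scalerDl -rmorphD /= -div1r -splitr.
    by rewrite scale1r.
  rewrite (csnZ qs); apply: mulr_ge0_le0; first exact: nrm_ge0.
  apply: le_trans (csnB _ _ qs) _.
  by rewrite h1 (csnZ qs) h2 mulr0 addr0.
have uniq x z w : q (x - z *: h) = 0 -> q (x - w *: h) = 0 -> z = w.
  move=> hz hw; apply/eqP; rewrite -subr_eq0; apply/eqP/(@nrm_eq0 R C^o).
  apply/eqP; rewrite eq_le nrm_ge0 andbT.
  rewrite -[leLHS]mulr1 -qh -(csnZ qs) scalerBl.
  have -> : z *: h - w *: h = (x - w *: h) - (x - z *: h).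
    by rewrite opprB [RHS]addrC addrA subrK.
  by apply: le_trans (csnB _ _ qs) _; rewrite hz hw addr0.
pose lam x := sval (cid (ex x)).
have lamP x : q (x - lam x *: h) = 0 by rewrite /lam; case: cid.
have lamE x z : q (x - z *: h) = 0 -> lam x = z.
  by move=> hz; exact: uniq (lamP x) hz.
(* Modulo the kernel [h^2 = mu h], so [lam] is multiplicative only up to [mu]; the product
   [lam x * mu] is multiplicative. *)
pose mu := lam (cmul h h).
have lamq x : nrm (lam x : C^o) = q x.
  rewrite -[LHS]mulr1 -qh -(csnZ qs); apply/eqP; rewrite eq_le.
  have h1 := csnD qs (x - lam x *: h) (lam x *: h).
  have h2 := csnB x (x - lam x *: h) qs.
  rewrite lamP add0r subrK in h1; rewrite lamP addr0 opprB addrC subrK in h2.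
  by rewrite h1 h2.
have lamD z x y : lam (z *: x + y) = z * lam x + lam y.
  apply: lamE; apply: le0.
  have -> : z *: x + y - (z * lam x + lam y) *: h
      = z *: (x - lam x *: h) + (y - lam y *: h).
    by rewrite scalerDl -scalerA scalerBr opprD addrACA.
  apply: le_trans (csnD qs _ _) _.
  by rewrite (csnZ qs) !lamP mulr0 addr0.
have lamM x y : lam (cmul x y) = lam x * lam y * mu.
  apply: lamE; apply: le0.
  have -> : cmul x y - (lam x * lam y * mu) *: h
      = cmul (x - lam x *: h) y + (lam x *: cmul h (y - lam y *: h)
        + (lam x * lam y) *: (cmul h h - mu *: h)).
    rewrite cmulDl cmulNl cmulZl cmulDr cmulNr cmulZr !scalerBr !scalerA.
    by rewrite addrA (addrA (cmul x y - _)) subrK addrA subrK.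
  apply: le_trans (csnD qs _ _) _; rewrite qM lamP mul0r add0r.
  apply: le_trans (csnD qs _ _) _; rewrite !(csnZ qs) qM !lamP.
  by rewrite !mulr0 addr0.
have lamS x : lam (cstar x) = (lam x)^*%C.
  apply: lamE.
  have -> : cstar x - (lam x)^*%C *: h = cstar (x - lam x *: h).
    by rewrite cstarD cstarN cstarZc hs.
  by rewrite csn_star.
have muS : mu^*%C = mu by rewrite /mu -lamS cstarM hs.
have nmu : nrm (mu : C^o) = 1 by rewrite lamq qM qh mulr1.
exists (fun x => lam x * mu); split.
  split; [|split; [|split]].
  - by move=> z x y; rewrite lamD mulrDl -mulrA.
  - by move=> x y; rewrite lamM -mulrA -mulrACA.
  - by move=> x; rewrite lamS -{1}muS -rmorphM.
  - exists h => /eqP; rewrite mulf_eq0 => /orP[] /eqP E.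
      by have := lamq h; rewrite E nrm0 qh => /eqP; rewrite eq_sym oner_eq0.
    by have := nmu; rewrite E nrm0 => /eqP; rewrite eq_sym oner_eq0.
rewrite nrm_complexM nmu mulr1 lamq.
(* The choice of [h] pays off: [q a ^ 2 = q (a^* a) = |a|^2 q h]. *)
apply/eqP; rewrite -(@eqrXn2 _ 2) ?nrm_ge0 ?(csn_ge0 qs) // -(csn_sq qs).
have -> : cmul (cstar a) a = (nrm a ^+ 2)%:C *: h.
  rewrite /h scalerA -rmorphM /= divff ?rmorph1 ?scale1r //.
  by rewrite expf_neq0 // gt_eqF.
by rewrite (csnZ qs) qh mulr1 nrm_real ger0_norm // exprn_ge0 // nrm_ge0.
Qed.

Lemma geometric_limit (V : completeNormedModType C) (u : nat -> V) (c r : R) :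
  0 <= r -> r < 1 -> 0 <= c -> (forall n, nrm (u n.+1 - u n) <= c * r ^+ n) ->
  exists l, forall n, nrm (l - u n) <= c / (1 - r) * r ^+ n.
Proof.
move=> r0 r1 c0 H.
have s0 : 0 < 1 - r by rewrite subr_gt0.
apply: complete_rate => [d d0|n m nm].
  have cp : 0 < c / (1 - r) + 1 by rewrite ltr_wpDl // divr_ge0 // ltW.
  have [n hn] := vanishing_geometric r0 r1 (divr_gt0 d0 cp).
  exists n; move: hn; rewrite ltr_pdivlMr // => hn.
  apply: le_lt_trans hn; rewrite mulrC ler_wpM2l ?exprn_ge0 //.
  by rewrite lerDl.
have : nrm (u m - u n) <= c / (1 - r) * (r ^+ n - r ^+ m).
  elim: m nm => [|m IH]; first by rewrite leqn0 => /eqP ->; rewrite !subrr nrm0 mulr0.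
  rewrite leq_eqVlt => /orP[/eqP ->|]; first by rewrite !subrr nrm0 mulr0.
  move=> /IH IH'; apply: le_trans (nrm_triangle _ (u m) _) _.
  have -> : c / (1 - r) * (r ^+ n - r ^+ m.+1)
      = c * r ^+ m + c / (1 - r) * (r ^+ n - r ^+ m).
    by rewrite exprS; field; rewrite gt_eqF.
  exact: lerD.
move/le_trans; apply; rewrite ler_wpM2l ?divr_ge0 ?(ltW s0) //.
by rewrite lerBlDr lerDl exprn_ge0.
Qed.

Section Character.
Variable chi : A -> C.
Hypothesis hchi : is_character chi.

Lemma chiD a b : chi (a + b) = chi a + chi b.
Proof. by have [H _] := hchi; have := H 1 a b; rewrite !scale1r. Qed.

Lemma chi0 : chi 0 = 0.
Proof. by apply/(addrI (chi 0)); rewrite -chiD !addr0. Qed.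

Lemma chiZ (z : C) a : chi (z *: a) = z * chi a.
Proof. by have [H _] := hchi; have := H z a 0; rewrite !addr0 chi0 addr0. Qed.

Lemma chiN a : chi (- a) = - chi a.
Proof. by rewrite -scaleN1r chiZ mulN1r. Qed.

Lemma chiB a b : chi (a - b) = chi a - chi b.
Proof. by rewrite chiD chiN. Qed.

Lemma chiM a b : chi (cmul a b) = chi a * chi b.
Proof. by have [_ [H _]] := hchi; exact: H. Qed.

Lemma chi_star a : chi (cstar a) = (chi a)^*%C.
Proof. by have [_ [_ [H _]]] := hchi; exact: H. Qed.

Lemma chi_sum (I : Type) (r : seq I) (P : pred I) (F : I -> A) :
  chi (\sum_(i <- r | P i) F i) = \sum_(i <- r | P i) chi (F i).
Proof. by rewrite (big_morph chi chiD chi0). Qed.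

(* If [chi a = 1] and [|a| < 1], then [b = a + a b] has a solution. *)
Lemma chi_le a : nrm (chi a : C^o) <= nrm a.
Proof.
rewrite leNgt; apply/negP => lt.
have cp : 0 < nrm (chi a : C^o) by exact: le_lt_trans (nrm_ge0 _) lt.
have c0 : chi a != 0 by apply: contraTneq cp => ->; rewrite nrm0 ltxx.
pose b := (chi a)^-1 *: a.
have chib : chi b = 1 by rewrite chiZ mulVf.
pose r := nrm b.
have r1 : r < 1.
  have : nrm (((chi a)^-1 * chi a : C) : C^o) = 1.
    by rewrite mulVf // (nrm_real 1) normr1.
  rewrite nrm_complexM => E.
  by rewrite -E /r nrmZ ltr_pM2l // lt_def nrm_ge0 andbT; apply/eqP => E0;
    move: E => /eqP; rewrite E0 mul0r eq_sym oner_eq0.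
pose u := fix u n := if n is m.+1 then b + cmul b (u m) else 0.
have [l hl] : exists l, forall n, nrm (l - u n) <= r / (1 - r) * r ^+ n.
  apply: geometric_limit => //; rewrite ?nrm_ge0 //.
  elim=> [|n IH]; first by rewrite /= cmul0r addr0 subr0 expr0 mulr1.
  rewrite [u n.+2]/= [u n.+1 in X in nrm X]/= opprD addrACA subrr add0r.
  rewrite -cmulNr -cmulDr; apply: le_trans (nrm_cmul _ _) _.
  by rewrite exprS mulrCA ler_wpM2l // nrm_ge0.
have : b + cmul b l - l = 0.
  apply: nrm_eq0; apply/eqP; rewrite eq_le nrm_ge0 andbT.
  apply: (vanishing_le0 (e := fun n => r ^+ n) (c := 2 * r * (r / (1 - r)))).
  - by apply: vanishing_geometric => //; exact: nrm_ge0.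
  - by rewrite !mulr_ge0 ?nrm_ge0 // invr_ge0 subr_ge0 ltW.
  move=> n; apply: le_trans (nrm_triangle _ (u n.+1) _) _ => /=.
  rewrite opprD addrACA subrr add0r -cmulNr -cmulDr.
  have := nrm_cmul b (l - u n); have := hl n.+1; have := hl n.
  rewrite [nrm (l - u n.+1)]nrmB -/r /= exprS => h1 h2 h3.
  have : r * nrm (l - u n) <= r * (r / (1 - r) * r ^+ n) by rewrite ler_wpM2l // nrm_ge0.
  set K := r / (1 - r) in h1 h2 *; lra.
move=> /(congr1 chi); rewrite chiB chiD chiM chib mul1r addrK chi0 => /eqP.
by rewrite oner_eq0.
Qed.

End Character.

Lemma nrm_le_chi a (r : R) : 0 <= r ->
  (forall chi : A -> C, is_character chi -> nrm (chi a : C^o) <= r) -> nrm a <= r.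
Proof.
move=> r0 H; have [->|a0] := eqVneq a 0; first by rewrite nrm0.
by have [chi [hchi <-]] := exists_character a0; exact: H.
Qed.

Lemma chi_ext a b :
  (forall chi : A -> C, is_character chi -> chi a = chi b) -> a = b.
Proof.
move=> H; apply/eqP; rewrite -subr_eq0; apply/eqP/nrm_eq0/eqP.
rewrite eq_le nrm_ge0 andbT; apply: nrm_le_chi => // chi hchi.
by rewrite (chiB hchi) (H _ hchi) subrr nrm0.
Qed.

End Characters.

(** * Cauchy-Schwarz for possibly degenerate forms *)

Section SemiInnerProduct.
Variables (R : realType) (V : lmodType R[i]) (f : V -> V -> R[i]).
Hypotheses (fD : forall u v w, f u (v + w) = f u v + f u w)
  (fZ : forall (z : R[i]) u v, f u (z *: v) = z * f u v)
  (fC : forall u v, f v u = (f u v)^*%C)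
  (f0 : forall v, 0 <= complex.Re (f v v)).

Let expand (v w : V) (t : R) :
  0 <= complex.Re (f v v) + 2 * t * (complex.Re (f v w) ^+ 2 + complex.Im (f v w) ^+ 2)
    + t ^+ 2 * (complex.Re (f v w) ^+ 2 + complex.Im (f v w) ^+ 2) * complex.Re (f w w).
Proof.
(* This phase turns the cross term into the real number [2 t |f v w|^2]. *)
set z : R[i] := t%:C * (f v w)^*%C.
have := f0 (v + z *: w).
have -> : f (v + z *: w) (v + z *: w)
    = (f v v + z * f v w)^*%C + z * ((f v w)^*%C + z * f w w)^*%C.
  by rewrite fD fZ [f _ v]fC [f _ w]fC !fD !fZ (fC v w).
rewrite /z; move: (f v v) (f v w) (f w w) => [a a'] [b b'] [c c'] /=.
by congr (_ <= _); ring.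
Qed.

Lemma semi_cauchy_schwarz (v w : V) :
  nrm (f v w : R[i]^o) ^+ 2 <= complex.Re (f v v) * complex.Re (f w w).
Proof.
rewrite nrm_complexE sqr_sqrtr ?addr_ge0 ?sqr_ge0 //.
have H := expand v w; have v0 := f0 v; have w0 := f0 w.
move: (complex.Re (f v v)) (complex.Re (f w w)) v0 w0 H => a b a0 b0.
set F := _ + _ => H; have F0 : 0 <= F by rewrite /F addr_ge0 ?sqr_ge0.
have [b1|b1] := eqVneq b 0.
  subst b; rewrite mulr0 leNgt; apply/negP => F1.
  (* Without a quadratic term the polynomial is affine in [t]; at this point its value is -1. *)
  have := H (- (a + 1) / (2 * F)); rewrite mulr0 addr0.
  have -> : 2 * (- (a + 1) / (2 * F)) * F = - (a + 1) by field; rewrite gt_eqF.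
  lra.
have bp : 0 < b by rewrite lt_def b1.
(* The minimizer of the quadratic polynomial in [t]. *)
have := H (- b^-1).
have -> : a + 2 * - b^-1 * F + (- b^-1) ^+ 2 * F * b = (a * b - F) / b by field.
by rewrite ler_pdivlMr // mul0r subr_ge0.
Qed.

End SemiInnerProduct.

(** * The algebra of adjointable operators *)

Section ModuleBasics.
Variables (R : realType) (A : commCStarAlgType R) (E : hilbertModType A).
Implicit Types (u v w : E) (a : A) (S T : adjointable E).
Local Notation C := R[i].

Lemma ipNr v w : ip v (- w) = - ip v w :> A.
Proof. by rewrite -scaleN1r ipZr scaleN1r. Qed.

Lemma ipNl v w : ip (- v) w = - ip v w :> A.
Proof. by rewrite -ipC ipNr cstarN ipC. Qed.

Lemma ip0r v : ip v 0 = 0 :> A.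
Proof. by rewrite -(scale0r 0) ipZr !scale0r. Qed.

Lemma ipMl v w a : ip (mact v a) w = cmul (cstar a) (ip v w) :> A.
Proof. by rewrite -ipC ipMr cstarM ipC. Qed.

Lemma nrm_ip v : nrm (ip v v : A) = nrm v ^+ 2.
Proof.
by apply: (@complexI R); rewrite rmorphXn /= -!nrmE -ip_norm.
Qed.

Lemma ip_self_eq0 v : ip v v = 0 :> A -> v = 0.
Proof.
move=> v0; apply: nrm_eq0; apply/eqP; rewrite -sqrf_eq0 -nrm_ip v0.
by rewrite nrm0.
Qed.

Lemma ip_ext v w : (forall u, ip u v = ip u w :> A) -> v = w.
Proof.
move=> H; apply/eqP; rewrite -subr_eq0; apply/eqP/ip_self_eq0.
by rewrite ipDr ipNr H subrr.
Qed.

Lemma ip_adjr T v w : ip v (T w) = ip (astar T v) w :> A.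
Proof. exact/esym/(aopP (astar T)). Qed.

Lemma aopD T v w : T (v + w) = T v + T w.
Proof. by apply: ip_ext => u; rewrite ipDr !ip_adjr ipDr. Qed.

Lemma aopZ T (z : C) v : T (z *: v) = z *: T v.
Proof. by apply: ip_ext => u; rewrite ipZr !ip_adjr ipZr. Qed.

Lemma aop0 T : T 0 = 0.
Proof. by rewrite -(scale0r 0) aopZ !scale0r. Qed.

Lemma aopN T v : T (- v) = - T v.
Proof. by rewrite -scaleN1r aopZ scaleN1r. Qed.

Lemma aopB T v w : T (v - w) = T v - T w.
Proof. by rewrite aopD aopN. Qed.

Lemma adj_ext S T : (forall v, S v = T v) -> S = T.
Proof.
case: S T => [S S' SP] [T T' TP] /= H.
have E1 : S = T by apply/funext.
have E2 : S' = T'.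
  by apply/funext => w; apply: ip_ext => u; rewrite -SP -TP H.
by subst; congr Adjointable; exact: Prop_irrelevance.
Qed.

Let zeroP v w : ip (0 : E) w = ip v (0 : E) :> A.
Proof. by rewrite ip0r -ipC ip0r -(scale0r 0) cstarZc rmorph0 !scale0r. Qed.

Let addA : associative (@aadd R A E).
Proof. by move=> ? ? ?; apply: adj_ext => v /=; rewrite addrA. Qed.
Let addC : commutative (@aadd R A E).
Proof. by move=> ? ?; apply: adj_ext => v /=; rewrite addrC. Qed.
Let add0 : left_id (Adjointable zeroP) (@aadd R A E).
Proof. by move=> ?; apply: adj_ext => v /=; rewrite add0r. Qed.
Let addN : left_inverse (Adjointable zeroP) (@ascale R A E (-1)) (@aadd R A E).
Proof. by move=> ?; apply: adj_ext => v /=; rewrite scaleN1r addNr. Qed.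
(** The algebraic structures are built on [aadd], [acomp] and [ascale] themselves, so ring notation
    is convertible with the operations used in the definition of the trace. *)
HB.instance Definition _ := GRing.isZmodule.Build (adjointable E) addA addC add0 addN.

Let mulA : associative (@acomp R A E).
Proof. by move=> ? ? ?; exact: adj_ext. Qed.
Let mul1 : left_id (@aid R A E) (@acomp R A E).
Proof. by move=> ?; exact: adj_ext. Qed.
Let mulr1' : right_id (@aid R A E) (@acomp R A E).
Proof. by move=> ?; exact: adj_ext. Qed.
Let mulDl : left_distributive (@acomp R A E) +%R.
Proof. by move=> ? ? ?; exact: adj_ext. Qed.
Let mulDr : right_distributive (@acomp R A E) +%R.
Proof. by move=> S T U; apply: adj_ext => v /=; exact: aopD. Qed.
HB.instance Definition _ := GRing.Zmodule_isPzRing.Build (adjointable E)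
  mulA mul1 mulr1' mulDl mulDr.

Let scA (x y : C) T : ascale x (ascale y T) = ascale (x * y) T.
Proof. by apply: adj_ext => v /=; rewrite scalerA. Qed.
Let sc1 : left_id 1 (@ascale R A E).
Proof. by move=> T; apply: adj_ext => v /=; rewrite scale1r. Qed.
Let scDr : right_distributive (@ascale R A E) +%R.
Proof. by move=> x S T; apply: adj_ext => v /=; rewrite scalerDr. Qed.
Let scDl T : {morph (@ascale R A E)^~ T : x y / x + y >-> x + y}.
Proof. by move=> x y; apply: adj_ext => v /=; rewrite scalerDl. Qed.
HB.instance Definition _ := GRing.Zmodule_isLmodule.Build C (adjointable E)
  scA sc1 scDr scDl.

Lemma aaddE S T v : (S + T) v = S v + T v. Proof. by []. Qed.
Lemma aoppE T v : (- T) v = - T v. Proof. exact: scaleN1r. Qed.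
Lemma asubE S T v : (S - T) v = S v - T v. Proof. by rewrite aaddE aoppE. Qed.
Lemma amulE S T v : (S * T) v = S (T v). Proof. by []. Qed.
Lemma ascaleE (z : C) T v : (z *: T) v = z *: T v. Proof. by []. Qed.
Lemma aoneE v : (1 : adjointable E) v = v. Proof. by []. Qed.
Lemma azeroE v : (0 : adjointable E) v = 0. Proof. by []. Qed.

Lemma ascalerAl (z : C) S T : z *: (S * T) = (z *: S) * T.
Proof. exact: adj_ext. Qed.
Lemma ascalerAr (z : C) S T : z *: (S * T) = S * (z *: T).
Proof. by apply: adj_ext => v; rewrite ascaleE !amulE ascaleE aopZ. Qed.

Lemma astarK T : astar (astar T) = T. Proof. exact: adj_ext. Qed.
Lemma astarD S T : astar (S + T) = astar S + astar T. Proof. exact: adj_ext. Qed.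
Lemma astarM S T : astar (S * T) = astar T * astar S. Proof. exact: adj_ext. Qed.
Lemma astarZ (z : C) T : astar (z *: T) = z^*%C *: astar T. Proof. exact: adj_ext. Qed.
Lemma astarZr (r : R) T : astar (r%:C *: T) = r%:C *: astar T.
Proof. by rewrite astarZ conjc_real. Qed.
Lemma astarN T : astar (- T) = - astar T.
Proof. by rewrite -scaleN1r astarZ rmorphN rmorph1 scaleN1r. Qed.
Lemma astar1 : astar (1 : adjointable E) = 1. Proof. exact: adj_ext. Qed.
Lemma astar0 : astar (0 : adjointable E) = 0. Proof. exact: adj_ext. Qed.
Lemma astarB S T : astar (S - T) = astar S - astar T.
Proof. by rewrite astarD astarN. Qed.
Lemma astarX T n : astar (T ^+ n) = astar T ^+ n.
Proof. by elim: n => [|n IH]; rewrite ?expr0 ?astar1 // exprS astarM IH -exprSr. Qed.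

Lemma ip_adjl T v w : ip (T v) w = ip v (astar T w) :> A. Proof. exact: aopP. Qed.

End ModuleBasics.

(** * Localized semi-inner products *)

Section Forms.
Variables (R : realType) (A : commCStarAlgType R) (E : hilbertModType A).
Implicit Types (u v w : E) (a : A) (S T : adjointable E).
Local Notation C := R[i].

(** The semi-inner product on [E] whose Hausdorff completion is [chi_* E]; most local arguments take
    place here, before completion. *)
Definition form (chi : A -> C) v w : C := chi (ip v w).
Definition sqn (chi : A -> C) v : R := complex.Re (form chi v v).

Section Char.
Variable chi : A -> C.
Hypothesis hchi : is_character chi.
Local Notation B := (form chi).
Local Notation N := (sqn chi).

Lemma formDr u v w : B u (v + w) = B u v + B u w.
Proof. by rewrite /form ipDr (chiD hchi). Qed.
Lemma formDl u v w : B (u + v) w = B u w + B v w.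
Proof. by rewrite /form ipDl (chiD hchi). Qed.
Lemma formZr (z : C) v w : B v (z *: w) = z * B v w.
Proof. by rewrite /form ipZr (chiZ hchi). Qed.
Lemma formZl (z : C) v w : B (z *: v) w = z^*%C * B v w.
Proof. by rewrite /form ipZl (chiZ hchi). Qed.
Lemma formNr v w : B v (- w) = - B v w.
Proof. by rewrite /form ipNr (chiN hchi). Qed.
Lemma formNl v w : B (- v) w = - B v w.
Proof. by rewrite /form ipNl (chiN hchi). Qed.
Lemma formC v w : B w v = (B v w)^*%C.
Proof. by rewrite /form -ipC (chi_star hchi). Qed.
Lemma form_adjl T v w : B (T v) w = B v (astar T w).
Proof. by rewrite /form ip_adjl. Qed.
Lemma form_adjr T v w : B v (T w) = B (astar T v) w.
Proof. by rewrite /form ip_adjr. Qed.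
Lemma form_mactr v w a : B v (mact w a) = B v w * chi a.
Proof. by rewrite /form ipMr (chiM hchi). Qed.

Lemma sqn_ge0 v : 0 <= N v.
Proof.
rewrite /sqn /form; have [b ->] := ip_ge0 v.
rewrite (chiM hchi) (chi_star hchi); case: (chi b) => x y /=.
by rewrite mulNr opprK addr_ge0 // -expr2 sqr_ge0.
Qed.

Lemma form_self v : B v v = (N v)%:C.
Proof.
have := formC v v; rewrite /sqn; case: (B v v) => x y /= [] /eqP.
by rewrite -subr_eq0 opprK -mulr2n mulrn_eq0 /= => /eqP ->.
Qed.

Lemma cauchy_schwarz v w : nrm (B v w : C^o) ^+ 2 <= N v * N w.
Proof.
apply: (semi_cauchy_schwarz (f := B)).
- exact: formDr.
- exact: formZr.
- exact: formC.
- exact: sqn_ge0.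
Qed.

Lemma sqnD v w : N (v + w) = N v + N w + 2 * complex.Re (B v w).
Proof.
rewrite /sqn !formDl !formDr (formC v w).
by move: (B v v) (B w w) (B v w) => [a a'] [b b'] [c c'] /=; ring.
Qed.

Lemma sqnN v : N (- v) = N v.
Proof. by rewrite /sqn formNl formNr opprK. Qed.

Lemma sqnZ (z : C) v : N (z *: v) = nrm (z : C^o) ^+ 2 * N v.
Proof.
rewrite nrm_complexE sqr_sqrtr ?addr_ge0 ?sqr_ge0 //.
rewrite /sqn formZl formZr.
by move: (B v v) z => [a a'] [b b'] /=; ring.
Qed.

Lemma sqnB v w : N (v - w) = N v + N w - 2 * complex.Re (B v w).
Proof. by rewrite sqnD sqnN formNr; case: (B v w) => a b /=; ring. Qed.

Lemma sqnD_le v w : N (v + w) <= 2 * N v + 2 * N w.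
Proof. by have := sqn_ge0 (v - w); have := sqnB v w; have := sqnD v w; lra. Qed.

Lemma sqn_mact v a : N (mact v a) = nrm (chi a : C^o) ^+ 2 * N v.
Proof.
rewrite nrm_complexE sqr_sqrtr ?addr_ge0 ?sqr_ge0 // /sqn.
rewrite form_mactr formC form_mactr.
by rewrite (form_self v); case: (chi a) => b b' /=; ring.
Qed.

Lemma sqn_le v : N v <= nrm v ^+ 2.
Proof.
rewrite -nrm_ip; apply: le_trans (chi_le hchi _).
by rewrite -/(form chi v v) form_self nrm_real ler_norm.
Qed.

Lemma Re_form_le v w : 2 * `|complex.Re (B v w)| <= N v + N w.
Proof.
have := sqn_ge0 (v - w); have := sqnB v w; have := sqn_ge0 (v + w).
have := sqnD v w; case: (ger0P (complex.Re (B v w))); lra.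
Qed.

End Char.

Lemma nrm_le_sqn v (r : R) : 0 <= r ->
  (forall chi, is_character chi -> sqn chi v <= r ^+ 2) -> nrm v <= r.
Proof.
move=> r0 H; rewrite -(@ler_pXn2r _ 2) ?nnegrE ?nrm_ge0 //.
rewrite -nrm_ip; apply: nrm_le_chi => [|chi hchi]; first exact: exprn_ge0.
by rewrite -/(form chi v v) (form_self hchi) nrm_real ger0_norm ?H // sqn_ge0.
Qed.

Lemma sqn_ext v w :
  (forall chi, is_character chi -> sqn chi (v - w) <= 0) -> v = w.
Proof.
move=> H; apply/eqP; rewrite -subr_eq0; apply/eqP/nrm_eq0/eqP.
rewrite eq_le nrm_ge0 andbT; apply: nrm_le_sqn => // chi hchi.
by rewrite expr0n; exact: H.
Qed.

End Forms.

(** * Boundedness and completeness of the adjointable operators *)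

Section BoundedOperators.
Variables (R : realType) (A : commCStarAlgType R) (E : hilbertModType A).
Implicit Types (u v w : E) (a : A) (S T : adjointable E).
Local Notation C := R[i].

Lemma nrm_ip_le v w : nrm (ip v w : A) <= nrm v * nrm w.
Proof.
apply: nrm_le_chi => [|chi hchi]; first by rewrite mulr_ge0 ?nrm_ge0.
rewrite -(@ler_pXn2r _ 2) ?nnegrE ?mulr_ge0 ?nrm_ge0 //.
apply: le_trans (cauchy_schwarz hchi v w) _; rewrite exprMn.
by apply: ler_pM; rewrite ?sqn_ge0 ?sqn_le.
Qed.

Definition bnd T (c : R) := forall v, nrm (T v) <= c * nrm v.

Lemma bnd_star T c : bnd T c -> bnd (astar T) c.
Proof.
move=> Tc v; have := nrm_ip_le v (T (astar T v)).
rewrite ip_adjr nrm_ip => h.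
have [->|n0] := eqVneq (nrm (astar T v)) 0.
  have := Tc (astar T v); have := nrm_ge0 (T v); have := Tc v; lra.
have p0 : 0 < nrm (astar T v) by rewrite lt_def n0 nrm_ge0.
rewrite -(ler_pM2r p0) -expr2; apply: le_trans h _.
by rewrite -mulrA mulrCA ler_wpM2l ?nrm_ge0.
Qed.

Lemma bndD S T c d : bnd S c -> bnd T d -> bnd (S + T) (c + d).
Proof.
by move=> h1 h2 v; apply: le_trans (nrmD _ _) _; rewrite mulrDl lerD.
Qed.

Lemma bndM S T c d : 0 <= c -> bnd S c -> bnd T d -> bnd (S * T) (c * d).
Proof.
move=> c0 h1 h2 v; apply: le_trans (h1 _) _.
by rewrite -mulrA ler_wpM2l.
Qed.

Lemma bndZ (z : C) T c : bnd T c -> bnd (z *: T) (nrm (z : C^o) * c).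
Proof. by move=> h v; rewrite ascaleE nrmZ -mulrA ler_wpM2l ?nrm_ge0. Qed.

Lemma bndZr (r : R) T c : 0 <= r -> bnd T c -> bnd (r%:C *: T) (r * c).
Proof. by move=> r0 /(bndZ r%:C); rewrite nrm_real ger0_norm. Qed.

Lemma bndN T c : bnd T c -> bnd (- T) c.
Proof. by move=> h v; rewrite aoppE nrmN. Qed.

Lemma bndB S T c d : bnd S c -> bnd T d -> bnd (S - T) (c + d).
Proof. by move=> h1 /bndN; exact: bndD. Qed.

Lemma bnd_le T c d : c <= d -> bnd T c -> bnd T d.
Proof.
by move=> cd h v; apply: le_trans (h v) _; rewrite ler_wpM2r ?nrm_ge0.
Qed.

Lemma bnd1 : bnd (1 : adjointable E) 1.
Proof. by move=> v; rewrite mul1r. Qed.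

Lemma bnd0 : bnd (0 : adjointable E) 0.
Proof. by move=> v; rewrite azeroE nrm0 mul0r. Qed.

Lemma bnd_vanishing (e : nat -> R) (c : R) S T : vanishing e -> 0 <= c ->
  (forall n, bnd (S - T) (c * e n)) -> S = T.
Proof.
move=> ev c0 h; apply: adj_ext => v; apply/eqP; rewrite -subr_eq0.
apply/eqP/nrm_eq0/eqP; rewrite eq_le nrm_ge0 andbT.
apply: (vanishing_le0 (e := e) (c := c * nrm v)); rewrite ?mulr_ge0 ?nrm_ge0 //.
by move=> n; have := h n v; rewrite asubE mulrAC.
Qed.

(* Uniform boundedness by a gliding hump: the maps [w |-> <T v, w>] with
   [|v| <= 1] are pointwise bounded by [|T^* w|]. *)
Lemma adj_bounded T : exists2 c, 0 < c & bnd T c.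
Proof.
have [//|H] := pselect (exists2 c, 0 < c & bnd T c).
(* Step [n] gains [3^-n |T x_n|], and the later steps move the limit by at most [3^-n / 2], so half
   the gain remains. [K n] converts that half into [n |x_n|]; the summand 1 excludes [T x_n = 0] for
   [n = 0]. *)
pose K n : R := n%:R * 2 * 3 ^+ n + 1.
have K0 n : 0 < K n by rewrite ltr_wpDl // !mulr_ge0 ?exprn_ge0.
have ex n : exists v, K n * nrm v < nrm (T v).
  apply: contrapT => h; apply: H; exists (K n) => // v.
  by rewrite leNgt; apply/negP => h'; apply: h; exists v.
pose x n := sval (cid (ex n)).
have xP n : K n * nrm (x n) < nrm (T (x n)) by rewrite /x; case: cid.
have Tx n : 0 < nrm (T (x n)).
  by apply: le_lt_trans (xP n); rewrite mulr_ge0 ?nrm_ge0 ?(ltW (K0 n)).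
have step n w : exists y, nrm (y - w) <= (3^-1) ^+ n /\
    (3^-1) ^+ n * nrm (T (x n)) <= nrm (ip (T (x n)) y : A).
  set t := T (x n); set r := (3^-1) ^+ n : R.
  have r0 : 0 <= r by rewrite exprn_ge0 ?invr_ge0.
  pose b := (r / nrm t)%:C *: t.
  have nt : nrm t != 0 by rewrite gt_eqF ?Tx.
  have nb : nrm b = r.
    by rewrite /b nrmZ nrm_real ger0_norm ?divr_ge0 ?nrm_ge0 // divfK.
  have ipb : nrm (ip t b : A) = r * nrm t.
    rewrite /b ipZr nrmZ nrm_real nrm_ip ger0_norm ?divr_ge0 ?nrm_ge0 //.
    by field.
  (* Hence one of the two signs achieves the required gain, whatever [w] is. *)
  have : 2 * nrm (ip t b : A) <= nrm (ip t (w + b) : A) + nrm (ip t (w - b) : A).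
    have -> : 2 * nrm (ip t b : A) = nrm (ip t (w + b) - ip t (w - b) : A).
      rewrite !ipDr ipNr opprD opprK addrACA subrr add0r.
      by rewrite nrm_double.
    by apply: le_trans (nrmD _ _) _; rewrite nrmN.
  rewrite ipb => h.
  have [h1|h1] := leP (r * nrm t) (nrm (ip t (w + b) : A)).
    by exists (w + b); rewrite addrC addKr nb.
  exists (w - b); split; last lra.
  by rewrite addrC addKr nrmN nb.
pose next n w := sval (cid (step n w)).
have nextP n w := svalP (cid (step n w)).
pose ws := fix ws n := if n is m.+1 then next m (ws m) else 0.
have [l hl] : exists l, forall n, nrm (l - ws n) <= 1 / (1 - 3^-1) * (3^-1) ^+ n.
  apply: geometric_limit; [lra|lra|lra|].
  by move=> n; rewrite mul1r; have [] := nextP n (ws n).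
have key n : n%:R <= nrm (astar T l).
  have [_ h1] := nextP n (ws n); have h2 := hl n.+1.
  set t := T (x n) in h1 *; set r := (3^-1) ^+ n in h1.
  have rp : 0 < r by rewrite exprn_gt0 // invr_gt0.
  have h3 := nrm_ip_le t (ws n.+1 - l).
  have h4 : nrm (ip t (ws n.+1) : A) - nrm (ip t (ws n.+1 - l) : A) <= nrm (ip t l : A).
    rewrite ipDr ipNr; have := nrm_sub_ge (ip t (ws n.+1) : A) (ip t l).
    by rewrite !lerBlDr => /le_trans; apply; rewrite addrC.
  have h5 := nrm_ip_le (x n) (astar T l); rewrite -ip_adjl -/t in h5.
  have h6 : nrm (ws n.+1 - l) <= r / 2.
    rewrite nrmB; apply: le_trans h2 _; rewrite exprS -/r.
    by rewrite (_ : 1 / (1 - 3^-1) * (3^-1 * r) = r / 2) //; field.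
  have h7 : nrm t * nrm (ws n.+1 - l) <= nrm t * (r / 2).
    by rewrite ler_wpM2l ?nrm_ge0.
  have h8 : r * nrm t <= nrm (ip t (ws n.+1) : A) := h1.
  have h9 : r / 2 * nrm t <= nrm (x n) * nrm (astar T l) by lra.
  have h10 := xP n; rewrite -/t in h10.
  have rE : r * 3 ^+ n = 1 by rewrite /r -exprMn mulVf ?expr1n // pnatr_eq0.
  have xn0 := nrm_ge0 (x n).
  have h11 : r / 2 * (K n * nrm (x n)) <= r / 2 * nrm t.
    by rewrite ler_wpM2l ?(ltW h10) // divr_ge0 // ltW.
  have h12 : n%:R * nrm (x n) <= nrm (x n) * nrm (astar T l).
    apply: le_trans h9; apply: le_trans h11.
    have -> : r / 2 * (K n * nrm (x n)) = (r * 3 ^+ n) * n%:R * nrm (x n) + r / 2 * nrm (x n).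
      by rewrite /K; field.
    by rewrite rE mul1r lerDl mulr_ge0 // divr_ge0 // ltW.
  have xnp : 0 < nrm (x n).
    rewrite lt_def xn0 andbT; apply/eqP => /nrm_eq0 E0.
    by have := Tx n; rewrite E0 aop0 nrm0 ltxx.
  by move: h12; rewrite mulrC ler_pM2l.
have := truncnS_gt (nrm (astar T l)); rewrite ltNge => /negP; case; exact: key.
Qed.

(** By [bnd_star] the adjoints converge at the same rate, and their limit is an adjoint of the
    limit. *)
Lemma adj_complete (T : nat -> adjointable E) (e : nat -> R) :
  vanishing e -> (forall n, 0 <= e n) ->
  (forall n m, (n <= m)%N -> bnd (T m - T n) (e n)) ->
  exists L, forall n, bnd (L - T n) (e n).
Proof.
move=> ev e0 H.
have ev' r : 0 <= r -> vanishing (fun n => e n * r).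
  move=> r0 d d0; have r1 : 0 < r + 1 by rewrite ltr_wpDl.
  have [n hn] := ev _ (divr_gt0 d0 r1); exists n.
  move: hn; rewrite ltr_pdivlMr // => hn; apply: le_lt_trans hn.
  by rewrite ler_wpM2l // lerDl.
have lim (U : nat -> adjointable E) :
    (forall n m, (n <= m)%N -> bnd (U m - U n) (e n)) ->
    exists L : E -> E, forall n v, nrm (L v - U n v) <= e n * nrm v.
  move=> HU.
  have ex v : exists l, forall n, nrm (l - U n v) <= e n * nrm v.
    apply: (complete_rate (ev' _ (nrm_ge0 v))) => n m nm.
    by rewrite -asubE; exact: HU.
  exists (fun v => sval (cid (ex v))) => n v.
  exact: (svalP (cid (ex v))).
have [L hL] := lim _ H.
have [|L' hL'] := lim (fun n => astar (T n)).
  by move=> n m nm; rewrite -astarB; apply: bnd_star; exact: H.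
have LP v w : ip (L v) w = ip v (L' w) :> A.
  apply/eqP; rewrite -subr_eq0; apply/eqP/nrm_eq0/eqP.
  rewrite eq_le nrm_ge0 andbT.
  apply: (vanishing_le0 (e := e) (c := 2 * nrm v * nrm w)) => //.
    by rewrite !mulr_ge0 ?nrm_ge0.
  move=> n; have -> : ip (L v) w - ip v (L' w) =
      ip (L v - T n v) w + ip v (astar (T n) w - L' w) :> A.
    by rewrite ipDl ipDr ipNl ipNr ip_adjl addrA subrK.
  apply: le_trans (nrmD _ _) _.
  have h1 := nrm_ip_le (L v - T n v) w.
  have h2 := nrm_ip_le v (astar (T n) w - L' w).
  have h3 : nrm (L v - T n v) * nrm w <= e n * nrm v * nrm w.
    by rewrite ler_wpM2r ?nrm_ge0 ?hL.
  have h4 : nrm v * nrm (astar (T n) w - L' w) <= nrm v * (e n * nrm w).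
    by rewrite ler_wpM2l ?nrm_ge0 // nrmB hL'.
  lra.
by exists (Adjointable LP) => n v; rewrite asubE; exact: hL.
Qed.

End BoundedOperators.

(** * Positive operators and their square roots *)

Section SquareRoot.
Variables (R : realType) (A : commCStarAlgType R) (E : hilbertModType A).
Implicit Types (u v w : E) (a : A) (S T X Y Z B : adjointable E).
Local Notation C := R[i].

(* The binomial series of [1 - sqrt (1 - y)] at [y = 1], as an iteration. *)
Let z := fix z n : R := if n is m.+1 then (1 + z m ^+ 2) / 2 else 0.

Let z01 n : 0 <= z n <= 1.
Proof. by elim: n => [|n /andP[h1 h2]] /=; [lra|apply/andP; split; nra]. Qed.

Let zS n : z n <= z n.+1.
Proof. by have := sqr_ge0 (z n - 1); rewrite /=; lra. Qed.

Let z_vanishing : vanishing (fun n => 1 - z n).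
Proof.
(* With [d = 1 - z n] the recursion reads [d - d^2 / 2], whose decay is of order [2 / n]. *)
have H n : n.+1%:R * (1 - z n) <= 2.
  elim: n => [|n IH]; first by rewrite /=; lra.
  have /andP[h1 h2] := z01 n.
  move: IH; rewrite -[n.+2%:R]natr1 /=; set m := n.+1%:R => IH.
  set d := 1 - z n in IH *; have zE : z n = 1 - d by rewrite /d; ring.
  have d0 : 0 <= d by rewrite /d; lra.
  have d1 : d <= 1 by rewrite /d; lra.
  rewrite zE; have : 0 <= (2 - m * d) * (1 - d / 2) by apply: mulr_ge0; lra.
  have := sqr_ge0 d; lra.
move=> d d0; have [n hn] := @vanishing_harmonic R 2 _ d0; exists n.
by apply: le_lt_trans hn; rewrite ler_pdivlMr // mulrC.
Qed.

Let half : C := (2^-1)%:C.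

Section Iteration.
Variable Y : adjointable E.
Hypotheses (Ys : astar Y = Y) (Y1 : bnd Y 1).
(** A fixed point [W] of this iteration satisfies [(1 - W)^2 = 1 - Y]. The iterates commute, so
    [Z n.+1 ^ 2 - Z n ^ 2] factors and the increments are dominated in norm by those of the scalar
    sequence [z]. *)
Let Z := fix Z n : adjointable E :=
  if n is m.+1 then half *: (Y + Z m * Z m) else 0.

Let halfS T : astar (half *: T) = half *: astar T.
Proof. exact: astarZr. Qed.

Let Zs n : astar (Z n) = Z n.
Proof.
by elim: n => [|n IH] /=; rewrite ?astar0 // halfS astarD astarM Ys IH.
Qed.

Let Z_comm X : X * Y = Y * X -> forall n, X * Z n = Z n * X.
Proof.
move=> XY; elim=> [|n IH] /=; first by rewrite mulr0 mul0r.
by rewrite -ascalerAr -ascalerAl mulrDr mulrDl XY mulrA IH -!mulrA IH.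
Qed.

Let Zbnd n : bnd (Z n) (z n).
Proof.
elim: n => [|n IH] /=; first exact: bnd0.
have /andP[z0 _] := z01 n.
rewrite mulrC; apply: bndZr; first by rewrite invr_ge0.
by apply: bndD => //; rewrite expr2; apply: bndM.
Qed.

Let ZZ n m : Z n * Z m = Z m * Z n.
Proof. by apply: Z_comm; exact/esym/Z_comm. Qed.

Let ZbndS n : bnd (Z n.+1 - Z n) (z n.+1 - z n).
Proof.
elim: n => [|n IH].
  rewrite /= !subr0 mulr0 addr0 expr0n addr0 mul1r -[2^-1]mulr1.
  by apply: bndZr; rewrite ?invr_ge0.
have -> : Z n.+2 - Z n.+1 = half *: ((Z n.+1 - Z n) * (Z n.+1 + Z n)).
  rewrite [Z n.+2]/= [X in _ - X = _]/= -scalerBr; congr (_ *: _).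
  rewrite opprD addrACA subrr add0r mulrBl !mulrDr (ZZ n n.+1) opprD.
  by rewrite -[half *: _]/(Z n.+1) [RHS]addrA addrK.
have -> : z n.+2 - z n.+1 = 2^-1 * ((z n.+1 - z n) * (z n.+1 + z n)).
  rewrite -[z n.+2]/((1 + z n.+1 ^+ 2) / 2) -[X in _ - X]/((1 + z n ^+ 2) / 2).
  by field.
apply: bndZr; first by rewrite invr_ge0.
apply: bndM => //; first by rewrite subr_ge0.
exact: bndD.
Qed.

Let Zbnd_le n m : (n <= m)%N -> bnd (Z m - Z n) (z m - z n).
Proof.
elim: m => [|m IH]; first by rewrite leqn0 => /eqP ->; rewrite !subrr; exact: bnd0.
rewrite leq_eqVlt => /orP[/eqP ->|/IH]; first by rewrite !subrr; exact: bnd0.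
move=> /(bndD (@ZbndS m)); by rewrite !subrKA.
Qed.

Lemma sqrt_unit : exists W, [/\ astar W = W, bnd W 1, (1 - W) * (1 - W) = 1 - Y &
  forall X, X * Y = Y * X -> X * W = W * X].
Proof.
have z1 n : 0 <= 1 - z n by have /andP[] := z01 n; lra.
have [n m nm|W hW] := adj_complete z_vanishing z1 (T := Z).
  apply: bnd_le (Zbnd_le nm); have /andP[] := z01 m; lra.
have W1 : bnd W 1.
  by have := bndD (hW 0%N) (@Zbnd 0%N); rewrite subrK /= subr0 addr0.
have lim_eq S T (c : R) : 0 <= c -> (forall n, bnd (S - T) (c * (1 - z n))) -> S = T.
  by move=> c0; exact: bnd_vanishing z_vanishing c0.
exists W; split=> //.
- apply: (lim_eq _ _ 2) => // n.
  have -> : astar W - W = astar (W - Z n) - (W - Z n).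
    by rewrite astarB Zs opprB addrA subrK.
  by apply: bnd_le (bndB (bnd_star (hW n)) (hW n)); lra.
- have HW : W = half *: (Y + W * W).
    apply: (lim_eq _ _ 2) => // n.
    have -> : W - half *: (Y + W * W) = (W - Z n.+1)
        - half *: (W * (W - Z n) + (W - Z n) * Z n).
      rewrite [Z n.+1]/= mulrBr mulrBl addrA subrK.
      rewrite -addrA -opprD -scalerDr; congr (_ - _ *: _).
      by rewrite addrAC addrA subrK addrC.
    apply: (@bnd_le _ _ _ _ ((1 - z n.+1) + 2^-1 * (1 * (1 - z n) + (1 - z n) * z n))).
      have /andP[h1 h2] := z01 n; have := zS n; nra.
    apply: bndB => //; apply: bndZr; first by rewrite invr_ge0.
    apply: bndD; apply: bndM => //.
  have WW : W + W = Y + W * W.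
    by rewrite {1 2}HW -scalerDl -rmorphD /= -div1r -splitr scale1r.
  rewrite mulrBl mul1r mulrBr mulr1 opprB addrCA -addrA -opprD WW opprD.
  by rewrite (addrC (- Y)) addrCA addNKr.
- move=> X XY; have [c c0 Xc] := adj_bounded X.
  apply: (lim_eq _ _ (2 * c)); first by rewrite mulr_ge0 // ltW.
  move=> n; have -> : X * W - W * X = X * (W - Z n) - (W - Z n) * X.
    by rewrite mulrBr mulrBl (Z_comm XY) opprB addrA subrK.
  apply: bnd_le (bndB (bndM (ltW c0) Xc (hW n)) (bndM (z1 n) (hW n) Xc)).
  lra.
Qed.

End Iteration.

(** A norm bound is global, the claim is local at [chi]. With [1 - T^* T / c^2 = (1 - W)^2] and [W]
    self-adjoint, the claim is [sqn chi ((1 - W) v) >= 0]. *)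
Lemma sqn_bnd T c chi v : is_character chi -> bnd T c -> 0 <= c ->
  sqn chi (T v) <= c ^+ 2 * sqn chi v.
Proof.
move=> hchi Tc c0; have [c1|cn] := eqVneq c 0.
  have -> : T v = 0.
    apply: nrm_eq0; apply/eqP; rewrite eq_le nrm_ge0 andbT.
    by have := Tc v; rewrite c1 mul0r.
  rewrite /sqn /form ip0r (chi0 hchi) /= mulr_ge0 ?sqr_ge0 //.
  exact: sqn_ge0.
pose Y := ((c ^+ 2)^-1)%:C *: (astar T * T).
have Ys : astar Y = Y by rewrite astarZr astarM astarK.
have Y1 : bnd Y 1.
  have -> : (1 : R) = (c ^+ 2)^-1 * (c * c) by rewrite -expr2 mulVf // sqrf_eq0.
  apply: bndZr; first by rewrite invr_ge0 sqr_ge0.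
  by apply: bndM => //; exact: bnd_star.
have [W [Ws _ W2 _]] := sqrt_unit Ys Y1.
have := sqn_ge0 hchi ((1 - W) v).
rewrite {1}/sqn form_adjl -amulE astarB astar1 Ws W2 asubE.
rewrite (formDr hchi) (formNr hchi) ascaleE (formZr hchi) amulE -form_adjl.
rewrite aoneE !(form_self hchi) -rmorphM -rmorphB /=.
have cp : 0 < c ^+ 2 by rewrite exprn_gt0 // lt_def cn.
by rewrite subr_ge0 mulrC ler_pdivrMr // mulrC.
Qed.

Lemma bnd_sqn T c : 0 <= c ->
  (forall chi v, is_character chi -> sqn chi (T v) <= c ^+ 2 * sqn chi v) -> bnd T c.
Proof.
move=> c0 H v; apply: nrm_le_sqn => [|chi hchi]; first by rewrite mulr_ge0 ?nrm_ge0.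
apply: le_trans (H _ _ hchi) _; rewrite exprMn ler_wpM2l ?sqr_ge0 //.
exact: sqn_le.
Qed.

(** Positivity tested at the characters, which is easy to verify for differences and multiples;
    [apositiveE] identifies it with [apositive]. *)
Definition opos T := astar T = T /\
  forall chi v, is_character chi -> 0 <= complex.Re (form chi v (T v)).

Lemma oposZ (r : R) T : 0 <= r -> opos T -> opos (r%:C *: T).
Proof.
move=> r0 [Ts T0]; split=> [|chi v hchi]; first by rewrite astarZr Ts.
rewrite ascaleE (formZr hchi); have := T0 _ v hchi.
by case: (form _ _ _) => x y /= x0; rewrite mul0r subr0 mulr_ge0.
Qed.

Lemma opos_sq S : astar S = S -> opos (S * S).
Proof.
move=> Ss; split=> [|chi v hchi]; first by rewrite astarM Ss.
by rewrite amulE form_adjr Ss; exact: (sqn_ge0 hchi).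
Qed.

Lemma opos_starM S : opos (astar S * S).
Proof.
split=> [|chi v hchi]; first by rewrite astarM astarK.
by rewrite amulE form_adjr astarK; exact: (sqn_ge0 hchi).
Qed.

Lemma opos_cauchy_schwarz T chi v w : opos T -> is_character chi ->
  nrm (form chi v (T w) : C^o) ^+ 2
    <= complex.Re (form chi v (T v)) * complex.Re (form chi w (T w)).
Proof.
move=> [Ts T0] hchi; apply: (semi_cauchy_schwarz (f := fun v w => form chi v (T w))).
- by move=> *; rewrite aopD formDr.
- by move=> *; rewrite aopZ formZr.
- by move=> x y; rewrite form_adjr Ts formC.
- by move=> x; exact: T0.
Qed.

(** Cauchy-Schwarz for the form of [T] at [v] and [T v] bounds the square of [sqn chi (T v)] by a
    product whose second factor is at most [sqn chi (T v)]. *)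
Lemma opos_contraction T chi v : opos T -> bnd T 1 -> is_character chi ->
  sqn chi (T v) <= complex.Re (form chi v (T v)).
Proof.
move=> Tp T1 hchi; have := opos_cauchy_schwarz v (T v) Tp hchi.
have [Ts T0] := Tp; have f0 := T0 _ v hchi.
rewrite [form chi v _]form_adjr Ts (form_self hchi) nrm_real.
have h1 : complex.Re (form chi (T v) (T (T v))) <= sqn chi (T v).
  have := Re_form_le hchi (T v) (T (T v)).
  have := sqn_bnd (T v) hchi T1 ler01; rewrite expr1n mul1r.
  have := ler_norm (complex.Re (form chi (T v) (T (T v)))); lra.
have s0 := sqn_ge0 hchi (T v); rewrite ger0_norm // => h2.
have [->|n0] := eqVneq (sqn chi (T v)) 0; first exact: f0.
have p0 : 0 < sqn chi (T v) by rewrite lt_def n0.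
rewrite -(ler_pM2r p0) -expr2; apply: le_trans h2 _.
by rewrite ler_wpM2l.
Qed.

Lemma opos_sqrt B : opos B -> exists Q, [/\ opos Q, Q * Q = B &
  forall X, X * B = B * X -> X * Q = Q * X].
Proof.
move=> Bp; have [c c0 Bc] := adj_bounded B.
pose D := (c^-1)%:C *: B.
have Dp : opos D by apply: oposZ; rewrite // invr_ge0 ltW.
have D1 : bnd D 1.
  rewrite -(mulVf (lt0r_neq0 c0)); apply: bndZr => //.
  by rewrite invr_ge0 ltW.
pose Y := 1 - D.
have Ys : astar Y = Y by rewrite astarB astar1 Dp.1.
have Y1 : bnd Y 1.
  apply: bnd_sqn => // chi v hchi; rewrite expr1n mul1r asubE aoneE sqnB //.
  by have := opos_contraction v Dp D1 hchi; have := Dp.2 _ v hchi; lra.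
have [W [Ws W1 W2 Wc]] := sqrt_unit Ys Y1.
have sc : 0 <= Num.sqrt c by exact: sqrtr_ge0.
exists ((Num.sqrt c)%:C *: (1 - W)); split.
- apply: oposZ => //; split=> [|chi v hchi]; first by rewrite astarB astar1 Ws.
  rewrite asubE (formDr hchi) (formNr hchi) aoneE (form_self hchi).
  have := Re_form_le hchi v (W v).
  have := sqn_bnd v hchi W1 ler01; rewrite expr1n mul1r.
  case: (form chi v (W v)) => x y /=; have := ler_norm x; lra.
- rewrite -ascalerAl -ascalerAr W2 scalerA -rmorphM /= -expr2 sqr_sqrtr ?(ltW c0) //.
  by rewrite /Y opprB addrC subrK scalerA -rmorphM /= divff ?rmorph1 ?scale1r // gt_eqF.
- move=> X XB; rewrite -ascalerAr -ascalerAl mulrBr mulrBl mulr1 mul1r.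
  rewrite Wc // /Y mulrBr mulrBl mulr1 mul1r.
  by rewrite -ascalerAr -ascalerAl XB.
Qed.

(** With [D = P - Q], the operators [P D] and [Q D] add up to [P^2 - Q^2 = 0]. So the forms of [P]
    and [Q] at [D v], both nonnegative, vanish; by Cauchy-Schwarz so does [<v, D (D v)>], the square
    norm of [D v]. *)
Lemma opos_sqrt_unique_comm P Q : opos P -> opos Q -> P * P = Q * Q ->
  P * Q = Q * P -> P = Q.
Proof.
move=> Pp Qp PQ2 PQ; apply: adj_ext => v; apply: sqn_ext => chi hchi.
rewrite -asubE; set D := P - Q.
have Ds : astar D = D by rewrite astarB Pp.1 Qp.1.
have PQD : P * D + Q * D = 0.
  by rewrite -mulrDl mulrDl !mulrBr PQ2 PQ addrA subrK subrr.
have S0 : complex.Re (form chi (D v) (P (D v))) + complex.Re (form chi (D v) (Q (D v))) = 0.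
  have -> : complex.Re (form chi (D v) (P (D v))) + complex.Re (form chi (D v) (Q (D v)))
      = complex.Re (form chi (D v) ((P * D + Q * D) v)).
    by rewrite aaddE (formDr hchi); case: (form _ _ _) (form _ _ _) => [? ?] [? ?].
  by rewrite PQD azeroE /form ip0r (chi0 hchi).
have P0 := Pp.2 _ (D v) hchi; have Q0 := Qp.2 _ (D v) hchi.
have zero T : opos T -> complex.Re (form chi (D v) (T (D v))) = 0 ->
    form chi v (T (D v)) = 0.
  move=> Tp T0; have := opos_cauchy_schwarz v (D v) Tp hchi; rewrite T0 mulr0.
  by rewrite exprn_even_le0 //= => /eqP /(@nrm_eq0 R C^o).
have : form chi v (D (D v)) = 0.
  by rewrite {1}/D asubE (formDr hchi) (formNr hchi) !zero ?subr0 //; lra.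
by rewrite form_adjr Ds (form_self hchi) => /(congr1 (@complex.Re _)) /= ->.
Qed.

End SquareRoot.

(** * Uniqueness of square roots, and absolute values *)

Section AbsoluteValue.
Variables (R : realType) (A : commCStarAlgType R) (E : hilbertModType A).
Implicit Types (u v w : E) (a : A) (S T X Y Z B Q : adjointable E).
Local Notation C := R[i].

Lemma apositiveE T : apositive T <-> opos T.
Proof.
split=> [[S ->]|Tp]; first exact: opos_starM.
by have [Q [[Qs _] <- _]] := opos_sqrt Tp; exists Q; rewrite Qs.
Qed.

(** The constructed root commutes with everything that commutes with the square, in particular with
    [Q] and with [T]; each of them equals it by the commuting case. *)
Lemma opos_sqrt_unique Q T : opos Q -> opos T -> Q * Q = T * T -> Q = T.
Proof.
move=> Qp Tp QT.
have [S [Sp S2 Sc]] := opos_sqrt (opos_sq Tp.1).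
have -> : T = S by apply: opos_sqrt_unique_comm; rewrite // Sc // mulrA.
apply: opos_sqrt_unique_comm => //; first by rewrite QT S2.
by rewrite Sc // -QT mulrA.
Qed.

Lemma asqrt_eq Q T : opos Q -> Q * Q = T -> asqrt T = Q.
Proof.
move=> Qp <-; rewrite /asqrt; case: xgetP => [S _ [/apositiveE Sp S2]|/(_ Q) H].
  exact: opos_sqrt_unique.
by case: H; split=> //; exact/apositiveE.
Qed.

Lemma asqrt_opos T : opos T -> opos (asqrt T).
Proof. by move=> /opos_sqrt[Q [Qp Q2 _]]; rewrite (asqrt_eq Qp Q2). Qed.

Lemma asqrt_sq T : opos T -> asqrt T * asqrt T = T.
Proof. by move=> /opos_sqrt[Q [Qp Q2 _]]; rewrite (asqrt_eq Qp Q2). Qed.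

Lemma aabs_opos T : opos (aabs T).
Proof. exact/asqrt_opos/opos_starM. Qed.

Lemma aabs_sq T : aabs T * aabs T = astar T * T.
Proof. exact/asqrt_sq/opos_starM. Qed.

Lemma aabs_eq Q T : opos Q -> Q * Q = astar T * T -> aabs T = Q.
Proof. exact: asqrt_eq. Qed.

Lemma sqn_starM_eq S T chi v : astar S * S = astar T * T ->
  sqn chi (S v) = sqn chi (T v).
Proof. by move=> ST; rewrite /sqn !form_adjl -!amulE ST. Qed.

End AbsoluteValue.

(** * Decay of the powers of [1 - B] for a positive contraction [B] *)

Section Decay.
Variables (R : realType) (A : commCStarAlgType R) (E : hilbertModType A).
Variable B : adjointable E.
Hypotheses (Bp : opos B) (B1 : bnd B 1).
Local Notation D := (1 - B).

Lemma opos_compl_bnd : bnd D 1.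
Proof.
apply: bnd_sqn => // chi v hchi; rewrite expr1n mul1r asubE aoneE sqnB //.
by have := opos_contraction v Bp B1 hchi; have := Bp.2 _ v hchi; lra.
Qed.

Lemma bndX (T : adjointable E) n : bnd T 1 -> bnd (T ^+ n) 1.
Proof.
move=> T1; elim: n => [|n IH]; first exact: bnd1.
by have := bndM ler01 T1 IH; rewrite mulr1 exprS.
Qed.

(** An elementary substitute for [x (1 - x)^(2 n) <= 1 / (n + 1)] on the spectrum. The quantity
    [g (D^k v)] decreases in [k] and is at most the drop of [sqn] from [D^k v] to [D^(k+1) v]; the
    drops telescope. *)
Lemma decay chi v n : is_character chi ->
  complex.Re (form chi ((D ^+ n) v) (B ((D ^+ n) v))) <= sqn chi v / n.+1%:R.
Proof.
move=> hchi.
pose g u : R := complex.Re (form chi u (B u)).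
have g_step u : g u <= sqn chi u - sqn chi (D u).
  rewrite asubE aoneE sqnB //.
  by have := opos_contraction u Bp B1 hchi; rewrite -/(g u); lra.
have g_mono u : g (D u) <= g u.
  rewrite /g asubE aoneE aopB.
  have -> : complex.Re (form chi (u - B u) (B u - B (B u))) =
      complex.Re (form chi u (B u)) - 2 * sqn chi (B u)
        + complex.Re (form chi (B u) (B (B u))).
    rewrite !(formDr hchi) !(formDl hchi) !(formNr hchi) !(formNl hchi).
    rewrite [form chi u (B (B u))]form_adjr Bp.1 /sqn.
    by case: (form _ _ _) (form _ _ _) (form _ _ _) => [? ?] [? ?] [? ?] /=; ring.
  have := Re_form_le hchi (B u) (B (B u)).
  have := sqn_bnd (B u) hchi B1 ler01; rewrite expr1n mul1r.
  have := sqn_ge0 hchi (B u).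
  by have := ler_norm (complex.Re (form chi (B u) (B (B u)))); lra.
have main k : k%:R * g ((D ^+ k) v) <= sqn chi v - sqn chi ((D ^+ k) v).
  elim: k => [|k IH]; first by rewrite mul0r expr0 aoneE subrr.
  rewrite exprS amulE -natr1.
  have h1 := g_mono ((D ^+ k) v); have h2 := g_step ((D ^+ k) v).
  have h3 : k%:R * g (D ((D ^+ k) v)) <= k%:R * g ((D ^+ k) v) by rewrite ler_wpM2l.
  lra.
have := main n; have := g_step ((D ^+ n) v).
rewrite ler_pdivlMr // -natr1 -/(g _).
have := sqn_ge0 hchi (D ((D ^+ n) v)); lra.
Qed.

Definition neumann n : adjointable E := \sum_(k < n) D ^+ k.

Lemma neumann_mul n : B * neumann n = 1 - D ^+ n.
Proof.
by rewrite -opprB subrX1 addrAC subrr add0r mulNr opprK.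
Qed.

Lemma neumann_comm (T : adjointable E) n : T * B = B * T -> T * neumann n = neumann n * T.
Proof.
move=> TB; rewrite -[_ = _]/(GRing.comm _ _); apply: commr_sum => k _.
by apply/commrX/commrB => //; exact: commr1.
Qed.

End Decay.

(** * Existence of weak polar decompositions *)

Section WeakPolar.
Variables (R : realType) (A : commCStarAlgType R) (E : hilbertModType A).
Implicit Types (u v w : E) (a : A) (S T X Y Z B Q : adjointable E).
Local Notation C := R[i].

Lemma vanishing_sqrt (e : nat -> R) : vanishing e -> vanishing (Num.sqrt \o e).
Proof.
move=> ev d d0; have [n hn] := ev _ (exprn_gt0 2 d0); exists n => /=.
have [e0|e0] := lerP 0 (e n); last by rewrite ler0_sqrtr // ltW.
by rewrite -[ltRHS]gtr0_norm // -sqrtr_sqr ltr_sqrt ?exprn_gt0.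
Qed.

(* With [P = |X|], [Q = sqrt P], [B = P / c] and [G n] the partial sums of the
   Neumann series of [B^-1], the factor is the norm limit of [X Q (G n) / c],
   since [X Q (G n) Q / c = X (1 - (1 - B) ^ n)]. *)
Lemma weak_polar_exists X : exists S, X = S * asqrt (aabs X) /\ astar S * S = aabs X.
Proof.
set P := aabs X; set Q := asqrt P.
have Pp : opos P := aabs_opos X.
have Qp : opos Q := asqrt_opos Pp.
have Q2 : Q * Q = P := asqrt_sq Pp.
have P2 : P * P = astar X * X := aabs_sq X.
have [c c0 Pc] := adj_bounded P.
pose B := (c^-1)%:C *: P.
have PB : P = c%:C *: B.
  by rewrite scalerA -rmorphM /= divff ?rmorph1 ?scale1r // gt_eqF.
have Bp : opos B by apply: oposZ; rewrite // invr_ge0 ltW.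
have B1 : bnd B 1.
  rewrite -(mulVf (lt0r_neq0 c0)); apply: bndZr => //.
  by rewrite invr_ge0 ltW.
pose D := 1 - B; have D1 : bnd D 1 := opos_compl_bnd Bp B1.
have Ds n : astar (D ^+ n) = D ^+ n by rewrite astarX astarB astar1 Bp.1.
pose G n := neumann B n.
have QB : GRing.comm Q B.
  by rewrite /GRing.comm -ascalerAl -ascalerAr -Q2 mulrA.
have QG n : GRing.comm Q (G n) by exact: neumann_comm.
have BG n : B * G n = 1 - D ^+ n by exact: neumann_mul.
have QD n : GRing.comm Q (D ^+ n) by apply/commrX/commrB => //; exact: commr1.
have BD n : GRing.comm B (D ^+ n) by apply/commrX/commrB => //; exact: commr1.
pose S n := (c^-1)%:C *: (X * Q * G n).
have Sdiff n m : S m - S n = (c^-1)%:C *: (X * Q * (G m - G n)).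
  by rewrite mulrBr scalerBr.
have sqnX T chi v : sqn chi ((X * T) v) = sqn chi ((P * T) v).
  by rewrite !amulE; apply: sqn_starM_eq; rewrite -P2 Pp.1.
(* [X] may be replaced by [P] under [sqn]; then [P / c] times [G m - G n] collapses to
   [D ^ n - D ^ m]. *)
have sqnSdiff n m chi v : is_character chi ->
    sqn chi ((S m - S n) v) = sqn chi ((Q * (D ^+ n - D ^+ m)) v).
  move=> hchi; rewrite Sdiff -mulrA ascalerAr sqnX -ascalerAr ascalerAl.
  congr (sqn chi (_ v)); rewrite -/B mulrA -QB -mulrA mulrBr !BG.
  by rewrite opprB addrC addrA subrK.
have Dmn n m : (n <= m)%N -> D ^+ n - D ^+ m = D ^+ n * (1 - D ^+ (m - n)).
  by move=> nm; rewrite mulrBr mulr1 -exprD subnKC.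
(* Meant for [T = 1 - D ^ (m - n)], of norm at most 2, whence the constant 4. *)
have sqnQ n T chi v : is_character chi -> bnd T 2 ->
    sqn chi ((Q * (D ^+ n * T)) v) <= 4 * c / n.+1%:R * sqn chi v.
  move=> hchi T2; rewrite !amulE /sqn form_adjl Qp.1 -(amulE Q Q) Q2.
  rewrite PB ascaleE (formZr hchi).
  have := decay Bp B1 (T v) n hchi; rewrite -/D.
  have := sqn_bnd v hchi T2 (ler0n _ 2).
  case: (form _ _ _) => x y /= h1 h2; rewrite mul0r subr0.
  have -> : 4 * c / n.+1%:R * sqn chi v = c * (2 ^+ 2 * sqn chi v / n.+1%:R).
    by field; rewrite addrC natr1 pnatr_eq0.
  rewrite ler_wpM2l ?(ltW c0) //; apply: le_trans h2 _.
  by rewrite ler_wpM2r ?invr_ge0.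
pose e n : R := Num.sqrt (4 * c / n.+1%:R).
have e0 n : 0 <= e n by exact: sqrtr_ge0.
have e2 n : e n ^+ 2 = 4 * c / n.+1%:R.
  by rewrite sqr_sqrtr // divr_ge0 // mulr_ge0 // ltW.
have ev : vanishing e by apply: vanishing_sqrt; exact: vanishing_harmonic.
have e_le n : e n <= e 0%N.
  rewrite /e ler_wsqrtr // ler_wpM2l ?mulr_ge0 ?(ltW c0) //.
  by rewrite lef_pV2 ?posrE ?ltr0n // ler_nat.
have [n m nm|L hL] := adj_complete ev e0 (T := S).
  apply: bnd_sqn => // chi v hchi; rewrite sqnSdiff // Dmn // e2.
  by apply: sqnQ => //; apply: (bndB (bnd1 (E := E)) (bndX _ D1)).
have [q q0 Qq] := adj_bounded Q.
have PDn n : bnd (P * D ^+ n) (q * e n).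
  apply: bnd_sqn => [|chi v hchi]; first by rewrite mulr_ge0 // ltW.
  rewrite -Q2 -mulrA amulE exprMn e2 -(mulrA (q ^+ 2)).
  apply: le_trans (sqn_bnd _ hchi Qq (ltW q0)) _; rewrite ler_wpM2l ?sqr_ge0 //.
  by have := @sqnQ n 1 chi v hchi; rewrite mulr1; apply; apply: bnd_le (bnd1 (E := E)); lra.
have XDn n : bnd (X * D ^+ n) (q * e n).
  apply: bnd_sqn => [|chi v hchi]; first by rewrite mulr_ge0 // ltW.
  by rewrite sqnX; apply: sqn_bnd => //; rewrite mulr_ge0 // ltW.
exists L; split.
  apply/esym; apply: (bnd_vanishing ev (c := 2 * q)); first by rewrite mulr_ge0 // ltW.
  move=> n; have -> : L * Q - X = (L - S n) * Q - X * D ^+ n.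
    have SQ : S n * Q = X - X * D ^+ n.
      rewrite /S -ascalerAl -mulrA -QG mulrA -(mulrA X) Q2 -mulrA ascalerAr ascalerAl.
      by rewrite -/B BG mulrBr mulr1.
    by rewrite mulrBl SQ opprB addrA addrAC addrK.
  by apply: bnd_le (bndB (bndM (e0 n) (hL n) Qq) (XDn n)); lra.
have [l l0 Ll] := adj_bounded L.
apply: (bnd_vanishing ev (c := 2 * l + e 0%N + 3 * q)).
  by rewrite !addr_ge0 ?mulr_ge0 ?(ltW l0) ?(ltW q0).
move=> n; set W := L - S n.
(* The expansion of [(1 - D ^ n) P (1 - D ^ n)]; each term in the correction contains the small
   factor [P D ^ n] or its adjoint. *)
have SS : astar (S n) * S n = P - (D ^+ n * P + (P * D ^+ n - D ^+ n * (P * D ^+ n))).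
  pose K := (c^-1)%:C *: (Q * G n).
  have SK : S n = X * K by rewrite /S /K -ascalerAr mulrA.
  have PK : P * K = Q * (1 - D ^+ n).
    by rewrite /K -ascalerAr ascalerAl -/B mulrA -QB -mulrA BG.
  rewrite SK astarM mulrA -(mulrA (astar K)) -P2 -{1}Pp.1 mulrA -astarM -mulrA PK.
  rewrite astarM astarB astar1 Ds Qp.1 mulrA -(mulrA (1 - _)) Q2.
  rewrite !mulrBl mul1r !mulrBr !mulr1 -!mulrA [in RHS]opprD !opprB -addrA.
  by congr (_ + _); rewrite addrCA [RHS]addrCA (addrC (- (P * _))).
have -> : astar L * L - P = (astar L * W + astar W * L - astar W * W)
   - (D ^+ n * P + (P * D ^+ n - D ^+ n * (P * D ^+ n))).
  have -> : astar L * W + astar W * L - astar W * W = astar L * L - astar (S n) * S n.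
    have LW : L - W = S n by rewrite /W opprB addrC subrK.
    by rewrite -addrA -mulrBr LW /W mulrBr astarB mulrBl addrA subrK.
  by rewrite SS opprB addrA addrAC addrK.
have We := hL n; have Wse := bnd_star We; have Ls := bnd_star Ll.
have PDs : bnd (D ^+ n * P) (q * e n) by rewrite -Pp.1 -(Ds n) -astarM; exact: bnd_star.
have DPD : bnd (D ^+ n * (P * D ^+ n)) (1 * (q * e n)) by apply: bndM => //; exact: bndX.
apply: bnd_le (bndB (bndB (bndD (bndM (ltW l0) Ls We) (bndM (e0 n) Wse Ll))
  (bndM (e0 n) Wse We)) (bndD PDs (bndB (PDn n) DPD))).
have := e_le n; have := e0 n; nra.
Qed.

End WeakPolar.

(** * Remainders in Parseval's identity *)

Section Defect.
Variables (R : realType) (A : commCStarAlgType R) (E : hilbertModType A).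
Implicit Types (u v w : E) (a : A).
Local Notation C := R[i].
Variables (chi : A -> C) (y : nat -> E).
Hypothesis hchi : is_character chi.

Definition defect n v : R :=
  sqn chi v - \sum_(k < n) nrm (form chi (y k) v : C^o) ^+ 2.

Lemma defectS n v : defect n.+1 v = defect n v - nrm (form chi (y n) v : C^o) ^+ 2.
Proof. by rewrite /defect big_ord_recr /= opprD addrA. Qed.

Lemma defect_anti n m v : (n <= m)%N -> defect m v <= defect n v.
Proof.
elim: m => [|m IH]; first by rewrite leqn0 => /eqP ->.
rewrite leq_eqVlt => /orP[/eqP -> //|/IH]; apply: le_trans.
by rewrite defectS lerBlDr lerDl sqr_ge0.
Qed.

Lemma defect_le_sqn n v : defect n v <= sqn chi v.
Proof. by have := @defect_anti 0 n v (leq0n _); rewrite {2}/defect big_ord0 subr0. Qed.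

(** The defect is a quadratic form; once it is nonnegative, this identity yields [defectD_le]. *)
Lemma defect_parallelogram n v w :
  defect n (v + w) + defect n (v - w) = 2 * defect n v + 2 * defect n w.
Proof.
rewrite /defect addrACA -opprD -big_split /= !mulrBr addrACA -opprD !mulr_sumr.
rewrite -big_split /=; congr (_ - _).
  by rewrite sqnD // sqnB //; ring.
apply: eq_bigr => k _; rewrite (formDr hchi) (formDr hchi) (formNr hchi).
rewrite !nrm_complexE !sqr_sqrtr ?addr_ge0 ?sqr_ge0 //.
by case: (form _ _ _) (form _ _ _) => [? ?] [? ?] /=; ring.
Qed.

Lemma defect_mact n v a : defect n (mact v a) = nrm (chi a : C^o) ^+ 2 * defect n v.
Proof.
rewrite /defect mulrBr sqn_mact // mulr_sumr; congr (_ - _).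
by apply: eq_bigr => k _; rewrite form_mactr // nrm_complexM exprMn mulrC.
Qed.

Hypothesis bessel : forall n v, 0 <= defect n v.

Lemma defectD_le n v w : defect n (v + w) <= 2 * defect n v + 2 * defect n w.
Proof. by rewrite -defect_parallelogram lerDl. Qed.

Definition exhausted v := forall e, 0 < e -> exists n, defect n v < e.

Lemma exhaustedD v w : exhausted v -> exhausted w -> exhausted (v + w).
Proof.
move=> hv hw e e0; have e4 : 0 < e / 4 by rewrite divr_gt0.
have [[n hn] [m hm]] := (hv _ e4, hw _ e4); exists (maxn n m).
have := defectD_le (maxn n m) v w.
have := defect_anti v (leq_maxl n m); have := defect_anti w (leq_maxr n m).
lra.
Qed.

Lemma exhausted_approx v :
  (forall e, 0 < e -> exists2 d, exhausted d & sqn chi (v - d) < e) -> exhausted v.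
Proof.
move=> H e e0; have e4 : 0 < e / 4 by rewrite divr_gt0.
have [d hd vd] := H _ e4; have [n hn] := hd _ e4; exists n.
have := defectD_le n (v - d) d; rewrite subrK.
have := defect_le_sqn n (v - d); lra.
Qed.

Lemma exhausted0 : exhausted 0.
Proof.
by move=> e e0; exists 0%N; rewrite /defect big_ord0 subr0 /sqn /form ip0r chi0.
Qed.

Lemma exhausted_mact v a : exhausted v -> exhausted (mact v a).
Proof.
move=> hv e e0; have c0 : 0 < nrm (chi a : C^o) ^+ 2 + 1.
  by rewrite ltr_wpDl // sqr_ge0.
have [n hn] := hv _ (divr_gt0 e0 c0); exists n; rewrite defect_mact.
move: hn; rewrite ltr_pdivlMr //; apply: le_lt_trans.
by rewrite mulrC ler_wpM2l // lerDl.
Qed.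

End Defect.

(** Bessel's inequality and Parseval's identity at a single character. Convergence is thus only
    pointwise in [chi]; uniformity comes from [dini]. *)
Definition local_frame (R : realType) (A : commCStarAlgType R)
    (E : hilbertModType A) (chi : A -> R[i]) (y : nat -> E) :=
  (forall n v, 0 <= defect chi y n v) /\ (forall v, exhausted chi y v).

(** * Frames of countably generated modules *)

Section FrameExistence.
Variables (R : realType) (A : commCStarAlgType R) (E : hilbertModType A).
Implicit Types (u v w : E) (a : A).
Local Notation C := R[i].

Let rank_oneP y v w : ip (mact y (ip y v)) w = ip v (mact y (ip y w)) :> A.
Proof. by rewrite ipMl ipC ipMr. Qed.

Definition rank_one y : adjointable E := Adjointable (rank_oneP y).

Lemma form_rank_one_rest (chi : A -> C) (y : nat -> E) n v : is_character chi ->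
  form chi v ((1 - \sum_(k < n) rank_one (y k)) v) = (defect chi y n v)%:C.
Proof.
move=> hchi; elim: n => [|n IH].
  by rewrite big_ord0 subr0 aoneE form_self // /defect big_ord0 subr0.
rewrite big_ord_recr opprD addrA asubE (formDr hchi) (formNr hchi) IH.
rewrite defectS [RHS]rmorphB; congr (_ - _).
rewrite /= (form_mactr hchi) (formC hchi (y n)) -/(form chi (y n) v) nrm_complexE.
rewrite sqr_sqrtr ?addr_ge0 ?sqr_ge0 //.
case: (form _ _ _) => a b /=.
by congr (_ +i* _)%C; ring.
Qed.

Section Sequence.
Variable x : nat -> E.
Hypothesis x1 : forall i, nrm (x i) <= 1.

(* Every index occurs infinitely often. *)
Let idx j := logn 2 j.+1.

(** Gram-Schmidt would divide by [<v, v>], which need not be invertible in [A]. Instead the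
    unnormalized rank one part is subtracted, and each generator is revisited infinitely often to
    exhaust what was left of it. *)
Let rest := fix rest j : adjointable E :=
  if j is k.+1 then rest k - rank_one (rest k (x (idx k))) else 1.

Definition frame_of j : E := rest j (x (idx j)).

Let idx_hit i n : exists2 j, (n <= j)%N & idx j = i.
Proof.
have p0 : (0 < 2 ^ i * n.*2.+1)%N by rewrite muln_gt0 expn_gt0.
(* The number [2 ^ i (2 n + 1)] has 2-adic valuation [i]; [idx] takes the valuation of the
   successor. *)
exists (2 ^ i * n.*2.+1).-1.
  have : (0 < 2 ^ i)%N by rewrite expn_gt0.
  by move: (2 ^ i)%N p0 => m; rewrite -mul2n; nia.
rewrite /idx prednK // lognM ?expn_gt0 // pfactorK //.
rewrite logn_coprime ?addn0 // coprime2n /=; by rewrite odd_double.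
Qed.

Let rest_star j : astar (rest j) = rest j.
Proof.
elim: j => [|j IH] /=; first exact: astar1.
by rewrite astarB IH; congr (_ - _); exact: adj_ext.
Qed.

Let form_rest chi j v : is_character chi ->
  form chi v (rest j v) = (defect chi frame_of j v)%:C.
Proof.
move=> hchi; rewrite -form_rank_one_rest //; congr (form chi v (aop _ v)).
elim: j => [|j IH]; first by rewrite big_ord0 subr0.
by rewrite big_ord_recr opprD addrA -IH.
Qed.

(** Cauchy-Schwarz for the positive operator [rest n] at [x (idx n)] and [v]. Since [x (idx n)] has
    norm at most 1, the subtracted square does not exceed the present defect of [v]. *)
Lemma bessel_frame_of chi n v : is_character chi -> 0 <= defect chi frame_of n v.
Proof.
elim: n chi v => [|n IH] chi v hchi.
  by rewrite /defect big_ord0 subr0 sqn_ge0.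
have Rp : opos (rest n).
  by split=> // chi' w hchi'; rewrite form_rest //; exact: IH.
have := opos_cauchy_schwarz (x (idx n)) v Rp hchi.
rewrite !form_rest //= [form _ _ (rest n v)]form_adjr rest_star -/(frame_of n) => h.
rewrite defectS subr_ge0; apply: le_trans h _.
have q1 : defect chi frame_of n (x (idx n)) <= 1.
  have := defect_le_sqn chi frame_of n (x (idx n)).
  have := sqn_le hchi (x (idx n)).
  have : nrm (x (idx n)) ^+ 2 <= 1 by rewrite expr_le1 // ?nrm_ge0.
  lra.
have := IH chi v hchi; nra.
Qed.

(** At a visit to [x i] the new coefficient equals the present defect of [x i]. So a defect that
    stayed above [e] would drop by [e^2] infinitely often. *)
Lemma exhausted_frame_of chi i : is_character chi ->
  exhausted chi frame_of (x i).
Proof.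
move=> hchi e e0; apply: contrapT => H.
have ge n : e <= defect chi frame_of n (x i).
  by rewrite leNgt; apply/negP => h; apply: H; exists n.
have [K hK] : exists K : nat, sqn chi (x i) < K%:R * e ^+ 2.
  exists (Num.truncn (sqn chi (x i) / e ^+ 2)).+1.
  by rewrite -ltr_pdivrMr ?exprn_gt0 // truncnS_gt.
have dec m : exists j, defect chi frame_of j (x i) <= sqn chi (x i) - m%:R * e ^+ 2.
  elim: m => [|m [j hj]]; first by exists 0%N; rewrite mul0r subr0 defect_le_sqn.
  have [k jk ik] := idx_hit i j; exists k.+1; rewrite defectS.
  rewrite {2}/frame_of ik form_adjl rest_star form_rest // nrm_real real_normK ?num_real //.
  have := defect_anti chi frame_of (x i) jk; have := ge k.
  have : e ^+ 2 <= defect chi frame_of k (x i) ^+ 2.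
    by rewrite ler_pXn2r ?nnegrE ?(ltW e0) ?ge // bessel_frame_of.
  rewrite -natr1; lra.
have [j hj] := dec K; have := bessel_frame_of j (x i) hchi; lra.
Qed.

End Sequence.

Lemma frame_exists : countably_generated E ->
  exists y : nat -> E, forall chi, is_character chi -> local_frame chi y.
Proof.
move=> [x0 hx].
(* Rescaling into the unit ball, with no special case for a zero generator. *)
pose r i : R := (1 + nrm (x0 i))^-1.
have r0 i : 0 < 1 + nrm (x0 i) by rewrite ltr_wpDr // nrm_ge0.
pose x i := (r i)%:C *: x0 i.
have x1 i : nrm (x i) <= 1.
  rewrite nrmZ nrm_real ger0_norm ?invr_ge0 ?(ltW (r0 i)) //.
  by rewrite mulrC ler_pdivrMr // mul1r lerDr.
exists (frame_of x) => chi hchi; split=> [n v|v]; first exact: bessel_frame_of.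
have bes n w := bessel_frame_of x1 n w hchi.
apply: (exhausted_approx hchi bes) => e e0.
have se : 0 < Num.sqrt e by rewrite sqrtr_gt0.
have [d [n [a ->]] hd] := closureT_approx v hx se.
exists (\sum_(i < n) mact (x0 i) (a i)).
  elim/big_rec: _ => [|i w _ hw]; first exact: exhausted0.
    apply: exhaustedD => //.
    have -> : mact (x0 i) (a i) = mact (x i) ((1 + nrm (x0 i))%:C *: a i).
      rewrite mactZr mactZl scalerA -rmorphM /= divff ?rmorph1 ?scale1r //.
      by rewrite gt_eqF.
    by apply: exhausted_mact => //; exact: exhausted_frame_of.
  apply: le_lt_trans (sqn_le hchi _) _.
  by rewrite -[ltRHS]sqr_sqrtr ?(ltW e0) // ltr_pXn2r ?nnegrE ?nrm_ge0 ?sqrtr_ge0.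
Qed.

End FrameExistence.

(** * Unordered sums of nonnegative terms *)

Section UnorderedSums.
Variable R : realType.

Lemma sum_uniq_le (T : eqType) (a : T -> R) (r s : seq T) :
  (forall x, 0 <= a x) -> uniq r -> uniq s -> {subset r <= s} ->
  \sum_(x <- r) a x <= \sum_(x <- s) a x.
Proof.
move=> a0 ur us rs.
have -> : \sum_(x <- r) a x = \sum_(x <- s | x \in r) a x.
  rewrite -[RHS]big_filter (perm_big [seq x <- s | x \in r]) //.
  apply: uniq_perm => //; first exact: filter_uniq.
  by move=> x; rewrite mem_filter; case: (boolP (x \in r)) => //= /rs ->.
by rewrite big_mkcond /=; apply: ler_sum => x _; case: ifP.
Qed.

Lemma esum_eqP (T : choiceType) (I : set T) (a : T -> R) (s : R) :
  (forall r, uniq r -> (forall x, x \in r -> I x) -> \sum_(x <- r) a x <= s) ->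
  (forall d, 0 < d -> exists r, [/\ uniq r, forall x, x \in r -> I x &
     s - d <= \sum_(x <- r) a x]) ->
  (\esum_(x in I) (a x)%:E = s%:E)%E.
Proof.
move=> H1 H2; apply/eqP; rewrite eq_le; apply/andP; split.
  apply: ge_ereal_sup => _ [F [finF FI] <-].
  rewrite fsbig_finite //= sumEFin lee_fin; apply: H1; first exact: finmap.fset_uniq.
  by move=> x; rewrite in_fset_set // inE => /FI.
apply/lee_addgt0Pr => d d0; have [r [ur rI hr]] := H2 _ d0.
rewrite -leeBlDr //; apply: esum_ge; exists [set` r]; first by split.
by rewrite -fsbig_seq //= sumEFin -EFinB lee_fin.
Qed.

Lemma esum_natP (a : nat -> R) (s : R) : (forall k, 0 <= a k) ->
  (forall n, \sum_(k < n) a k <= s) ->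
  (forall d, 0 < d -> exists n, s - d <= \sum_(k < n) a k) ->
  (\esum_(k in [set: nat]) (a k)%:E = s%:E)%E.
Proof.
move=> a0 H1 H2; apply: esum_eqP.
  move=> r ur _; apply: le_trans (H1 (\max_(k <- r) k).+1).
  rewrite -(big_mkord xpredT a); apply: sum_uniq_le => //; first exact: iota_uniq.
  by move=> k kr; rewrite mem_index_iota /= ltnS; apply: leq_bigmax_seq.
move=> d d0; have [n hn] := H2 _ d0; exists (index_iota 0 n).
by split=> //; [exact: iota_uniq|rewrite big_mkord].
Qed.

Lemma esum_exchange (T1 T2 : choiceType) (I : set T1) (J : set T2)
    (a : T1 -> T2 -> \bar R) : (forall i j, 0 <= a i j)%E ->
  (\esum_(i in I) \esum_(j in J) a i j = \esum_(j in J) \esum_(i in I) a i j)%E.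
Proof.
move=> a0; rewrite !esum_esum //.
rewrite (@reindex_esum _ _ _ (J `*`` fun=> I) (I `*`` fun=> J) (fun p => (p.2, p.1))) //.
split; first by move=> [j i] [/= ? ?].
- by move=> [x y] [x' y'] _ _ [-> ->].
- by move=> [i j] [/= Ii Jj]; exists (j, i).
Qed.

End UnorderedSums.

(** * Orthonormal bases of Hilbert spaces *)

Section OrthonormalBases.
Variables (R : realType) (H : hilbertSpaceType R).
Implicit Types (u v w e : H) (B : set H).
Local Notation C := R[i].

(** The identity as a character of the algebra [C]: through it the results on [form] and [sqn] apply
    to Hilbert spaces. *)
Definition idc (z : C) : C := z.

Lemma idc_character : is_character (idc : (C : commCStarAlgType R) -> C).
Proof. by split; [|split; [|split]] => //; exists 1; apply/eqP; exact: oner_neq0. Qed.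

Local Notation F := (form (idc : (C : commCStarAlgType R) -> C)).
Local Notation N := (sqn (idc : (C : commCStarAlgType R) -> C)).

Definition orthonormal B :=
  (forall e, B e -> F e e = 1) /\ (forall e f, B e -> B f -> e <> f -> F e f = 0).

Lemma sqn_eq0 v : N v = 0 -> v = 0.
Proof.
move=> v0; apply: (@ip_self_eq0 R C H).
by have := form_self idc_character v; rewrite v0.
Qed.

Lemma onb_exists : exists B : set H, orthonormal_basis B.
Proof.
have chain (G : set (set H)) : G `<=` orthonormal -> total_on G subset ->
    orthonormal (\bigcup_(X in G) X).
  move=> Go Gtot; split=> [e [X GX Xe]|e f [X GX Xe] [Y GY Yf]].
    by have [h _] := Go _ GX; exact: h.
  have [XY|YX] := Gtot _ _ GX GY.
    by have [_ h] := Go _ GY; apply: h => //; exact: XY.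
  by have [_ h] := Go _ GX; apply: h => //; exact: YX.
have [B [Bo Bmax]] := Zorn_bigcup chain.
exists B; split; [|split]; [exact: Bo.1|exact: Bo.2|].
move=> v vB; apply: contrapT => v0.
have Nv : 0 < N v.
  rewrite lt_def (sqn_ge0 idc_character) andbT; apply/eqP => /sqn_eq0; exact: v0.
pose f := ((Num.sqrt (N v))^-1)%:C *: v.
have ff : F f f = 1.
  rewrite (form_self idc_character) (sqnZ idc_character) nrm_real.
  rewrite real_normK ?num_real // exprVn sqr_sqrtr ?(ltW Nv) //.
  by rewrite mulVf ?gt_eqF.
have Bf e : B e -> F e f = 0.
  by move=> Be; rewrite (formZr idc_character) [F e v]vB // mulr0.
have nBf : ~ B f.
  by move=> /Bf; rewrite ff => /eqP; rewrite oner_eq0.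
apply: (Bmax (B `|` [set f])).
  by split=> [e Be|/(_ f (or_intror erefl))//]; left.
split=> [e [Be|->] //|e g [Be|->] [Bg|->] //]; first exact: Bo.1.
- exact: Bo.2.
- by move=> _; exact: Bf.
- by move=> _; rewrite (formC idc_character) Bf // rmorph0.
Qed.

(** Ensures that the choice in [onb] does not fall back to the empty default. *)
Lemma onbP : orthonormal_basis (@onb R H).
Proof. by rewrite /onb; case: xgetP => // /(_ _) h; have [B /h] := onb_exists. Qed.

Section Parseval.
Variables (B : set H) (v : H).
Hypothesis Bo : orthonormal_basis B.
Implicit Types r s : seq H.

Let coef e : R := nrm (F e v : C^o) ^+ 2.
Let total r := \sum_(e <- r) coef e.
Let proj r : H := \sum_(e <- r) F e v *: e.
Let res r := v - proj r.
Let inB r := uniq r /\ forall e, e \in r -> B e.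

Let coef_ge0 e : 0 <= coef e. Proof. exact: sqr_ge0. Qed.

Let form_proj e r : B e -> inB r -> F e (proj r) = if e \in r then F e v else 0.
Proof.
have [B1 [B0 _]] := Bo.
move=> Be; elim: r => [_|f r IH [/= /andP[fr ur] rB]].
  by rewrite /proj big_nil /form ip0r.
have Bf : B f by apply: rB; rewrite inE eqxx.
have rB' : inB r by split=> // g gr; apply: rB; rewrite inE gr orbT.
rewrite /proj big_cons (formDr idc_character) -/(proj r) IH // (formZr idc_character) inE.
have [->|ef] := eqVneq e f; first by rewrite (negbTE fr) addr0 [F f f]B1 // mulr1.
by rewrite [F e f]B0 ?mulr0 ?add0r //; exact/eqP.
Qed.

Let form_res e r : B e -> inB r -> F e (res r) = if e \in r then 0 else F e v.
Proof.
move=> Be rB; rewrite /res (formDr idc_character) (formNr idc_character) form_proj //.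
by case: ifP; rewrite ?subrr ?subr0.
Qed.

Let form_proj_res r s : inB r -> inB s -> {subset r <= s} -> F (proj r) (res s) = 0.
Proof.
move=> [_ rB] sB rs; rewrite (formC idc_character).
suff -> : F (res s) (proj r) = 0 by rewrite rmorph0.
rewrite /proj big_seq; elim/big_rec: _ => [|e w er IH]; first by rewrite /form ip0r.
have Be := rB _ er.
rewrite (formDr idc_character) IH (formZr idc_character) (formC idc_character e).
rewrite form_res // (rs _ er).
by rewrite rmorph0 mulr0 addr0.
Qed.

Let sqn_res r : inB r -> N (res r) = N v - total r.
Proof.
elim: r => [_|e r IH [/= /andP[er ur] rB]].
  by rewrite /res /proj /total !big_nil !subr0.
have Be : B e by apply: rB; rewrite inE eqxx.
have rB' : inB r by split=> // g gr; apply: rB; rewrite inE gr orbT.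
have -> : res (e :: r) = res r - F e v *: e.
  by rewrite /res /proj big_cons opprD addrA addrAC.
rewrite (sqnB idc_character) IH // /total big_cons -/(total r).
rewrite (sqnZ idc_character) (formZr idc_character) (formC idc_character e) form_res // (negbTE er).
have -> : N e = 1 by rewrite /sqn [F e e]Bo.1.
rewrite /coef nrm_complexE sqr_sqrtr ?addr_ge0 ?sqr_ge0 //.
by case: (F e v) => a b /=; ring.
Qed.

Let sqn_res_sub r s : inB r -> inB s -> {subset r <= s} ->
  N (proj s - proj r) = total s - total r.
Proof.
move=> rB sB rs.
have -> : proj s - proj r = res r - res s.
  by rewrite /res opprB [RHS]addrC addrA subrK.
have E : F (res r) (res s) = F (res s) (res s).
  have resE t : F (res t) (res s) = F v (res s) - F (proj t) (res s).
    by rewrite (formDl idc_character) (formNl idc_character).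
  by rewrite !resE !form_proj_res.
rewrite (sqnB idc_character) E -/(N (res s)) !sqn_res //; ring.
Qed.

Let bessel r : inB r -> total r <= N v.
Proof. by move=> /sqn_res E; rewrite -subr_ge0 -E (sqn_ge0 idc_character). Qed.

(** [B] may be uncountable. Growing finite lists [t n] nearly attain the supremum [L] of the finite
    sums, so the projections of [v] onto them form a Cauchy sequence; its limit differs from [v] by
    a vector orthogonal to [B], hence by 0. *)
Lemma parseval : (\esum_(e in B) (nrm (F e v : C^o) ^+ 2)%:E = (N v)%:E)%E.
Proof.
pose L := sup [set total r | r in inB].
have supB : has_sup [set total r | r in inB].
  split; first by exists (total [::]), [::].
  by exists (N v) => _ [r rB <-]; exact: bessel.
have ub r : inB r -> total r <= L by move=> rB; apply: ub_le_sup; [exact: supB.2|exists r].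
have near n : exists r, inB r /\ L - n.+1%:R^-1 < total r.
  have n0 : 0 < n.+1%:R^-1 :> R by rewrite invr_gt0.
  by have [_ [r rB <-] h] := sup_adherent n0 supB; exists r.
pose rs n := sval (cid (near n)); have rsP n := svalP (cid (near n)).
pose t := fix t n := if n is m.+1 then undup (rs m ++ t m) else [::] : seq H.
have tB n : inB (t n).
  elim: n => [|n [un IH]]; first by split.
  split=> [|e]; first exact: undup_uniq.
  by rewrite mem_undup mem_cat => /orP[/((rsP n).1.2)|/IH].
have tsub n m : (n <= m)%N -> {subset t n <= t m}.
  elim: m => [|m IH]; first by rewrite leqn0 => /eqP ->.
  rewrite leq_eqVlt => /orP[/eqP -> //|/IH h] e /h et /=.
  by rewrite mem_undup mem_cat et orbT.
have tnear n : L - n.+1%:R^-1 <= total (t n.+1).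
  apply: le_trans (ltW (rsP n).2) _; apply: sum_uniq_le => //.
  - by have [[]] := rsP n.
  - by have [] := tB n.+1.
  - by move=> e er; rewrite mem_undup mem_cat er.
pose d n : R := Num.sqrt (1 * n.+1%:R^-1).
have d2 n : d n ^+ 2 = n.+1%:R^-1 by rewrite /d mul1r sqr_sqrtr // invr_ge0.
have dv : vanishing d by apply: vanishing_sqrt; exact: vanishing_harmonic.
have nrmN w : nrm w ^+ 2 = N w.
  rewrite -nrm_ip -[ip w w]/(F w w) (form_self idc_character).
  by rewrite (nrm_real (N w)) ger0_norm // (sqn_ge0 idc_character).
have [n m nm|u hu] := complete_rate dv (u := fun n => proj (t n.+1)).
  rewrite -(@ler_pXn2r _ 2) ?nnegrE ?nrm_ge0 ?sqrtr_ge0 // d2 nrmN sqn_res_sub //.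
    suff : total (t m.+1) - total (t n.+1) <= n.+1%:R^-1 by [].
    by rewrite lerBlDr; apply: le_trans (ub _ (tB m.+1)) _; rewrite -lerBlDl.
  exact: tsub.
have vu : v = u.
  apply/eqP; rewrite -subr_eq0; apply/eqP; have [_ [_ h]] := Bo.
  apply: h => e Be; apply: (@nrm_eq0 R C^o); apply/eqP; rewrite eq_le nrm_ge0 andbT.
  apply: (vanishing_le0 (e := d) (c := 2)) => // n.
  have -> : ip e (v - u) = F e (res (t n.+1)) + F e (proj (t n.+1) - u) :> C.
    by rewrite -(formDr idc_character) addrA subrK.
  apply: le_trans (nrmD _ _) _.
  have h1 : nrm (F e (res (t n.+1)) : C^o) <= d n.
    rewrite form_res //; case: ifP => [_|/negbT et]; first by rewrite nrm0 sqrtr_ge0.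
    rewrite -(@ler_pXn2r _ 2) ?nnegrE ?nrm_ge0 ?sqrtr_ge0 // d2 -/(coef e).
    (* An element outside the list can be added to it, and the total stays below [L]; its
       coefficient is therefore at most the gap [1 / (n + 1)]. *)
    have etB : inB (e :: t n.+1).
      split=> [|f]; first by rewrite /= et; have [] := tB n.+1.
      by rewrite inE => /orP[/eqP ->|] //; have [_] := tB n.+1; apply.
    have := ub _ etB; rewrite {1}/total big_cons -/(total (t n.+1)) -lerBrDr => h.
    by apply: le_trans h _; rewrite lerBlDl -lerBlDr; exact: tnear.
  have h2 : nrm (F e (proj (t n.+1) - u) : C^o) <= d n.
    rewrite -(@ler_pXn2r _ 2) ?nnegrE ?nrm_ge0 ?sqrtr_ge0 //.
    apply: le_trans (cauchy_schwarz idc_character _ _) _.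
    have -> : N e = 1 by rewrite /sqn [F e e]Bo.1.
    rewrite mul1r -nrmN nrmB.
    by rewrite ler_pXn2r ?nnegrE ?nrm_ge0 ?sqrtr_ge0.
  by apply: le_trans (lerD h1 h2) _; rewrite -mulr2n mulr_natl.
apply: esum_eqP => [r ur rB|e e0]; first exact: bessel.
have [n hn] := @vanishing_harmonic R 1 _ e0; rewrite mul1r in hn.
have [ut tB'] := tB n.+1; exists (t n.+1); split=> //.
have : N (res (t n.+1)) <= d n ^+ 2.
  by rewrite -nrmN /res {1}vu ler_pXn2r ?nnegrE ?nrm_ge0 ?sqrtr_ge0.
rewrite d2 => h; rewrite lerBlDr -lerBlDl -/(total (t n.+1)) -(sqn_res (tB n.+1)).
exact: le_trans h (ltW hn).
Qed.

End Parseval.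

End OrthonormalBases.

Arguments idc {R}.

(** * Hilbert-Schmidt sums over a frame *)

Section HilbertSchmidt.
Variables (R : realType) (A : commCStarAlgType R) (E : hilbertModType A).
Implicit Types (u v w : E) (T : adjointable E).
Local Notation C := R[i].

(** For a local frame, the squared Hilbert-Schmidt norm of [chi_* T] in terms of [E] alone; see
    [postrace_push]. *)
Definition hs_sum (chi : A -> C) (y : nat -> E) T : \bar R :=
  (\esum_(j in [set: nat]) (sqn chi (T (y j)))%:E)%E.

Section LocalFrame.
Variables (chi : A -> C) (y : nat -> E).
Hypotheses (hchi : is_character chi) (hy : local_frame chi y).

Lemma frame_parseval v :
  (\esum_(k in [set: nat]) (nrm (form chi (y k) v : C^o) ^+ 2)%:E = (sqn chi v)%:E)%E.
Proof.
have [bes ex] := hy; apply: esum_natP => [k|n|d d0]; first exact: sqr_ge0.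
  by have := bes n v; rewrite /defect subr_ge0.
have [n hn] := ex v _ d0; exists n.
by move: hn; rewrite /defect; lra.
Qed.

Lemma nrm_formC v w : nrm (form chi v w : C^o) = nrm (form chi w v : C^o).
Proof. by rewrite formC // !nrm_complexE; case: (form _ _ _) => a b /=; rewrite sqrrN. Qed.

(** Parseval turns both sides into the double series of [|<y_k, T y_j>|^2], up to exchanging the
    indices. *)
Lemma hs_sum_star T : hs_sum chi y (astar T) = hs_sum chi y T.
Proof.
rewrite /hs_sum; under eq_esum do rewrite -frame_parseval.
rewrite esum_exchange => [|j k]; last by rewrite lee_fin sqr_ge0.
under [RHS]eq_esum do rewrite -frame_parseval.
apply: eq_esum => j _; apply: eq_esum => k _.
by rewrite form_adjr astarK nrm_formC.
Qed.

End LocalFrame.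
End HilbertSchmidt.

(** * Operators and traces on the localized Hilbert space *)

Section Pushforward.
Variables (R : realType) (A : commCStarAlgType R) (E : hilbertModType A).
Local Notation C := R[i].
Variables (chi : A -> C) (hchi : is_character chi) (P : pushforward chi E).
Implicit Types (u v w : E) (p q : P) (T : adjointable E).
Local Notation F := (form (idc : (C : commCStarAlgType R) -> C)).
Local Notation N := (sqn (idc : (C : commCStarAlgType R) -> C)).
Local Notation idcP := (@idc_character R).

Definition tens1 v : P := tens P v 1.

Lemma form_tens v w (x z : C) : F (tens P v x) (tens P w z) = x^*%C * form chi v w * z.
Proof. by rewrite /form /idc tens_ip. Qed.

Lemma form_tens1 v w : F (tens1 v) (tens1 w) = form chi v w.
Proof. by rewrite form_tens rmorph1 mul1r mulr1. Qed.

Lemma sqn_tens1 v : N (tens1 v) = sqn chi v.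
Proof. by rewrite /sqn form_tens1. Qed.

Lemma sqn_eq p q : N (p - q) = 0 -> p = q.
Proof. by move=> /sqn_eq0 /eqP; rewrite subr_eq0 => /eqP. Qed.

(** [pushforward] prescribes inner products only; linearity follows because the difference of the
    two sides has norm 0. The same holds for [tens1D] and [tens1Z]. *)
Lemma tensE v (x : C) : tens P v x = x *: tens1 v.
Proof.
apply: sqn_eq; rewrite /sqn !(formDr idcP, formDl idcP, formNr idcP, formNl idcP).
rewrite !(formZr idcP, formZl idcP) !form_tens rmorph1.
by move: (form chi v v) x => [a b] [c d] /=; ring.
Qed.

Lemma tens1D v w : tens1 (v + w) = tens1 v + tens1 w.
Proof.
apply: sqn_eq; rewrite /sqn opprD !(formDr idcP, formDl idcP, formNr idcP, formNl idcP).
rewrite !form_tens1 !(formDr hchi, formDl hchi).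
by move: (form chi v v) (form chi v w) (form chi w v) (form chi w w)
  => [? ?] [? ?] [? ?] [? ?] /=; ring.
Qed.

Lemma tens1Z (x : C) v : tens1 (x *: v) = x *: tens1 v.
Proof.
apply: sqn_eq; rewrite /sqn !(formDr idcP, formDl idcP, formNr idcP, formNl idcP).
rewrite !(formZr idcP, formZl idcP) !form_tens1 !(formZr hchi, formZl hchi).
by move: (form chi v v) x => [a b] [c d] /=; ring.
Qed.

Lemma tens1_0 : tens1 0 = 0.
Proof. by rewrite -(scale0r 0) tens1Z scale0r. Qed.

Lemma tens1B v w : tens1 (v - w) = tens1 v - tens1 w.
Proof. by rewrite tens1D -scaleN1r tens1Z scaleN1r. Qed.

Lemma tens1_dense p e : 0 < e -> exists v, nrm (p - tens1 v) < e.
Proof.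
move=> e0; have [_ [n [v [x ->]]] h] := closureT_approx p (tens_dense P) e0.
exists (\sum_(i < n) x i *: v i); move: h; congr (nrm (_ - _) < _).
rewrite (big_morph tens1 tens1D tens1_0).
by apply: eq_bigr => i _; rewrite tens1Z tensE.
Qed.

Lemma nrm_sqn p : nrm p ^+ 2 = N p.
Proof.
rewrite -nrm_ip -[ip p p]/(F p p) (form_self idcP).
by rewrite (nrm_real (N p)) ger0_norm // (sqn_ge0 idcP).
Qed.

Lemma nrm_tens1_le T c v : bnd T c -> 0 <= c ->
  nrm (tens1 (T v)) <= c * nrm (tens1 v).
Proof.
move=> Tc c0; rewrite -(@ler_pXn2r _ 2) ?nnegrE ?mulr_ge0 ?nrm_ge0 //.
by rewrite exprMn !nrm_sqn !sqn_tens1; exact: sqn_bnd.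
Qed.

(** Extension by continuity. The estimate against every [v] determines the value at [p] by density
    and encodes the bound [c]. *)
Let extend T c : bnd T c -> 0 <= c -> exists X : P -> P,
  forall p v, nrm (X p - tens1 (T v)) <= c * nrm (p - tens1 v).
Proof.
move=> Tc c0.
have H p : exists l, forall v, nrm (l - tens1 (T v)) <= c * nrm (p - tens1 v).
  have n0 n : 0 < n.+1%:R^-1 :> R by rewrite invr_gt0.
  pose s n := sval (cid (tens1_dense p (n0 n))).
  have sP n : nrm (p - tens1 (s n)) < n.+1%:R^-1.
    exact: (svalP (cid (tens1_dense p (n0 n)))).
  have TT v w : nrm (tens1 (T v) - tens1 (T w)) <= c * (nrm (p - tens1 v) + nrm (p - tens1 w)).
    rewrite -tens1B -aopB; apply: le_trans (nrm_tens1_le _ Tc c0) _.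
    rewrite ler_wpM2l // tens1B; apply: le_trans (nrm_triangle _ p _) _.
    by rewrite nrmB.
  have [n m nm|l hl] := complete_rate (@vanishing_harmonic R (2 * c))
      (u := fun n => tens1 (T (s n))).
    apply: le_trans (TT _ _) _; rewrite [leRHS]mulrAC [leRHS]mulrC ler_wpM2l //.
    apply: le_trans (lerD (ltW (sP m)) (ltW (sP n))) _.
    by rewrite mulr_natl mulr2n lerD2r lef_pV2 ?posrE ?ltr0n // ler_nat.
  exists l => v; rewrite -subr_le0.
  apply: (vanishing_le0 (@vanishing_harmonic R 1) (c := 3 * c)); first exact: mulr_ge0.
  move=> n; rewrite mul1r lerBlDr.
  apply: le_trans (nrm_triangle _ (tens1 (T (s n))) _) _.
  apply: le_trans (lerD (hl n) (TT (s n) v)) _.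
  have : c * nrm (p - tens1 (s n)) <= c * n.+1%:R^-1 by rewrite ler_wpM2l // ltW.
  move=> h; rewrite mulrDr addrA lerD2r; apply: le_trans (lerD (lexx _) h) _.
  by rewrite -mulrDl (_ : 2 * c + c = 3 * c) //; ring.
by exists (fun p => sval (cid (H p))) => p; exact: (svalP (cid (H p))).
Qed.

Lemma push_exists T : exists X : adjointable P,
  (forall v, X (tens1 v) = tens1 (T v)) /\
  (forall v, astar X (tens1 v) = tens1 (astar T v)).
Proof.
have [c c0 Tc] := adj_bounded T.
have [X hX] := extend Tc (ltW c0); have [X' hX'] := extend (bnd_star Tc) (ltW c0).
have XP p q : ip (X p) q = ip p (X' q) :> C.
  apply/eqP; rewrite -subr_eq0; apply/eqP/(@nrm_eq0 R C^o)/eqP.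
  rewrite eq_le nrm_ge0 andbT.
  pose K := c * nrm q + (nrm (X p) + c) + (nrm (X' q) + c) + nrm p * c.
  apply: (vanishing_le0 (@vanishing_harmonic R 1) (c := K)).
    by rewrite !addr_ge0 ?mulr_ge0 ?nrm_ge0 ?(ltW c0).
  move=> n; rewrite mul1r; set d := n.+1%:R^-1.
  have d0 : 0 < d by rewrite invr_gt0.
  have d1 : d <= 1 by rewrite invf_le1 ?ltr0n // ler1n.
  have [v hv] := tens1_dense p d0; have [w hw] := tens1_dense q d0.
  have -> : ip (X p) q - ip p (X' q) =
     ip (X p - tens1 (T v)) q + ip (tens1 (T v)) (q - tens1 w)
     - (ip (p - tens1 v) (tens1 (astar T w)) + ip p (X' q - tens1 (astar T w))) :> C.
    rewrite !ipDl !ipDr !ipNl !ipNr.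
    have -> : ip (tens1 (T v)) (tens1 w) = ip (tens1 v) (tens1 (astar T w)) :> C.
      by rewrite -[LHS]/(F _ _) -[RHS]/(F _ _) !form_tens1 form_adjl.
    have Z (a b m r s : C) : a - b = a - s + (s - m) - (r - m + (b - r)) by ring.
    exact: Z.
  have B1 := nrm_ip_le (X p - tens1 (T v)) q.
  have B2 := nrm_ip_le (tens1 (T v)) (q - tens1 w).
  have B3 := nrm_ip_le (p - tens1 v) (tens1 (astar T w)).
  have B4 := nrm_ip_le p (X' q - tens1 (astar T w)).
  have c1 : nrm (X p - tens1 (T v)) <= c * d.
    by apply: le_trans (hX _ _) _; rewrite ler_wpM2l ?(ltW c0) ?(ltW hv).
  have c2 : nrm (X' q - tens1 (astar T w)) <= c * d.
    by apply: le_trans (hX' _ _) _; rewrite ler_wpM2l ?(ltW c0) ?(ltW hw).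
  have cd : c * d <= c by rewrite ler_piMr ?(ltW c0).
  have c3 : nrm (tens1 (T v)) <= nrm (X p) + c.
    have := nrm_sub_ge (tens1 (T v)) (X p); rewrite nrmB; lra.
  have c4 : nrm (tens1 (astar T w)) <= nrm (X' q) + c.
    have := nrm_sub_ge (tens1 (astar T w)) (X' q); rewrite nrmB; lra.
  have -> : K * d = (c * d) * nrm q + (nrm (X p) + c) * d
      + (d * (nrm (X' q) + c) + nrm p * (c * d)) by rewrite /K; ring.
  apply: le_trans (nrmD _ _) _; rewrite nrmN; apply: lerD.
    apply: le_trans (nrmD _ _) _; apply: lerD.
      by apply: le_trans B1 _; rewrite ler_wpM2r ?nrm_ge0.
    by apply: le_trans B2 _; apply: ler_pM; rewrite ?nrm_ge0 ?(ltW hw).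
  apply: le_trans (nrmD _ _) _; apply: lerD.
    by apply: le_trans B3 _; apply: ler_pM; rewrite ?nrm_ge0 ?(ltW hv).
  by apply: le_trans B4 _; rewrite ler_wpM2l ?nrm_ge0.
exists (Adjointable XP); split=> v; apply/eqP; rewrite -subr_eq0; apply/eqP/nrm_eq0/eqP;
  rewrite eq_le nrm_ge0 andbT.
  by have := hX (tens1 v) v; rewrite subrr nrm0 mulr0.
by have := hX' (tens1 v) v; rewrite subrr nrm0 mulr0.
Qed.

Lemma push_unique (X Y : adjointable P) :
  (forall v, X (tens1 v) = Y (tens1 v)) -> X = Y.
Proof.
move=> XY; have [c c0 XYc] := adj_bounded (X - Y).
apply: adj_ext => p; apply/eqP; rewrite -subr_eq0; apply/eqP/nrm_eq0/eqP.
rewrite eq_le nrm_ge0 andbT.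
apply: (vanishing_le0 (@vanishing_harmonic R 1) (ltW c0)) => n; rewrite mul1r.
have n0 : 0 < n.+1%:R^-1 :> R by rewrite invr_gt0.
have [v hv] := tens1_dense p n0.
have -> : X p - Y p = (X - Y) (p - tens1 v).
  by rewrite aopB !asubE XY subrr subr0.
by apply: le_trans (XYc _) _; rewrite ler_wpM2l ?(ltW c0) ?(ltW hv).
Qed.

Lemma is_push_opE T (X : adjointable P) :
  is_push_op T X <-> forall v, X (tens1 v) = tens1 (T v).
Proof.
by split=> [H v|H v x]; [exact: H|rewrite !tensE aopZ H].
Qed.

(** [is_push_op] does not mention adjoints, but by density [X] is the operator from [push_exists],
    whose adjoint is known. *)
Lemma is_push_op_star T (X : adjointable P) :
  is_push_op T X -> is_push_op (astar T) (astar X).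
Proof.
move=> /is_push_opE TX; apply/is_push_opE.
have [Y [Y1 Y2]] := push_exists T.
by have -> : X = Y by apply: push_unique => v; rewrite TX Y1.
Qed.

Lemma is_push_opM S T (X Y : adjointable P) :
  is_push_op S X -> is_push_op T Y -> is_push_op (S * T) (X * Y).
Proof. by move=> SX TY v x; rewrite amulE TY SX. Qed.

Lemma opos_dense (W : adjointable P) p :
  (forall v, 0 <= complex.Re (F (tens1 v) (W (tens1 v)))) -> 0 <= complex.Re (F p (W p)).
Proof.
move=> H; have [c c0 Wc] := adj_bounded W.
rewrite -oppr_le0.
apply: (vanishing_le0 (@vanishing_harmonic R 1) (c := nrm (W p) + (nrm p + 1) * c)).
  by rewrite addr_ge0 ?mulr_ge0 ?addr_ge0 ?nrm_ge0 ?(ltW c0).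
move=> n; rewrite mul1r; set d := n.+1%:R^-1.
have d0 : 0 < d by rewrite invr_gt0.
have d1 : d <= 1 by rewrite invf_le1 ?ltr0n // ler1n.
have [v hv] := tens1_dense p d0; have Hv := H v.
have FpE : F p (W p) = F (p - tens1 v) (W p) + F (tens1 v) (W (p - tens1 v))
    + F (tens1 v) (W (tens1 v)).
  rewrite aopB (formDr idcP (tens1 v)) (formNr idcP) (formDl idcP) (formNl idcP).
  by rewrite addrA subrK subrK.
have Re_le (z : C) : - complex.Re z <= nrm (z : C^o).
  rewrite nrm_complexE; apply: le_trans (ler_norm _) _; rewrite normrN -sqrtr_sqr.
  by rewrite ler_wsqrtr // lerDl sqr_ge0.
have F_le (a b : P) : - complex.Re (F a b) <= nrm a * nrm b.
  by apply: le_trans (Re_le _) _; exact: nrm_ip_le.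
have h1 := F_le (p - tens1 v) (W p).
have h2 := F_le (tens1 v) (W (p - tens1 v)).
have h3 : nrm (p - tens1 v) * nrm (W p) <= d * nrm (W p).
  by rewrite ler_wpM2r ?nrm_ge0 ?(ltW hv).
have h4 : nrm (tens1 v) <= nrm p + 1.
  have := nrm_sub_ge (tens1 v) p; rewrite nrmB; lra.
have h5 : nrm (W (p - tens1 v)) <= c * d.
  by apply: le_trans (Wc _) _; rewrite ler_wpM2l ?(ltW c0) ?(ltW hv).
have h6 : nrm (tens1 v) * nrm (W (p - tens1 v)) <= (nrm p + 1) * (c * d).
  by apply: ler_pM; rewrite ?nrm_ge0.
move: h1 h2 Hv; rewrite FpE.
case: (F _ _) (F _ _) (F _ _) => [? ?] [? ?] [? ?] /=; lra.
Qed.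

(** Bessel's inequality is positivity of [1] minus the rank one operators, which extends from the
    dense image of [E]; exhaustion is stable under approximation. *)
Lemma push_frame (y : nat -> E) : local_frame chi y ->
  local_frame (idc : (C : commCStarAlgType R) -> C) (tens1 \o y).
Proof.
move=> [bes ex].
have defE n v : defect idc (tens1 \o y) n (tens1 v) = defect chi y n v.
  by rewrite /defect sqn_tens1; congr (_ - _); apply: eq_bigr => k _; rewrite form_tens1.
have besP n p : 0 <= defect idc (tens1 \o y) n p.
  have := @opos_dense (1 - \sum_(k < n) rank_one (tens1 (y k))) p.
  rewrite (form_rank_one_rest (tens1 \o y)); last exact: idcP.
  by apply=> v; rewrite (form_rank_one_rest (tens1 \o y)) /= ?defE //; exact: idcP.
split=> // p; apply: (exhausted_approx idcP besP) => e e0.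
have se : 0 < Num.sqrt e by rewrite sqrtr_gt0.
have [v hv] := tens1_dense p se; exists (tens1 v).
  by move=> d d0; have [n hn] := ex v _ d0; exists n; rewrite defE.
by rewrite -nrm_sqn -[ltRHS]sqr_sqrtr ?(ltW e0) // ltr_pXn2r ?nnegrE ?nrm_ge0 ?sqrtr_ge0.
Qed.

(** Parseval twice: expand [|X e|^2] along the frame, exchange the sums, and sum over the
    orthonormal basis. *)
Lemma postrace_push (y : nat -> E) T (X : adjointable P) : local_frame chi y ->
  is_push_op T X -> postrace (astar X * X) = hs_sum chi y T.
Proof.
move=> hy TX; have /is_push_opE TXs := is_push_op_star TX.
have [B1 _] := onbP P.
rewrite /postrace -(hs_sum_star hchi hy).
transitivity (\esum_(e in @onb R P) (N (X e))%:E)%E.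
  by apply: eq_esum => e _; rewrite /sqn /form amulE ip_adjr astarK.
under eq_esum do rewrite -(frame_parseval (push_frame hy)).
rewrite esum_exchange => [|e j]; last by rewrite lee_fin sqr_ge0.
apply: eq_esum => j _; rewrite -sqn_tens1 -(parseval _ (onbP P)).
by apply: eq_esum => e _; rewrite form_adjr TXs nrm_formC //; exact: idcP.
Qed.

Lemma postrace_abs2 (y : nat -> E) T (X : adjointable P) : local_frame chi y ->
  is_push_op T X -> postrace (apow (aabs X) 2) = hs_sum chi y T.
Proof.
move=> hy TX; rewrite -(postrace_push hy TX) -aabs_sq.
by rewrite /apow /=; congr postrace; exact: adj_ext.
Qed.

(** If [Y] localizes the square root of [|T|], then [Y^* Y] is positive with square [X^* X]; by
    uniqueness it is [|X|]. *)
Lemma postrace_abs1 (y : nat -> E) T (X : adjointable P) : local_frame chi y ->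
  is_push_op T X -> postrace (apow (aabs X) 1) = hs_sum chi y (asqrt (aabs T)).
Proof.
move=> hy TX; set Q := asqrt (aabs T).
have Tp := aabs_opos T.
have Qp : opos Q := asqrt_opos Tp; have Q2 : Q * Q = aabs T := asqrt_sq Tp.
have [Y [Y1 Y2]] := push_exists Q.
have QY : is_push_op Q Y by apply/is_push_opE.
have Ys : astar Y = Y by apply: push_unique => v; rewrite Y2 Y1 Qp.1.
rewrite -(postrace_push hy QY); congr postrace.
have -> : apow (aabs X) 1 = aabs X by exact: adj_ext.
apply: aabs_eq; first exact: opos_starM.
apply: push_unique => v; rewrite Ys.
have /is_push_opE -> : is_push_op (astar T * T) (astar X * X).
  by apply: is_push_opM => //; exact: is_push_op_star.
have /is_push_opE -> : is_push_op (Q * Q * (Q * Q)) (Y * Y * (Y * Y)).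
  by do ![apply: is_push_opM => //].
by rewrite Q2 aabs_sq.
Qed.

End Pushforward.

(** * Limits of bounded sequences along an ultrafilter *)

Section UltraLimit.
Variable R : realType.

Lemma ultralimit_exists : exists U : set_system nat,
  [/\ ProperFilter U, forall m, U [set n | (m <= n)%N] &
   forall (u : nat -> R) (c : R), (forall n, `|u n| <= c) ->
     exists l : R, u n @[n --> U] --> l].
Proof.
have [U [UU oU]] := ultraFilterLemma (F := \oo) _.
exists U; split=> [|m|u c uc].
- exact: ultra_proper.
- by apply: oU; exists m.
have PU : ProperFilter U := @ultra_proper _ _ UU.
have Ui : U (u @^-1` `[- c, c]%classic).
  by apply: filterE => n /=; rewrite in_itv /= -ler_norml.
have [l [_ hl]] := @segment_compact R (- c) c (u n @[n --> U]) _ Ui.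
exists l => V lV.
have [//|VC] := in_ultra_setVsetC (u @^-1` V) UU.
have [x [nVx Vx]] := hl (~` V) V VC lV.
by case: nVx.
Qed.

End UltraLimit.

(** * Dini's theorem on the space of characters *)

Section Dini.
Variables (R : realType) (A : commCStarAlgType R).
Local Notation C := R[i].

Lemma normRe_nrm (z : C) : `|complex.Re z| <= nrm (z : C^o).
Proof. by rewrite nrm_complexE -sqrtr_sqr ler_wsqrtr // lerDl sqr_ge0. Qed.

Lemma normIm_nrm (z : C) : `|complex.Im z| <= nrm (z : C^o).
Proof. by rewrite nrm_complexE -sqrtr_sqr ler_wsqrtr // lerDr sqr_ge0. Qed.

(* A limit of characters along an ultrafilter is a character as soon as it is
   nonzero: this replaces the weak-* compactness of the set of characters. *)
Lemma dini (b : nat -> A) :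
  (forall chi n, is_character chi -> chi (b n) = (complex.Re (chi (b n)))%:C) ->
  (forall chi n, is_character chi -> 0 <= complex.Re (chi (b n))) ->
  (forall chi n m, is_character chi -> (n <= m)%N ->
     complex.Re (chi (b m)) <= complex.Re (chi (b n))) ->
  (forall chi, is_character chi -> vanishing (fun n => complex.Re (chi (b n)))) ->
  vanishing (fun n => nrm (b n)).
Proof.
move=> breal b0 banti bv e e0; apply: contrapT => H.
have be n : e <= nrm (b n) by rewrite leNgt; apply/negP => h; apply: H; exists n.
have ex n : exists chi : A -> C, is_character chi /\ e <= complex.Re (chi (b n)).
  have bn0 : b n != 0.
    by apply/eqP => E; have := be n; rewrite E nrm0 leNgt e0.
  have [chi [hchi chib]] := exists_character bn0; exists chi; split=> //.
  by rewrite -[leRHS]ger0_norm ?b0 // -nrm_real -breal // chib.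
pose X n := sval (cid (ex n)).
have hX n : is_character (X n) by exact: (svalP (cid (ex n))).1.
have eX n : e <= complex.Re (X n (b n)) := (svalP (cid (ex n))).2.
have [U [PU Uge Ulim]] := ultralimit_exists R.
have exRe x : exists l : R, complex.Re (X n x) @[n --> U] --> l.
  apply: (Ulim _ (nrm x)) => n.
  by apply: le_trans (normRe_nrm _) _; exact: chi_le.
have exIm x : exists l : R, complex.Im (X n x) @[n --> U] --> l.
  apply: (Ulim _ (nrm x)) => n.
  by apply: le_trans (normIm_nrm _) _; exact: chi_le.
pose lr x := sval (cid (exRe x)); pose li x := sval (cid (exIm x)).
have lrP x : complex.Re (X n x) @[n --> U] --> lr x by exact: (svalP (cid (exRe x))).
have liP x : complex.Im (X n x) @[n --> U] --> li x by exact: (svalP (cid (exIm x))).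
have uniq (u : nat -> R) (l l' : R) : u n @[n --> U] --> l -> u n @[n --> U] --> l' -> l = l'.
  by move=> h h'; apply: (cvg_unique (@norm_hausdorff R R) h h').
have lim_ge (u : nat -> R) (l r : R) m : u n @[n --> U] --> l ->
    (forall n, (m <= n)%N -> r <= u n) -> r <= l.
  move=> ul h; rewrite -(cvg_lim (@norm_hausdorff R R) ul).
  apply: limr_ge; first by apply/cvg_ex; exists l.
  by apply: filterS (Uge m) => n /=; exact: h.
pose chi x : C := (lr x +i* li x)%C.
have lin (z : C) x y : chi (z *: x + y) = z * chi x + chi y.
  case: z => p q; rewrite /chi /=; congr (_ +i* _)%C.
    apply: uniq (lrP _) _.
    have -> : (fun n => complex.Re (X n ((p +i* q)%C *: x + y))) =
      ((fun n => p * complex.Re (X n x)) - (fun n => q * complex.Im (X n x)))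
        + (fun n => complex.Re (X n y)).
      apply/funext => n; rewrite (chiD (hX n)) (chiZ (hX n)).
      by rewrite !fctE; case: (X n x) (X n y) => [? ?] [? ?].
    apply: cvgD => //; apply: cvgB; apply: cvgMl_tmp => //.
  apply: uniq (liP _) _.
  have -> : (fun n => complex.Im (X n ((p +i* q)%C *: x + y))) =
    ((fun n => p * complex.Im (X n x)) + (fun n => q * complex.Re (X n x)))
      + (fun n => complex.Im (X n y)).
    apply/funext => n; rewrite (chiD (hX n)) (chiZ (hX n)).
    by rewrite !fctE; case: (X n x) (X n y) => [? ?] [? ?].
  by apply: cvgD => //; apply: cvgD; apply: cvgMl_tmp.
have mul x y : chi (cmul x y) = chi x * chi y.
  rewrite /chi /=; congr (_ +i* _)%C.
    apply: uniq (lrP _) _.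
    have -> : (fun n => complex.Re (X n (cmul x y))) =
      (fun n => complex.Re (X n x)) \* (fun n => complex.Re (X n y))
        - (fun n => complex.Im (X n x)) \* (fun n => complex.Im (X n y)).
      apply/funext => n; rewrite (chiM (hX n)) !fctE /=.
      by case: (X n x) (X n y) => [? ?] [? ?].
    by apply: cvgB; apply: cvgM.
  apply: uniq (liP _) _.
  have -> : (fun n => complex.Im (X n (cmul x y))) =
    ((fun n => complex.Re (X n x)) \* (fun n => complex.Im (X n y)))
      + ((fun n => complex.Im (X n x)) \* (fun n => complex.Re (X n y))).
    apply/funext => n; rewrite (chiM (hX n)) !fctE /=.
    by case: (X n x) (X n y) => [? ?] [? ?].
  by apply: cvgD; apply: cvgM.
have star x : chi (cstar x) = (chi x)^*%C.
  rewrite /chi /=; congr (_ +i* _)%C.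
    apply: uniq (lrP _) _.
    have -> : (fun n => complex.Re (X n (cstar x))) = (fun n => complex.Re (X n x)).
      by apply/funext => n; rewrite (chi_star (hX n)); case: (X n x).
    exact: lrP.
  apply: uniq (liP _) _.
  have -> : (fun n => complex.Im (X n (cstar x))) = - (fun n => complex.Im (X n x)).
    by apply/funext => n; rewrite (chi_star (hX n)) !fctE; case: (X n x).
  exact: cvgN.
(* For [m >= n] monotonicity gives [X m (b n) >= X m (b m) >= e]. In the limit this shows that [chi]
   is nonzero and also contradicts pointwise convergence. *)
have ge n : e <= complex.Re (chi (b n)).
  apply: (lim_ge _ _ _ n (lrP (b n))) => m nm.
  by apply: le_trans (eX m) _; exact: banti.
have hchi : is_character chi.
  split; [|split; [|split]] => //.
  by exists (b 0%N) => /(congr1 (@complex.Re R)) /= E; have := ge 0%N; rewrite /= E leNgt e0.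
by have [n] := bv _ hchi _ e0; rewrite ltNge ge.
Qed.

End Dini.

(** * Complex series and polarization *)

Section ComplexSums.
Variable R : realType.
Local Notation C := R[i].
Implicit Types (f g : nat -> C) (l m : C).

Definition csum f l := forall d : R, 0 < d -> exists N, forall n, (N <= n)%N ->
  nrm (l - \sum_(j < n) f j : C^o) <= d.

Lemma csum_uniq f l m : csum f l -> csum f m -> l = m.
Proof.
move=> fl fm; apply/eqP; rewrite -subr_eq0; apply/eqP/(@nrm_small_eq0 R C^o) => d d0.
have d2 : 0 < d / 2 by rewrite divr_gt0.
have [[N hN] [M hM]] := (fl _ d2, fm _ d2).
have h1 := hN _ (leq_maxl N M); have h2 := hM _ (leq_maxr N M).
apply: le_trans (nrm_triangle _ (\sum_(j < maxn N M) f j : C^o) _) _.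
by rewrite [X in _ + X](nrmB (\sum_(j < _) _ : C^o)) [d]splitr lerD.
Qed.

Lemma csumD f g l m : csum f l -> csum g m -> csum (fun j => f j + g j) (l + m).
Proof.
move=> fl gm d d0; have d2 : 0 < d / 2 by rewrite divr_gt0.
have [[N hN] [M hM]] := (fl _ d2, gm _ d2); exists (maxn N M) => n.
rewrite geq_max => /andP[Nn Mn]; rewrite big_split /= opprD addrACA.
apply: le_trans (nrmD (_ : C^o) _) _.
by rewrite [d]splitr; apply: lerD; [exact: hN|exact: hM].
Qed.

Lemma csumZ (z : C) f l : csum f l -> csum (fun j => z * f j) (z * l).
Proof.
move=> fl d d0; have z0 : 0 < nrm (z : C^o) + 1 by rewrite ltr_wpDl // nrm_ge0.
have [N hN] := fl _ (divr_gt0 d0 z0); exists N => n Nn.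
rewrite -mulr_sumr -mulrBr nrm_complexM.
have := hN n Nn; rewrite ler_pdivlMr // => h; apply: le_trans h.
by rewrite mulrC ler_wpM2l ?nrm_ge0 // lerDl.
Qed.

Lemma eq_csum f g l : f =1 g -> csum f l -> csum g l.
Proof.
move=> fg fl d /fl[N hN]; exists N => n /hN.
by under eq_bigr do rewrite fg.
Qed.

Lemma csumB f g l m : csum f l -> csum g m -> csum (fun j => f j - g j) (l - m).
Proof.
move=> fl /(csumZ (-1)); rewrite mulN1r => gm.
by apply: eq_csum (csumD fl gm) => j; rewrite mulN1r.
Qed.

Lemma esum_nat_inv (a : nat -> R) (s : R) : (forall k, 0 <= a k) ->
  (\esum_(k in [set: nat]) (a k)%:E = s%:E)%E ->
  (forall n, \sum_(k < n) a k <= s) /\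
  (forall d, 0 < d -> exists n, s - d < \sum_(k < n) a k).
Proof.
move=> a0 E; split=> [n|d d0].
  rewrite -lee_fin -E; apply: esum_ge; exists [set` index_iota 0 n].
    by split=> //; exact: finite_seq.
  by rewrite -fsbig_seq ?iota_uniq //= sumEFin lee_fin big_mkord.
apply: contrapT => H; have : ((s - d)%:E < s%:E)%E by rewrite lte_fin ltrBlDr ltrDl.
rewrite -E ltNge => /negP; apply; apply: ge_ereal_sup => _ [F [finF _] <-].
rewrite fsbig_finite //= sumEFin lee_fin.
apply: (@le_trans _ _ (\sum_(k < (\max_(k <- finmap.enum_fset (fset_set F)) k).+1) a k)).
  rewrite -(big_mkord xpredT a); apply: sum_uniq_le => //.
  - exact: finmap.fset_uniq.
  - exact: iota_uniq.
  - by move=> k kF; rewrite mem_index_iota /= ltnS; exact: leq_bigmax_seq.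
by rewrite leNgt; apply/negP => h; apply: H; eexists; exact: h.
Qed.

Lemma sum_mono (a : nat -> R) (n m : nat) : (forall k, 0 <= a k) -> (n <= m)%N ->
  \sum_(k < n) a k <= \sum_(k < m) a k.
Proof.
move=> a0 nm; rewrite -!(big_mkord xpredT a) (big_cat_nat _ nm) //= lerDl.
exact: sumr_ge0.
Qed.

Lemma csum_esum (a : nat -> R) (s : R) : (forall k, 0 <= a k) ->
  (\esum_(k in [set: nat]) (a k)%:E = s%:E)%E -> csum (fun k => (a k)%:C) s%:C.
Proof.
move=> a0 /(esum_nat_inv a0)[ub ap] d d0; have [N hN] := ap _ d0.
exists N => n Nn; rewrite -rmorph_sum -rmorphB nrm_real ger0_norm ?subr_ge0 //.
have := sum_mono a0 Nn; lra.
Qed.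

Lemma esum_csum (a : nat -> R) (l : C) : (forall k, 0 <= a k) ->
  csum (fun k => (a k)%:C) l ->
  l = (complex.Re l)%:C /\ (\esum_(k in [set: nat]) (a k)%:E = (complex.Re l)%:E)%E.
Proof.
move=> a0 al; have near d : 0 < d -> exists N, forall n, (N <= n)%N ->
    `|complex.Re l - \sum_(k < n) a k| <= d /\ `|complex.Im l| <= d.
  move=> d0; have [N hN] := al _ d0; exists N => n /hN h.
  split; apply: le_trans h.
    apply: le_trans (normRe_nrm _); rewrite -rmorph_sum.
    by case: (l) => x y.
  apply: le_trans (normIm_nrm _); rewrite -rmorph_sum.
  by case: (l) => x y /=; rewrite subr0.
split.
  have I0 : complex.Im l = 0.
    apply/eqP; rewrite -normr_eq0 eq_le normr_ge0 andbT.
    apply/ler_addgt0Pr => d d0; rewrite add0r.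
    by have [N hN] := near _ d0; have [] := hN N (leqnn _).
  by case: (l) I0 => x y /= ->.
apply: esum_natP => // [n|d d0].
  apply/ler_addgt0Pr => d d0; have [N hN] := near _ d0.
  have [h _] := hN _ (leq_maxl N n); have := sum_mono a0 (leq_maxr N n).
  by move: h; rewrite ler_norml => /andP[? ?]; lra.
have [N hN] := near _ d0; exists N; have [h _] := hN N (leqnn _).
by move: h; rewrite ler_norml => /andP[? ?]; lra.
Qed.

Lemma csum_polarization (r : 'I_4 -> C) (F : 'I_4 -> nat -> C) :
  (forall k, csum (F k) (r k)) ->
  csum (fun j => 4%:R^-1 * \sum_(k < 4) 'i%C ^+ k * F k j)
    (4%:R^-1 * \sum_(k < 4) 'i%C ^+ k * r k).
Proof.
move=> H; apply: csumZ; rewrite !big_ord_recr !big_ord0 /= add0r.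
apply: eq_csum (csumD (csumD (csumD (csumZ _ (H _)) (csumZ _ (H _)))
  (csumZ _ (H _))) (csumZ _ (H _))) => j.
by rewrite !big_ord_recr !big_ord0 /= add0r.
Qed.

End ComplexSums.

(** * Hilbert-Schmidt operators at one character *)

Section LocalTrace.
Variables (R : realType) (A : commCStarAlgType R) (E : hilbertModType A).
Implicit Types (u v w : E) (S T U V Y Z : adjointable E).
Local Notation C := R[i].
Variables (chi : A -> C) (y : nat -> E).
Hypotheses (hchi : is_character chi) (hy : local_frame chi y).
Local Notation N := (sqn chi).
Local Notation F := (form chi).

Definition hs T := exists r : R, hs_sum chi y T = r%:E.

Let N0 v : 0 <= N v. Proof. exact: sqn_ge0. Qed.

Lemma hs_bounded T : hs T -> exists K, forall n, \sum_(j < n) N (T (y j)) <= K.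
Proof.
move=> [r hr]; exists r.
by have [] := esum_nat_inv (fun k => N0 (T (y k))) hr.
Qed.

Lemma hs_of_bounded T (K : R) : (forall n, \sum_(j < n) N (T (y j)) <= K) -> hs T.
Proof.
move=> TK; pose s := sup (range (fun n => \sum_(j < n) N (T (y j)))).
have supP : has_sup (range (fun n => \sum_(j < n) N (T (y j)))).
  by split; [exists (\sum_(j < 0) N (T (y j))), 0%N|exists K => _ [n _ <-]].
exists s; apply: esum_natP => // [n|d d0].
  by apply: ub_le_sup; [exact: supP.2|exists n].
have [_ [n _ <-] h] := sup_adherent d0 supP.
by exists n; exact: ltW.
Qed.

Lemma hs_le T U (k : R) : 0 <= k -> hs T ->
  (forall j, N (U (y j)) <= k * N (T (y j))) -> hs U.
Proof.
move=> k0 /hs_bounded[K hK] h; apply: (@hs_of_bounded _ (k * K)) => n.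
apply: (@le_trans _ _ (k * \sum_(j < n) N (T (y j)))); last by rewrite ler_wpM2l.
by rewrite mulr_sumr; apply: ler_sum => j _.
Qed.

Lemma hsD T U : hs T -> hs U -> hs (T + U).
Proof.
move=> /hs_bounded[K hK] /hs_bounded[L hL].
apply: (@hs_of_bounded _ (2 * K + 2 * L)) => n.
apply: le_trans (lerD (ler_wpM2l (ler0n _ 2) (hK n)) (ler_wpM2l (ler0n _ 2) (hL n))).
rewrite !mulr_sumr -big_split; apply: ler_sum => j _ /=.
exact: sqnD_le.
Qed.

Lemma hsZ (z : C) T : hs T -> hs (z *: T).
Proof.
move=> hT; apply: (hs_le (sqr_ge0 (nrm (z : C^o))) hT) => j.
by rewrite ascaleE (sqnZ hchi).
Qed.

Lemma hs_star T : hs T -> hs (astar T).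
Proof. by move=> [r hr]; exists r; rewrite (hs_sum_star hchi hy). Qed.

Lemma hsMl Y T : hs T -> hs (Y * T).
Proof.
move=> hT; have [c c0 Yc] := adj_bounded Y.
apply: (hs_le (sqr_ge0 c) hT) => j.
by rewrite amulE; apply: sqn_bnd => //; exact: ltW.
Qed.

Lemma hsMr Y T : hs T -> hs (T * Y).
Proof.
by move=> /hs_star /(hsMl (astar Y)) /hs_star; rewrite astarM !astarK.
Qed.

Lemma form_polarization v w :
  F v w = 4%:R^-1 * \sum_(k < 4) 'i%C ^+ k * (N (w + 'i%C ^+ k *: v))%:C.
Proof.
have -> : \sum_(k < 4) 'i%C ^+ k * (N (w + 'i%C ^+ k *: v))%:C = 4%:R * F v w.
  rewrite !big_ord_recr big_ord0 /= add0r.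
  rewrite !(sqnD hchi) !(sqnZ hchi) !(formZr hchi) (formC hchi v w).
  rewrite !nrm_iX !expr1n !mul1r; move: (N v) (N w) (F v w) => a b [c d].
  rewrite !exprS expr0 !mulr1 -!mulrA.
  have -> : 4%:R = 4%:C :> C by rewrite (rmorph_nat (@real_complex R)).
  by simpc => /=; congr (_ +i* _)%C; ring.
by rewrite mulKf // pnatr_eq0.
Qed.

(** The polarized form of [hs_sum_star]: both series have the same four squared norms in their
    polarization. *)
Lemma hs_pairing U V : hs U -> hs V -> exists l,
  csum (fun j => F (U (y j)) (V (y j))) l /\
  csum (fun j => F (astar V (y j)) (astar U (y j))) l.
Proof.
move=> hU hV.
pose G (k : 'I_4) := V + 'i%C ^+ k *: U.
have hG k : hs (G k) by apply: hsD => //; exact: hsZ.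
pose r k := sval (cid (hG k)).
have rP k : hs_sum chi y (G k) = (r k)%:E := svalP (cid (hG k)).
exists (4%:R^-1 * \sum_(k < 4) 'i%C ^+ k * (r k)%:C); split.
  have H (k : 'I_4) := csum_esum (fun j => N0 (G k (y j))) (rP k).
  apply: eq_csum (csum_polarization H) => j.
  by rewrite form_polarization.
(* The adjoint conjugates the phase on [U]; multiplying by [i^k] moves the phase to [V] and changes
   no norm. *)
have GE (k : 'I_4) : 'i%C ^+ k *: astar (G k) = astar U + 'i%C ^+ k *: astar V.
  by rewrite astarD astarZ scalerDr scalerA iXconj scale1r addrC.
have rP' (k : 'I_4) : hs_sum chi y (astar U + 'i%C ^+ k *: astar V) = (r k)%:E.
  rewrite -GE -rP -(hs_sum_star hchi hy (G k)).
  apply: eq_esum => j _; rewrite ascaleE (sqnZ hchi).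
  by rewrite nrm_iX expr1n mul1r.
have H (k : 'I_4) := csum_esum (fun j => N0 ((astar U + 'i%C ^+ k *: astar V) (y j))) (rP' k).
apply: eq_csum (csum_polarization H) => j.
by rewrite form_polarization.
Qed.

Lemma hs_trace_cyclic S T : hs S -> hs T -> exists l,
  csum (fun j => F (y j) ((S * T) (y j))) l /\
  csum (fun j => F (y j) ((T * S) (y j))) l.
Proof.
move=> hS hT; have [l [h1 h2]] := hs_pairing (hs_star hS) hT.
exists l; split.
  by apply: eq_csum h1 => j; rewrite form_adjl astarK amulE.
by apply: eq_csum h2 => j; rewrite form_adjl !astarK amulE.
Qed.

(** The tails of the series are small uniformly in [n], being dominated by those of [U] and [V]; on
    the remaining finite head the factor [t n] decides. *)
Lemma dominated_vanishing U V (Z : nat -> adjointable E) (l : nat -> C) (t : nat -> R) :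
  hs U -> hs V -> (forall n, bnd (Z n) 1) ->
  (forall n, 0 < t n) -> vanishing t -> (forall n m, (n <= m)%N -> t m <= t n) ->
  (forall n v, N ((Z n * U) v) <= t n ^+ 2 * N v) ->
  (forall n, csum (fun j => F (V (y j)) ((Z n * U) (y j))) (l n)) ->
  forall d, 0 < d -> exists n0, forall n, (n0 <= n)%N -> nrm (l n : C^o) <= d.
Proof.
move=> hU hV Z1 t0 tv tanti Zt hl d d0.
(* A weighted Cauchy-Schwarz: [s = t n] on the head, where [N b] is of order [t n ^ 2], and [s = 1]
   on the tail. *)
have form_le (a b : E) (s : R) : 0 < s -> nrm (F a b : C^o) <= s * N a + N b / s.
  move=> s0; have sN : 0 <= N b / s.
    exact: divr_ge0 (N0 b) (ltW s0).
  have sM : 0 <= s * N a by exact: mulr_ge0 (ltW s0) (N0 a).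
  rewrite -(@ler_pXn2r _ 2) ?nnegrE ?nrm_ge0 ?addr_ge0 //.
  apply: le_trans (cauchy_schwarz hchi _ _) _.
  have -> : N a * N b = (s * N a) * (N b / s) by field; rewrite gt_eqF.
  rewrite sqrrD; nra.
have [rU hrU] := hU; have [rV hrV] := hV.
have [ubU apU] := esum_nat_inv (fun k => N0 (U (y k))) hrU.
have [ubV apV] := esum_nat_inv (fun k => N0 (V (y k))) hrV.
have d4 : 0 < d / 4 by rewrite divr_gt0.
have [[J1 hJ1] [J2 hJ2]] := (apU _ d4, apV _ d4).
pose J := maxn J1 J2.
pose M := \sum_(j < J) (N (V (y j)) + N (y j)).
have M0 : 0 <= M by apply: sumr_ge0 => j _; rewrite addr_ge0.
have M1 : 0 < M + 1 by rewrite ltr_wpDl.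
have [n0 hn0] := tv _ (divr_gt0 d4 M1); exists n0 => n n0n.
have tn : t n * M <= d / 4.
  have : t n * (M + 1) <= d / 4.
    by rewrite -ler_pdivlMr //; apply: le_trans (tanti _ _ n0n) _; exact: ltW.
  by have := t0 n; nra.
apply/ler_addgt0Pr => e e0; have [K hK] := hl n _ e0.
pose m := maxn K J; have Jm : (J <= m)%N by exact: leq_maxr.
have := hK m (leq_maxl _ _).
set s := \sum_(j < m) _ => hs'.
suff hs1 : nrm (s : C^o) <= d.
  apply: le_trans (_ : nrm (l n - s : C^o) + nrm (s : C^o) <= _); last by rewrite addrC lerD.
  by rewrite -{1}[l n](subrK s); exact: nrmD.
have sum_le (I : Type) (r : seq I) (P : pred I) (f : I -> C) (g : I -> R) :
    (forall i, P i -> nrm (f i : C^o) <= g i) ->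
    nrm (\sum_(i <- r | P i) f i : C^o) <= \sum_(i <- r | P i) g i.
  move=> fg; elim/big_rec2: _ => [|i a b Pi IH]; first by rewrite nrm0.
  by apply: le_trans (nrmD _ _) _; apply: lerD => //; exact: fg.
rewrite /s -(big_mkord xpredT (fun j => F (V (y j)) ((Z n * U) (y j)))).
rewrite (big_cat_nat _ Jm) //=.
apply: le_trans (nrmD _ _) _.
have head : nrm (\sum_(0 <= j < J) F (V (y j)) ((Z n * U) (y j)) : C^o) <= d / 4.
  apply: le_trans tn; rewrite /M mulr_sumr.
  rewrite -(big_mkord xpredT (fun j => t n * (N (V (y j)) + N (y j)))).
  apply: sum_le => j _; apply: le_trans (form_le _ _ (t n) (t0 n)) _.
  rewrite mulrDr lerD2l ler_pdivrMr ?t0 //; apply: le_trans (Zt n (y j)) _.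
  by rewrite expr2 -!mulrA mulrC -!mulrA [N _ * _]mulrC.
have tail (W : adjointable E) (rW : R) J' : (J' <= J)%N ->
    (forall k, \sum_(j < k) N (W (y j)) <= rW) ->
    rW - d / 4 < \sum_(j < J') N (W (y j)) -> \sum_(J <= j < m) N (W (y j)) <= d / 4.
  move=> JJ ub ap; have := ub m; have := sum_mono (fun j => N0 (W (y j))) JJ.
  have -> : \sum_(j < m) N (W (y j))
      = \sum_(j < J) N (W (y j)) + \sum_(J <= j < m) N (W (y j)).
    by rewrite -!(big_mkord xpredT (fun j => N (W (y j)))) (big_cat_nat _ Jm).
  lra.
have tU := tail U rU J1 (leq_maxl _ _) ubU hJ1.
have tV := tail V rV J2 (leq_maxr _ _) ubV hJ2.
have tl : nrm (\sum_(J <= j < m) F (V (y j)) ((Z n * U) (y j)) : C^o)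
    <= \sum_(J <= j < m) N (V (y j)) + \sum_(J <= j < m) N (U (y j)).
  rewrite -big_split /=; apply: sum_le => j _.
  apply: le_trans (form_le _ _ 1 ltr01) _; rewrite mul1r divr1 lerD2l.
  by have := sqn_bnd (U (y j)) hchi (Z1 n) ler01; rewrite expr1n mul1r.
lra.
Qed.

End LocalTrace.

(** * The trace as a series over the frame *)

Section TraceFormula.
Variables (R : realType) (A : commCStarAlgType R) (E : hilbertModType A).
Implicit Types (u v w : E) (a b c : A) (S T U V X : adjointable E).
Local Notation C := R[i].
Variable y : nat -> E.
Hypothesis hy : forall chi : A -> C, is_character chi -> local_frame chi y.
Hypothesis pushP : forall chi : A -> C, is_character chi ->
  inhabited (pushforward chi E).

(** The frame counterpart of [is_tr_abs_pow 2], equivalent to it and free of pushforwards. *)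
Definition tr_sq T a := forall chi : A -> C, is_character chi ->
  chi a = (complex.Re (chi a))%:C /\ hs_sum chi y T = (complex.Re (chi a))%:E.

Lemma tr_sq_is_tr_abs_pow T a : tr_sq T a -> is_tr_abs_pow 2 T a.
Proof.
move=> H chi hchi; have [chia hsa] := H _ hchi; have [P] := pushP hchi.
have [X [X1 _]] := push_exists hchi P T.
have TX : is_push_op T X by apply/is_push_opE.
exists (complex.Re (chi a)); split=> //; exists P, X; split=> //.
by rewrite -hsa (postrace_abs2 hchi (hy hchi) TX).
Qed.

Lemma is_tr_abs_pow2_tr_sq T a : is_tr_abs_pow 2 T a -> tr_sq T a.
Proof.
move=> H chi hchi; have [r [[P [X [TX hr]]] ->]] := H _ hchi; split=> //.
by rewrite -(postrace_abs2 hchi (hy hchi) TX) -hr.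
Qed.

Lemma is_tr_abs_pow1_tr_sq T a :
  is_tr_abs_pow 1 T a -> tr_sq (asqrt (aabs T)) a.
Proof.
move=> H chi hchi; have [r [[P [X [TX hr]]] ->]] := H _ hchi; split=> //.
by rewrite -(postrace_abs1 hchi (hy hchi) TX) -hr.
Qed.

Lemma tr_sq_tr_abs_pow T a : tr_sq T a -> tr_sq T (tr_abs_pow 2 T).
Proof.
move=> /tr_sq_is_tr_abs_pow Ta; rewrite /tr_abs_pow.
by case: xgetP => [b _ /is_tr_abs_pow2_tr_sq|/(_ a)].
Qed.

Lemma tr_sq_star T a : tr_sq T a -> tr_sq (astar T) a.
Proof.
move=> H chi hchi; have [h1 h2] := H _ hchi; split=> //.
by rewrite (hs_sum_star hchi (hy hchi)).
Qed.

Lemma tr_sq_eq S T a : astar S * S = astar T * T -> tr_sq T a -> tr_sq S a.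
Proof.
move=> ST H chi hchi; have [h1 h2] := H _ hchi; split=> //; rewrite -h2.
by apply: eq_esum => j _; rewrite (sqn_starM_eq _ _ ST).
Qed.

Lemma tr_sqZ (z : C) T a : nrm (z : C^o) = 1 -> tr_sq T a -> tr_sq (z *: T) a.
Proof.
move=> z1 H chi hchi; have [h1 h2] := H _ hchi; split=> //; rewrite -h2.
by apply: eq_esum => j _; rewrite ascaleE (sqnZ hchi) z1 expr1n mul1r.
Qed.

Let psum T n : A := \sum_(j < n) ip (T (y j)) (T (y j)).

Let chi_psum T n (chi : A -> C) : is_character chi ->
  chi (psum T n) = (\sum_(j < n) sqn chi (T (y j)))%:C.
Proof.
move=> hchi; rewrite /psum (chi_sum hchi) rmorph_sum; apply: eq_bigr => j _.
exact: form_self.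
Qed.

(** Finiteness at each [chi] is easy; the point is to find [c] in [A]. The sum [g n] of the two
    remainders decreases to 0 pointwise, hence in norm by [dini], and [2 g n] dominates the
    increments of the partial sums for [T + U], which therefore converge in [A]. *)
Lemma tr_sqD T U a b : tr_sq T a -> tr_sq U b -> exists c, tr_sq (T + U) c.
Proof.
move=> Ta Ub.
pose g n : A := (a - psum T n) + (b - psum U n).
pose gr (chi : A -> C) n : R := (complex.Re (chi a) - \sum_(j < n) sqn chi (T (y j)))
  + (complex.Re (chi b) - \sum_(j < n) sqn chi (U (y j))).
have chig chi n : is_character chi -> chi (g n) = (gr chi n)%:C.
  move=> hchi; have [h1 _] := Ta _ hchi; have [h2 _] := Ub _ hchi.
  by rewrite /g (chiD hchi) !(chiB hchi) !chi_psum // h1 h2 -!rmorphB -rmorphD.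
have Reg chi n : is_character chi -> complex.Re (chi (g n)) = gr chi n.
  by move=> hchi; rewrite chig.
have N0 chi v : is_character chi -> 0 <= sqn chi v by move=> hchi; exact: sqn_ge0.
have inv chi V c : is_character chi -> tr_sq V c ->
    (forall n, \sum_(j < n) sqn chi (V (y j)) <= complex.Re (chi c)) /\
    (forall d, 0 < d -> exists n, complex.Re (chi c) - d < \sum_(j < n) sqn chi (V (y j))).
  move=> hchi Vc; have [_ h] := Vc _ hchi.
  exact: (esum_nat_inv (fun k => N0 chi (V (y k)) hchi) h).
have mono chi V n m : is_character chi -> (n <= m)%N ->
    \sum_(j < n) sqn chi (V (y j)) <= \sum_(j < m) sqn chi (V (y j)).
  by move=> hchi nm; apply: (@sum_mono R (fun j => sqn chi (V (y j)))) => // k; exact: N0.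
have gr0 chi n : is_character chi -> 0 <= gr chi n.
  move=> hchi; have [h1 _] := inv _ _ _ hchi Ta; have [h2 _] := inv _ _ _ hchi Ub.
  by have := h1 n; have := h2 n; rewrite /gr; lra.
have gr_anti chi n m : is_character chi -> (n <= m)%N -> gr chi m <= gr chi n.
  move=> hchi nm; have := mono chi T _ _ hchi nm; have := mono chi U _ _ hchi nm.
  by rewrite /gr; lra.
have gv : vanishing (fun n => nrm (g n)).
  apply: dini => [chi n hchi|chi n hchi|chi n m hchi nm|chi hchi d d0].
  - by rewrite chig.
  - by rewrite Reg ?gr0.
  - by rewrite !Reg ?gr_anti.
  have d2 : 0 < d / 2 by rewrite divr_gt0.
  have [_ h1] := inv _ _ _ hchi Ta; have [_ h2] := inv _ _ _ hchi Ub.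
  have [[n hn] [m hm]] := (h1 _ d2, h2 _ d2); exists (maxn n m); rewrite Reg // /gr.
  have := mono chi T _ _ hchi (leq_maxl n m); have := mono chi U _ _ hchi (leq_maxr n m).
  lra.
have g_anti n m : (n <= m)%N -> nrm (g m) <= nrm (g n).
  move=> nm; apply: nrm_le_chi => [|chi hchi]; first exact: nrm_ge0.
  rewrite chig // nrm_real ger0_norm ?gr0 //; apply: le_trans (gr_anti _ _ _ hchi nm) _.
  by rewrite -[leLHS]ger0_norm ?gr0 // -nrm_real -chig //; exact: chi_le.
have gv2 : vanishing (fun n => 2 * nrm (g n)).
  move=> d d0; have [n hn] := gv _ (divr_gt0 d0 (ltr0n _ 2)); exists n; lra.
have [n m nm|c hc] := complete_rate gv2 (u := psum (T + U)).
  apply: nrm_le_chi => [|chi hchi]; first by rewrite mulr_ge0 ?nrm_ge0.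
  rewrite (chiB hchi) !chi_psum // -rmorphB nrm_real ger0_norm; last first.
    by rewrite subr_ge0 mono.
  apply: (@le_trans _ _ (2 * gr chi n)); last first.
    rewrite ler_wpM2l // -[leLHS]ger0_norm ?gr0 // -nrm_real -chig //.
    exact: chi_le.
  have split V : \sum_(j < m) sqn chi (V (y j)) =
      \sum_(j < n) sqn chi (V (y j)) + \sum_(n <= j < m) sqn chi (V (y j)).
    by rewrite -!(big_mkord xpredT (fun j => sqn chi (V (y j)))) (big_cat_nat _ nm).
  have [h1 _] := inv _ _ _ hchi Ta; have [h2 _] := inv _ _ _ hchi Ub.
  have := h1 m; have := h2 m; rewrite !split /gr => k1 k2.
  have : \sum_(n <= j < m) sqn chi ((T + U) (y j)) <=
     2 * \sum_(n <= j < m) sqn chi (T (y j)) + 2 * \sum_(n <= j < m) sqn chi (U (y j)).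
    rewrite !mulr_sumr -big_split /=; apply: ler_sum => j _.
    exact: sqnD_le.
  lra.
exists c => chi hchi.
apply: esum_csum => [k|d d0]; first exact: N0.
have [n hn] := gv2 _ d0; exists n => m nm.
have -> : \sum_(j < m) (sqn chi ((T + U) (y j)))%:C = chi (psum (T + U) m).
  by rewrite chi_psum // rmorph_sum.
rewrite -(chiB hchi).
apply: le_trans (chi_le hchi _) _; apply: le_trans (hc m) _.
by have := g_anti _ _ nm; lra.
Qed.

Lemma csum_ip2 S T a b : tr_sq S a -> tr_sq T b ->
  forall chi : A -> C, is_character chi ->
    csum (fun j => form chi (S (y j)) (T (y j))) (chi (ip2 S T)).
Proof.
move=> Sa Tb chi hchi.
have H (k : 'I_4) : csum (fun j => (sqn chi ((T + 'i%C ^+ k *: S) (y j)))%:C)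
    (chi (tr_abs_pow 2 (aadd T (ascale ('i%C ^+ k) S)))).
  have [c hc] := tr_sqD Tb (tr_sqZ (nrm_iX R k) Sa).
  have [h1 h2] := tr_sq_tr_abs_pow hc hchi; rewrite h1.
  by apply: csum_esum h2 => j; exact: sqn_ge0.
have -> : chi (ip2 S T) = 4%:R^-1 * \sum_(k < 4) 'i%C ^+ k
    * chi (tr_abs_pow 2 (aadd T (ascale ('i%C ^+ k) S))).
  rewrite /ip2 (chiZ hchi) (chi_sum hchi); congr (_ * _).
  by apply: eq_bigr => k _; rewrite (chiZ hchi).
apply: eq_csum (csum_polarization H) => j.
by rewrite (form_polarization hchi).
Qed.

(** [W] is the weak polar factor and [Q] the square root of [|X|]. As [W^* W = Q^2], both have
    squared Hilbert-Schmidt norm [tr |X|]. *)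
Lemma trace_factors X a : is_tr_abs_pow 1 X a -> exists W Q,
  [/\ X = W * Q, opos Q, astar W * W = Q * Q, Q * Q * (Q * Q) = astar X * X &
   forall chi : A -> C, is_character chi -> [/\ hs chi y W, hs chi y Q &
     csum (fun j => form chi (y j) (X (y j))) (chi (tr X))]].
Proof.
move=> Xa; have Qa := is_tr_abs_pow1_tr_sq Xa.
pose Q := asqrt (aabs X); have Pp := aabs_opos X.
have Qp : opos Q := asqrt_opos Pp; have Q2 : Q * Q = aabs X := asqrt_sq Pp.
rewrite /tr -/Q; case: xgetP => [W _ [XW WQ]|H]; last first.
  (* Excludes the default value [aid] in the definition of [tr]. *)
  have [S [XS SS]] := weak_polar_exists X.
  by case: (H S); split=> //; apply: aabs_eq => //; rewrite Q2.
have WW : astar W * W = Q * Q by rewrite -(WQ : aabs W = Q) aabs_sq.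
have Wa : tr_sq W a by apply: tr_sq_eq Qa; rewrite WW Qp.1.
exists W, Q; split=> //; first by rewrite Q2 aabs_sq.
move=> chi hchi; split.
- by have [_ h] := Wa _ hchi; exists (complex.Re (chi a)).
- by have [_ h] := Qa _ hchi; exists (complex.Re (chi a)).
apply: eq_csum (csum_ip2 (tr_sq_star Wa) Qa hchi) => j.
by rewrite form_adjl astarK {2}XW.
Qed.

End TraceFormula.

(** * Regularization and cyclicity *)

Section CyclicTrace.
Variables (R : realType) (A : commCStarAlgType R) (E : hilbertModType A).
Implicit Types (u v w : E) (a b : A) (S T U V X Y : adjointable E).
Local Notation C := R[i].

Lemma csum_conj (f : nat -> C) (l : C) :
  csum f l -> csum (fun j => (f j)^*%C) l^*%C.
Proof.
move=> fl d /fl[N hN]; exists N => n /hN; apply: le_trans.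
rewrite -rmorph_sum -rmorphB !nrm_complexE.
by case: (l - _) => x z /=; rewrite sqrrN.
Qed.

Lemma nrm_conj (z : C) : nrm (z^*%C : C^o) = nrm (z : C^o).
Proof. by rewrite !nrm_complexE; case: z => x z /=; rewrite sqrrN. Qed.

Lemma sqn_sq_le (chi : A -> C) V w : is_character chi ->
  sqn chi (V w) ^+ 2 <= sqn chi w * sqn chi ((astar V * V) w).
Proof.
move=> hchi; have := cauchy_schwarz hchi w ((astar V * V) w).
rewrite amulE -form_adjl (form_self hchi) nrm_real.
by rewrite real_normK ?num_real.
Qed.

(** From [|V w|^2 <= |w| |V^* V w|] at [w = Y v]: decay of [V^* V Y] passes to [V Y] with the square
    root of the rate. *)
Lemma bnd_sqrt V Y (t : R) : 0 <= t -> bnd Y 1 ->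
  (forall chi v, is_character chi ->
     sqn chi ((astar V * V) (Y v)) <= t ^+ 4 * sqn chi v) ->
  bnd (V * Y) t.
Proof.
move=> t0 Y1 H; apply: bnd_sqn => // chi v hchi.
have v0 := sqn_ge0 hchi v.
rewrite -(@ler_pXn2r _ 2) ?nnegrE ?(sqn_ge0 hchi) ?mulr_ge0 ?sqr_ge0 //.
rewrite amulE; apply: le_trans (sqn_sq_le _ _ hchi) _.
have := sqn_bnd v hchi Y1 ler01; rewrite expr1n mul1r => h1.
have -> : (t ^+ 2 * sqn chi v) ^+ 2 = sqn chi v * (t ^+ 4 * sqn chi v) by ring.
by apply: ler_pM => //; [exact: sqn_ge0|exact: sqn_ge0|exact: H].
Qed.

(** Move [W] to the end of [W (Q Y)], then [Q] to the end of [Q (Y W)]; the two series met halfway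
    coincide. *)
Lemma trace_comm (chi : A -> C) (y : nat -> E) W Q Y :
  is_character chi -> local_frame chi y -> hs chi y W -> hs chi y Q ->
  exists l, csum (fun j => form chi (y j) ((W * Q * Y) (y j))) l /\
    csum (fun j => form chi (y j) ((Y * (W * Q)) (y j))) l.
Proof.
move=> hchi hy hW hQ.
have [l [h1 h2]] := hs_trace_cyclic hchi hy hW (hsMr hchi hy Y hQ).
have [m [h3 h4]] := hs_trace_cyclic hchi hy (hsMl hchi Y hW) hQ.
exists l; rewrite -mulrA; split=> //.
rewrite mulrA; have -> // : l = m.
by rewrite mulrA in h4; exact: csum_uniq h2 h4.
Qed.

Section Regularization.
Variables (S T : adjointable E) (c : R).
Hypotheses (c0 : 0 < c) (Sc : bnd S c).
(** Dividing by [c^2] makes [B] and [B'] contractions while leaving [S] as it is. *)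
Let s : C := ((c ^+ 2)^-1)%:C.
Let B := s *: (astar S * S).
Let B' := s *: (S * astar S).
Let D := 1 - B.
Let D' := 1 - B'.

Let scaled_opos T' : opos T' -> opos (s *: T').
Proof. by apply: oposZ; rewrite invr_ge0 sqr_ge0. Qed.

Let scaled_bnd T' : bnd T' (c ^+ 2) -> bnd (s *: T') 1.
Proof.
move=> T'c; have c2 : c ^+ 2 != 0 by rewrite sqrf_eq0 gt_eqF.
by rewrite -(mulVf c2); apply: bndZr => //; rewrite invr_ge0 sqr_ge0.
Qed.

Let Bp : opos B. Proof. exact/scaled_opos/opos_starM. Qed.
Let B'p : opos B'.
Proof. by apply: scaled_opos; rewrite -{1}(astarK S); exact: opos_starM. Qed.
Let B1 : bnd B 1.
Proof.
by apply: scaled_bnd; rewrite expr2; apply: bndM; [exact: ltW|exact: bnd_star|].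
Qed.
Let B'1 : bnd B' 1.
Proof.
by apply: scaled_bnd; rewrite expr2; apply: bndM; [exact: ltW| |exact: bnd_star].
Qed.
Let Dn1 n : bnd (D ^+ n) 1. Proof. exact/bndX/opos_compl_bnd. Qed.
Let D'n1 n : bnd (D' ^+ n) 1. Proof. exact/bndX/opos_compl_bnd. Qed.
Let Dns n : astar (D ^+ n) = D ^+ n.
Proof. by rewrite astarX astarB astar1 Bp.1. Qed.
Let D'ns n : astar (D' ^+ n) = D' ^+ n.
Proof. by rewrite astarX astarB astar1 B'p.1. Qed.

Let SD n : S * D ^+ n = D' ^+ n * S.
Proof.
have SD1 : S * D = D' * S.
  by rewrite mulrBr mulrBl mulr1 mul1r -ascalerAl -ascalerAr mulrA.
elim: n => [|n IH]; first by rewrite !expr0 mulr1 mul1r.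
by rewrite exprSr mulrA IH -mulrA SD1 mulrA -exprSr.
Qed.

Let SsD n : astar S * D' ^+ n = D ^+ n * astar S.
Proof. by rewrite -(D'ns n) -astarM -SD astarM Dns. Qed.

Let G n := s *: (astar S * neumann B' n).

Let SG n : S * G n = 1 - D' ^+ n.
Proof. by rewrite -ascalerAr mulrA ascalerAl neumann_mul. Qed.

Let GS n : G n * S = 1 - D ^+ n.
Proof.
(* The intertwining [SsD] moves [astar S] across the Neumann sum, so the same [G n] regularizes [S]
   on both sides. *)
have -> : G n = s *: (neumann B n * astar S).
  rewrite /G; congr (_ *: _); rewrite mulr_sumr mulr_suml.
  by apply: eq_bigr => k _; exact: SsD.
by rewrite -ascalerAl -mulrA ascalerAr -(neumann_comm n (erefl (B * B))) neumann_mul.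
Qed.

Let S_decay n chi v : is_character chi ->
  sqn chi ((S * D ^+ n) v) <= c ^+ 2 * (sqn chi v / n.+1%:R).
Proof.
move=> hchi; rewrite amulE; set w := (D ^+ n) v.
rewrite [sqn chi (S _)]/sqn form_adjl -(amulE (astar S) S).
have -> : astar S * S = (c ^+ 2)%:C *: B.
  rewrite scalerA -rmorphM /= divff ?rmorph1 ?scale1r //.
  by rewrite sqrf_eq0 gt_eqF.
rewrite ascaleE (formZr hchi); have := decay Bp B1 v n hchi; rewrite -/D -/w.
case: (form _ _ _) => x z /= h; rewrite mul0r subr0.
by rewrite ler_wpM2l ?sqr_ge0.
Qed.

Variables (y : nat -> E) (chi : A -> C).
Hypotheses (hchi : is_character chi) (hy : local_frame chi y).

(* [S (G n) -> 1] on the range of [S]: cyclicity for the trace class operators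
   [S T] and [T S] yields [tr (S (G n) S T) = tr (T S (G n) S)]. *)
Lemma trace_regularized W Q W' Q' (n : nat) (l l' : C) :
  S * T = W * Q -> T * S = W' * Q' ->
  hs chi y W -> hs chi y Q -> hs chi y W' -> hs chi y Q' ->
  csum (fun j => form chi (y j) ((S * T) (y j))) l ->
  csum (fun j => form chi (y j) ((T * S) (y j))) l' ->
  exists m, csum (fun j => form chi (y j) ((D' ^+ n * (W * Q)) (y j))) (l - m) /\
    csum (fun j => form chi (y j) ((W' * Q' * D ^+ n) (y j))) (l' - m).
Proof.
move=> STE TSE hW hQ hW' hQ' hl hl'.
have [m [h1 h2]] := trace_comm (S * G n) hchi hy hW hQ.
(* Here [T S (G n)] is factored as [W' (Q' (G n))]. Its commutation with [S] leads to
   [tr (S T S (G n))], the number [m] already reached from [S T]. *)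
have [m' [h3 h4]] := trace_comm S hchi hy hW' (hsMr hchi hy (G n) hQ').
have mm' : m = m'.
  have E1 : W * Q * (S * G n) = S * (W' * (Q' * G n)).
    by rewrite (mulrA W') -TSE -STE !mulrA.
  by rewrite E1 in h1; exact: csum_uniq h1 h4.
subst m'; exists m; split.
  apply: eq_csum (csumB hl h2) => j.
  rewrite SG mulrBl mul1r asubE STE (formDr hchi) (formNr hchi).
  by rewrite opprB addrC subrK.
apply: eq_csum (csumB hl' h3) => j.
rewrite (mulrA W') -(mulrA _ (G n)) GS mulrBr mulr1 asubE TSE (formDr hchi) (formNr hchi).
by rewrite opprB addrC subrK.
Qed.

Lemma local_trace_comm W Q W' Q' (l l' : C) :
  S * T = W * Q -> T * S = W' * Q' -> opos Q -> opos Q' ->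
  astar W * W = Q * Q -> Q' * Q' * (Q' * Q') = astar (T * S) * (T * S) ->
  hs chi y W -> hs chi y Q -> hs chi y W' -> hs chi y Q' ->
  csum (fun j => form chi (y j) ((S * T) (y j))) l ->
  csum (fun j => form chi (y j) ((T * S) (y j))) l' ->
  l = l'.
Proof.
move=> STE TSE Qp Q'p WW Q'4 hW hQ hW' hQ' hl hl'.
have [d d0 Td] := adj_bounded T.
pose e n : R := (c * d) ^+ 2 / n.+1%:R.
(* [e n] bounds a squared norm, which accounts for one root; [bnd_sqrt] costs the other. *)
pose t n : R := Num.sqrt (Num.sqrt (e n)).
have cd : 0 < (c * d) ^+ 2 by rewrite exprn_gt0 // mulr_gt0.
have e0 n : 0 < e n by rewrite divr_gt0.
have t0 n : 0 < t n by rewrite !sqrtr_gt0.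
have t4 n : t n ^+ 4 = e n.
  by rewrite -[4%N]/(2 * 2)%N exprM !sqr_sqrtr ?sqrtr_ge0 // ltW.
have tv : vanishing t.
  by apply: vanishing_sqrt; apply: vanishing_sqrt; exact: vanishing_harmonic.
have tanti n m : (n <= m)%N -> t m <= t n.
  move=> nm; rewrite /t !ler_wsqrtr // ler_wpM2l ?(ltW cd) //.
  by rewrite lef_pV2 ?posrE ?ltr0n // ler_nat.
have STdecay n : bnd (D' ^+ n * (S * T)) (Num.sqrt (e n)).
  apply: bnd_sqn => [|chi' v hchi']; first exact: sqrtr_ge0.
  rewrite sqr_sqrtr ?(ltW (e0 n)) // mulrA -SD amulE.
  apply: le_trans (S_decay n (T v) hchi') _.
  have -> : e n * sqn chi' v = c ^+ 2 * (d ^+ 2 * sqn chi' v / n.+1%:R).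
    by rewrite /e exprMn; field; rewrite addrC natr1 pnatr_eq0.
  rewrite ler_wpM2l ?sqr_ge0 // ler_wpM2r ?invr_ge0 //.
  by apply: sqn_bnd => //; exact: ltW.
(* By [bnd_sqrt] for [V = astar W] it is enough to treat [W W^* D' ^ n]. Under [sqn] the first [W]
   may be replaced by [Q], and [Q W^* D' ^ n] is the adjoint of [D' ^ n S T]. *)
have bW n : bnd (D' ^+ n * W) (t n).
  have -> : D' ^+ n * W = astar (astar W * D' ^+ n) by rewrite astarM astarK D'ns.
  apply: bnd_star; apply: bnd_sqrt => [||chi' v hchi']; [exact: ltW|exact: D'n1|].
  rewrite astarK amulE t4.
  have -> : sqn chi' (W (astar W ((D' ^+ n) v))) = sqn chi' (Q (astar W ((D' ^+ n) v))).
    by apply: sqn_starM_eq; rewrite WW Qp.1.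
  have := sqn_bnd v hchi' (bnd_star (STdecay n)) (sqrtr_ge0 _).
  by rewrite sqr_sqrtr ?(ltW (e0 n)) // astarM STE astarM D'ns Qp.1.
(* Likewise for [V = Q']: under [sqn], [Q'^2] may be replaced by [T S], and [S D ^ n] decays. *)
have bQ' n : bnd (D ^+ n * Q') (t n).
  have -> : D ^+ n * Q' = astar (Q' * D ^+ n) by rewrite astarM Dns Q'p.1.
  apply: bnd_star; apply: bnd_sqrt => [||chi' v hchi']; [exact: ltW|exact: Dn1|].
  rewrite t4.
  have -> : sqn chi' ((astar Q' * Q') ((D ^+ n) v)) = sqn chi' ((T * S) ((D ^+ n) v)).
    by apply: sqn_starM_eq; rewrite Q'p.1 astarM Q'p.1.
  rewrite amulE; apply: le_trans (sqn_bnd _ hchi' Td (ltW d0)) _.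
  have := S_decay n v hchi'; rewrite amulE => h.
  have -> : e n * sqn chi' v = d ^+ 2 * (c ^+ 2 * (sqn chi' v / n.+1%:R)).
    by rewrite /e exprMn; field; rewrite addrC natr1 pnatr_eq0.
  by rewrite ler_wpM2l ?sqr_ge0.
have reg n := trace_regularized n STE TSE hW hQ hW' hQ' hl hl'.
pose m n := sval (cid (reg n)).
have [mP mP'] := (fun n => (svalP (cid (reg n))).1, fun n => (svalP (cid (reg n))).2).
apply/eqP; rewrite -subr_eq0; apply/eqP/(@nrm_small_eq0 R C^o) => r r0.
have r2 : 0 < r / 2 by rewrite divr_gt0.
have [n1 hn1] : exists n0, forall n, (n0 <= n)%N -> nrm (l - m n : C^o) <= r / 2.
  apply: (dominated_vanishing hchi hW hQ D'n1 t0 tv tanti _ _ r2) => [n v|n].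
    by apply: sqn_bnd => //; exact: ltW.
  have [k [h1 h2]] := hs_trace_cyclic hchi hy (hsMl hchi (D' ^+ n) hW) hQ.
  rewrite -mulrA in h1; rewrite (csum_uniq (mP n) h1).
  by apply: eq_csum h2 => j; rewrite amulE form_adjr Qp.1.
(* Conjugation exchanges the two slots of the form and brings the decaying product [D ^ n Q'] into
   the second one. *)
have [n2 hn2] : exists n0, forall n, (n0 <= n)%N -> nrm ((l' - m n)^*%C : C^o) <= r / 2.
  apply: (dominated_vanishing hchi hQ' hW' Dn1 t0 tv tanti _ _ r2) => [n v|n].
    by apply: sqn_bnd => //; exact: ltW.
  have [k [h1 h2]] := hs_trace_cyclic hchi hy hW' (hsMr hchi hy (D ^+ n) hQ').
  rewrite mulrA in h1; rewrite (csum_uniq (mP' n) h1).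
  apply: eq_csum (csum_conj h2) => j.
  by rewrite -(formC hchi) (amulE (Q' * D ^+ n) W') form_adjl astarM Dns Q'p.1.
have k1 := hn1 _ (leq_maxl n1 n2); have k2 := hn2 _ (leq_maxr n1 n2).
rewrite nrm_conj in k2; set k := maxn n1 n2 in k1 k2.
have -> : l - l' = (l - m k) - (l' - m k) by rewrite opprB addrA subrK.
by apply: le_trans (nrmD _ _) _; rewrite nrmN [r]splitr lerD.
Qed.

End Regularization.
End CyclicTrace.

Theorem proposition3p40 (R : realType) (A : commCStarAlgType R)
    (E : hilbertModType A) (hE : countably_generated E)
    (S T : adjointable E)
    (hST : in_Lp 1 (acomp S T)) (hTS : in_Lp 1 (acomp T S)) :
  tr (acomp S T) = tr (acomp T S).
Proof.
have [a hST'] := hST; have [b hTS'] := hTS.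
have [y hy] := frame_exists hE.
(* Membership in [L^1] already provides a localization of [E] at every character. *)
have pushP (chi : A -> R[i]) : is_character chi -> inhabited (pushforward chi E).
  by move=> hchi; have [r [[P _] _]] := hST' _ hchi; constructor.
have [W [Q [STE Qp WW _ loc]]] := trace_factors hy pushP hST'.
have [W' [Q' [TSE Q'p _ Q'4 loc']]] := trace_factors hy pushP hTS'.
have [c c0 Sc] := adj_bounded S.
apply: chi_ext => chi hchi.
have [hW hQ hl] := loc _ hchi; have [hW' hQ' hl'] := loc' _ hchi.
exact: (local_trace_comm c0 Sc hchi (hy _ hchi) STE TSE Qp Q'p WW Q'4 hW hQ hW' hQ' hl hl').
Qed.
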